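(* There exists an absolute constant $\mathcal{Q}>0$ such that the following is true. Let $d\geqslant 2$ be a power of two and let $q$ be an odd prime power such that $$q\geqslant\max\left(\frac{d^4}{4},\,(2d+1)^2+1\right).$$ Let $\mathbf{K}$ be a field with $q$ elements. There exist a $[d,\,d/2,\,d/2+1]$ linear code $C$ over $\mathbf{K}$, a straight-line program that encodes $C$ at the expense of at most $\mathcal{Q}\,d\log(d)$ operations in $\mathbf{K}$, a straight-line program that checks $C$ at the expense of at most $\mathcal{Q}\,d\log(d)$ operations in $\mathbf{K}$, and a computation tree that corrects $C$ up to $d/4$ errors at the expense of at most $\mathcal{Q}\,d\log^2(d)\log(\log(d))$ operations and comparisons in $\mathbf{K}$.
   Context: A $[d,k,\delta]$ linear code over $\mathbf{K}$ is a $\mathbf{K}$-linear subspace of $\mathbf{K}^d$ of dimension $k$ whose minimum (Hamming) distance is $\delta$. A straight-line program over $\mathbf{K}$ is a finite sequence of operations in $\mathbf{K}$, without loops or conditionals, involving the inputs, precomputed constants in $\mathbf{K}$ (independent of the input), and previously computed elements. Its complexity is the number of operations; precomputation of constants is not counted. A computation tree is the analogous model in which, in addition to arithmetic operations in $\mathbf{K}$, one may branch according to comparisons (equality tests) between elements of $\mathbf{K}$; its cost is the maximal number of operations and comparisons along an execution path. *Encoding* $C$ means evaluating an injective $\mathbf{K}$-linear map $\mathbf{K}^{d/2}\to\mathbf{K}^d$ with image $C$ at a given message. *Checking* $C$ means computing, from a received word $w\in\mathbf{K}^d$, finitely many elements of $\mathbf{K}$ that all vanish if and only if $w\in C$. *Correcting*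 $C$ up to $d/4$ errors means computing, from any $w\in\mathbf{K}^d$ at Hamming distance at most $d/4$ from some codeword $c\in C$, this codeword $c$. In the complexity bound, the factor $\log(\log(d))$ is to be read as $\max(1,\log(\log(d)))$. *)

(* Defs.v *)
From mathcomp Require Import all_boot all_order all_algebra.
From mathcomp Require Import reals exp.

Set Implicit Arguments.
Unset Strict Implicit.
Unset Printing Implicit Defensive.

Import Order.TTheory GRing.Theory Num.Theory.
Local Open Scope ring_scope.

Definition prime_power (q : nat) : Prop :=
  exists p e : nat, [/\ prime p, (0 < e)%N & q = (p ^ e)%N].

Definition hamming_dist (K : fieldType) (n : nat) (u v : 'rV[K]_n) : nat :=
  #|[set i : 'I_n | u 0 i != v 0 i]|.

Definition min_dist (K : fieldType) (n : nat) (C : {vspace 'rV[K]_n})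
    (delta : nat) : Prop :=
  (exists u v : 'rV[K]_n,
     [/\ u \in C, v \in C, u != v & hamming_dist u v = delta]) /\
  (forall u v : 'rV[K]_n, u \in C -> v \in C -> u != v ->
     (delta <= hamming_dist u v)%N).

Definition linear_code (K : fieldType) (n k delta : nat)
    (C : {vspace 'rV[K]_n}) : Prop :=
  \dim C = k /\ min_dist C delta.

(* The memory of a program is a sequence that starts as the list of inputs and
   to which every operation appends its result: [Reg j] is the j-th input if j
   is less than the number of inputs, and otherwise the result of an earlier
   operation. Constants are operands, hence free of charge. *)
Inductive operand (K : Type) : Type :=
| Const of K
| Reg of nat.

Inductive arith : Type := Add | Sub | Mul | Div.

Record instr (K : Type) : Type := Instr {
  instr_op : arith;
  instr_l : operand K;
  instr_r : operand K
}.

Definition operand_eval (K : Type) (mem : seq K) (o : operand K) : option K :=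
  match o with
  | Const c => Some c
  | Reg j => onth mem j
  end.

Fixpoint operands_eval (K : Type) (mem : seq K) (os : seq (operand K)) :
    option (seq K) :=
  match os with
  | [::] => Some [::]
  | o :: os' =>
      if operand_eval mem o is Some x then
        omap (cons x) (operands_eval mem os')
      else None
  end.

(* Division by zero aborts the computation: with the convention x / 0 = 0,
   straight-line programs could perform zero tests. *)
Definition arith_eval (K : fieldType) (op : arith) (x y : K) : option K :=
  match op with
  | Add => Some (x + y)
  | Sub => Some (x - y)
  | Mul => Some (x * y)
  | Div => if y == 0 then None else Some (x / y)
  end.

Definition instr_eval (K : fieldType) (mem : seq K) (i : instr K) : option K :=
  match operand_eval mem (instr_l i), operand_eval mem (instr_r i) with
  | Some x, Some y => arith_eval (instr_op i) x y
  | _, _ => None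
  end.

Record slp (K : Type) : Type := Slp {
  slp_code : seq (instr K);
  slp_out : seq (operand K)
}.

Fixpoint code_eval (K : fieldType) (mem : seq K) (code : seq (instr K)) :
    option (seq K) :=
  match code with
  | [::] => Some mem
  | i :: code' =>
      if instr_eval mem i is Some x then code_eval (rcons mem x) code'
      else None
  end.

Definition slp_eval (K : fieldType) (P : slp K) (input : seq K) :
    option (seq K) :=
  if code_eval input (slp_code P) is Some mem then
    operands_eval mem (slp_out P)
  else None.

Definition slp_cost (K : Type) (P : slp K) : nat := size (slp_code P).

Inductive ctree (K : Type) : Type :=
| Return of seq (operand K)
| Compute of instr K & ctree K
| TestEq of operand K & operand K & ctree K & ctree K.

Fixpoint ctree_eval (K : fieldType) (t : ctree K) (mem : seq K) :
    option (seq K) :=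
  match t with
  | Return out => operands_eval mem out
  | Compute i t' =>
      if instr_eval mem i is Some x then ctree_eval t' (rcons mem x) else None
  | TestEq a b t_eq t_neq =>
      match operand_eval mem a, operand_eval mem b with
      | Some x, Some y =>
          if x == y then ctree_eval t_eq mem else ctree_eval t_neq mem
      | _, _ => None
      end
  end.

Fixpoint ctree_cost (K : Type) (t : ctree K) : nat :=
  match t with
  | Return _ => 0
  | Compute _ t' => (ctree_cost t').+1
  | TestEq _ _ t_eq t_neq => (maxn (ctree_cost t_eq) (ctree_cost t_neq)).+1
  end.

Definition row_seq (K : Type) (n : nat) (v : 'rV[K]_n) : seq K :=
  [seq v ord0 i | i <- enum 'I_n].

Definition encodes (K : fieldType) (k n : nat) (P : slp K)
    (C : {vspace 'rV[K]_n}) : Prop :=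
  exists f : 'Hom('rV[K]_k, 'rV[K]_n),
    [/\ injective f, limg f = C
      & forall m : 'rV[K]_k, slp_eval P (row_seq m) = Some (row_seq (f m))].

Definition checks (K : fieldType) (n : nat) (P : slp K)
    (C : {vspace 'rV[K]_n}) : Prop :=
  forall w : 'rV[K]_n, exists2 s : seq K,
    slp_eval P (row_seq w) = Some s & all (fun x => x == 0) s = (w \in C).

(* The error bound is the rational number a / b, so that no rounding of d / 4
   is involved. Nothing is required on words that are too far from C. *)
Definition corrects (K : fieldType) (n : nat) (T : ctree K)
    (C : {vspace 'rV[K]_n}) (a b : nat) : Prop :=
  forall w c : 'rV[K]_n, c \in C -> (b * hamming_dist w c <= a)%N ->
    ctree_eval T (row_seq w) = Some (row_seq c).

(* Main.v *)
Require Import Defs.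
From HB Require Import structures.
From mathcomp Require Import all_boot all_order all_algebra.
From mathcomp Require Import finfield ring lra zify.
From mathcomp Require Import boolp reals exp.

Set Implicit Arguments.
Unset Strict Implicit.
Unset Printing Implicit Defensive.

Import Order.TTheory GRing.Theory Num.Theory.
Local Open Scope ring_scope.

(** The code is a Reed-Solomon code at the points [x] of an isogeny-graph
    "ECFFT" tree: the parent of [x] at level [l.+1] is [(x - c)^2 / x], which is
    the abscissa map of a 2-isogeny [E_{l+1} -> E_l], and a polynomial of degree
    less than [2 n] splits as [X^(n-1) (f0 (psi) + X f1 (psi))] with
    [psi = (X - c)^2 / X], which halves the problem at each level. We start
    from [O(log d)] roots, where the encoding is naive.

    A chain of curves with enough rational 2-power torsion is obtained without
    class field theory or the Weil bounds: the parameters of the chain are the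
    successive square roots (the arithmetic-geometric mean, and the halving of a
    point of order 2) that generate a tower of quadratic extensions of [K(x)],
    and Stepanov's method shows that the corresponding curve has a rational
    point as soon as [q] is of the order of [d^4]. A rational point [Q] of [E_k]
    then has a root [phi^k Q] whose fibre is entirely rational: the obstruction
    to lifting a point [V] of [E_i] is the class of [x(V) + al_i^2] modulo
    squares, and it is constant on the fibre, because two points of the fibre
    differ by a combination of points of the 2-power torsion whose own
    obstruction is trivial. Stepanov's bound also gives enough such roots.

    Decoding is that of general Reed-Solomon codes. The fraction
    [sum u_i w_i / (1 - x_i z)] modulo [z^(d/2)] only depends on the error; a
    minimal approximant basis gives the locator, its values give the positions,
    and the values of the error follow from Forney's formula. All products of
    polynomials are computed by the Schonhage-Strassen algorithm, in
    [O(n log n loglog n)]. *)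

(** * Power series *)

(** The chain has about [2 k] parameters, each a quadratic step: the tower has degree near [4^k],
    and the error in its point count is of order [4^k k^2 sqrt q]. A rational point thus needs
    [(2^k k)^2] below a constant times [sqrt q], whereas the hypothesis gives [sqrt q >= d^2 / 2].
    So [2^k k] must stay a constant factor below [d], and this is why at least [64 log_2 d] roots
    are kept in place of a single one. Stepanov's method bounds a number of points from above. The
    lower bound for a double cover comes from the upper bound for its twist by a constant, so every
    radicand must remain a nonsquare after multiplication by any nonzero constant; norms carry this
    property up the tower. Points where a radicand vanishes are discarded; a single generic
    expansion, in a rescaled variable and without denominators, then serves at all points. In the
    decoder, the tests on the locator make the positions known in each branch of the tree. All that
    depends on them alone, inverses included, is then a constant, free of charge, and no division is
    ever performed. *)

Definition fps (R : Type) : Type := nat -> R.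

HB.instance Definition _ (R : Type) := gen_eqMixin (fps R).
HB.instance Definition _ (R : Type) := gen_choiceMixin (fps R).

Section FpsRing.
Variable R : comNzRingType.
Implicit Types (a b c : fps R) (p q : {poly R}).

Definition fps_add a b : fps R := fun i => a i + b i.
Definition fps_opp a : fps R := fun i => - a i.
Definition fps_zero : fps R := fun=> 0.
Definition fps_one : fps R := fun i => (i == 0)%:R.
Definition fps_mul a b : fps R := fun k => \sum_(i < k.+1) a i * b (k - i)%N.

Definition fps_trunc n a : {poly R} := \poly_(i < n) a i.

(** A coefficient of a product only sees truncations of the factors, so the ring laws are inherited
    from polynomials. *)
Lemma fps_mulE a b n k : (k < n)%N ->
  fps_mul a b k = (fps_trunc n a * fps_trunc n b)`_k.
Proof.
move=> ltkn; rewrite coefM; apply: eq_bigr => i _.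
have ltik := ltn_ord i.
by rewrite !coef_poly !ifT //; lia.
Qed.

Lemma coefM_trunc p q p' q' n k : (k < n)%N ->
    (forall i, (i < n)%N -> p`_i = p'`_i) ->
    (forall i, (i < n)%N -> q`_i = q'`_i) ->
  (p * q)`_k = (p' * q')`_k.
Proof.
move=> ltkn epp eqq; rewrite !coefM; apply: eq_bigr => i _.
have ltik := ltn_ord i.
by rewrite epp ?eqq //; lia.
Qed.

Lemma fps_trunc_mul a b n i : (i < n)%N ->
  (fps_trunc n (fps_mul a b))`_i = (fps_trunc n a * fps_trunc n b)`_i.
Proof. by move=> ltin; rewrite coef_poly ltin; exact: fps_mulE. Qed.

Lemma fps_addA : associative fps_add.
Proof. by move=> a b c; apply/funext => i; rewrite /fps_add addrA. Qed.
Lemma fps_addC : commutative fps_add.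
Proof. by move=> a b; apply/funext => i; rewrite /fps_add addrC. Qed.
Lemma fps_add0 : left_id fps_zero fps_add.
Proof. by move=> a; apply/funext => i; rewrite /fps_add add0r. Qed.
Lemma fps_addN : left_inverse fps_zero fps_opp fps_add.
Proof. by move=> a; apply/funext => i; rewrite /fps_add addNr. Qed.

HB.instance Definition _ := GRing.isZmodule.Build (fps R)
  fps_addA fps_addC fps_add0 fps_addN.

Lemma fps_mulA : associative fps_mul.
Proof.
move=> a b c; apply/funext => k; have ltkk := ltnSn k.
rewrite !(fps_mulE _ _ ltkk).
transitivity ((fps_trunc k.+1 a * (fps_trunc k.+1 b * fps_trunc k.+1 c))`_k).
  by apply: (coefM_trunc ltkk) => // i; exact: fps_trunc_mul.
rewrite mulrA; apply: (coefM_trunc ltkk) => // i lti.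
by rewrite fps_trunc_mul.
Qed.
Lemma fps_mulC : commutative fps_mul.
Proof. by move=> a b; apply/funext => k; rewrite !(fps_mulE _ _ (ltnSn k)) mulrC. Qed.
Lemma fps_mul1 : left_id fps_one fps_mul.
Proof.
move=> a; apply/funext => k; rewrite /fps_mul big_ord_recl /= /fps_one eqxx mul1r subn0.
by rewrite big1 ?addr0 // => i _; rewrite mul0r.
Qed.
Lemma fps_mulD : left_distributive fps_mul fps_add.
Proof.
move=> a b c; apply/funext => k; rewrite /fps_mul /fps_add -big_split /=.
by apply: eq_bigr => i _; rewrite mulrDl.
Qed.
Lemma fps_one_neq0 : fps_one != 0 :> fps R.
Proof.
apply/eqP => /(congr1 (fun a : fps R => a 0%N)) /=; rewrite /fps_one eqxx.
by move/eqP; rewrite oner_eq0.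
Qed.

HB.instance Definition _ := GRing.Zmodule_isComNzRing.Build (fps R)
  fps_mulA fps_mulC fps_mul1 fps_mulD fps_one_neq0.

Lemma fpsD a b i : (a + b) i = a i + b i. Proof. by []. Qed.
Lemma fpsN a i : (- a) i = - a i. Proof. by []. Qed.
Lemma fps0 i : (0 : fps R) i = 0. Proof. by []. Qed.
Lemma fps1 i : (1 : fps R) i = (i == 0)%:R. Proof. by []. Qed.
Lemma fpsM a b k : (a * b) k = \sum_(i < k.+1) a i * b (k - i)%N.
Proof. by []. Qed.
Lemma fpsM0 a b : (a * b) 0%N = a 0%N * b 0%N.
Proof. by rewrite fpsM big_ord1. Qed.
Lemma fps_sum (I : Type) (r : seq I) (P : pred I) (F : I -> fps R) i :
  (\sum_(j <- r | P j) F j) i = \sum_(j <- r | P j) F j i.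
Proof. by elim/big_rec2: _ => //= j x y _ <-. Qed.

Lemma fpsX0 a n : (a ^+ n) 0%N = a 0%N ^+ n.
Proof. by elim: n => [|n IHn]; rewrite ?expr0 // !exprS fpsM0 IHn. Qed.

Definition low (m : nat) a := forall i, (i < m)%N -> a i = 0.

Lemma low0 a : low 0 a. Proof. by []. Qed.
Lemma low_le m n a : (m <= n)%N -> low n a -> low m a.
Proof. by move=> lemn la i ltim; apply: la; lia. Qed.
Lemma lowD m a b : low m a -> low m b -> low m (a + b).
Proof. by move=> la lb i lti; rewrite fpsD la ?lb ?addr0. Qed.
Lemma lowN m a : low m a -> low m (- a).
Proof. by move=> la i lti; rewrite fpsN la ?oppr0. Qed.
Lemma low_sum (I : Type) (r : seq I) (P : pred I) (F : I -> fps R) m :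
  (forall j, P j -> low m (F j)) -> low m (\sum_(j <- r | P j) F j).
Proof. by move=> lF i lti; rewrite fps_sum big1 // => j Pj; exact: lF. Qed.

Lemma fpsM_low m n a b : low m a -> low n b -> (a * b) (m + n)%N = a m * b n.
Proof.
move=> la lb; rewrite fpsM (bigD1 (inord m)) //= inordK; last lia.
rewrite big1 ?addr0 ?addKn // => i neq_i.
have neqim : i != m :> nat.
  by apply: contraNneq neq_i => eqim; apply/eqP/val_inj; rewrite /= inordK //; lia.
have := ltn_ord i; case: (ltnP i m) => [ltim _|lemi ltis]; first by rewrite la ?mul0r.
by rewrite lb ?mulr0 //; lia.
Qed.

Lemma lowM m n a b : low m a -> low n b -> low (m + n) (a * b).
Proof.
move=> la lb k ltk; rewrite fpsM big1 // => i _.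
have := ltn_ord i; case: (ltnP i m) => [ltim _|lemi lti]; first by rewrite la ?mul0r.
by rewrite lb ?mulr0 //; lia.
Qed.

Lemma lowX m a n : low m a -> low (m * n) (a ^+ n).
Proof.
by move=> la; elim: n => [|n IHn]; rewrite ?muln0 // mulnS exprS; exact: lowM.
Qed.

Lemma low_leadX m n a : low m a -> (a ^+ n) (m * n)%N = a m ^+ n.
Proof.
move=> la; elim: n => [|n IHn]; first by rewrite muln0.
by rewrite mulnS !exprS fpsM_low ?IHn //; exact: lowX.
Qed.

Definition fps_scale (u : R) a : fps R := fun i => u ^+ i * a i.

Fact fps_scale_additive u : zmod_morphism (fps_scale u).
Proof. by move=> a b; apply/funext => i; rewrite /fps_scale mulrBr. Qed.
HB.instance Definition _ u :=
  GRing.isZmodMorphism.Build (fps R) (fps R) (fps_scale u) (fps_scale_additive u).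

Fact fps_scale_multiplicative u : monoid_morphism (fps_scale u).
Proof.
split=> [|a b]; apply/funext => k.
  by rewrite /fps_scale fps1; case: eqP => [->|]; rewrite ?mulr1 ?mulr0.
rewrite /fps_scale !fpsM mulr_sumr; apply: eq_bigr => i _.
by rewrite mulrACA -exprD subnKC // -ltnS.
Qed.
HB.instance Definition _ u :=
  GRing.isMonoidMorphism.Build (fps R) (fps R) (fps_scale u)
    (fps_scale_multiplicative u).

Definition fps_const (u : R) : fps R := fun i => if i == 0 then u else 0.

Lemma fps_constM u a i : (fps_const u * a) i = u * a i.
Proof.
rewrite fpsM big_ord_recl subn0 big1 ?addr0 // => j _.
by rewrite /fps_const /= mul0r.
Qed.

End FpsRing.

Section FpsMap.
Variables (R S : comNzRingType) (g : {rmorphism R -> S}).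

Definition fps_map (a : fps R) : fps S := fun i => g (a i).

Fact fps_map_additive : zmod_morphism fps_map.
Proof. by move=> a b; apply/funext => i; rewrite /fps_map rmorphB. Qed.
HB.instance Definition _ :=
  GRing.isZmodMorphism.Build (fps R) (fps S) fps_map fps_map_additive.

Fact fps_map_multiplicative : monoid_morphism fps_map.
Proof.
split=> [|a b]; apply/funext => k; rewrite /fps_map.
  exact: rmorph_nat.
by rewrite !fpsM rmorph_sum; apply: eq_bigr => i _; rewrite rmorphM.
Qed.
HB.instance Definition _ :=
  GRing.isMonoidMorphism.Build (fps R) (fps S) fps_map fps_map_multiplicative.

End FpsMap.

Section FpsIdomain.
Variable K : idomainType.
Implicit Types a b : fps K.

Lemma lowM_cancel m n a b : low m a -> a m != 0 -> low (m + n) (a * b) -> low n b.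
Proof.
move=> la am0; elim: n => [|n IHn] lab; first exact: low0.
have lb : low n b by apply: IHn; apply: low_le lab; lia.
move=> i; rewrite ltnS leq_eqVlt => /predU1P [->|/lb//].
have := lab (m + n)%N; rewrite fpsM_low // addnS => /(_ (ltnSn _)) /eqP.
by rewrite mulf_eq0 (negPf am0) => /eqP.
Qed.

Lemma low_scale (c : K) m a : c != 0 -> low m (fps_scale c a) -> low m a.
Proof.
move=> c0 la i lti; have /eqP := la i lti.
by rewrite /fps_scale mulf_eq0 expf_eq0 (negPf c0) andbF => /eqP.
Qed.

End FpsIdomain.

Lemma fps_natE (R : comNzRingType) n i :
  (n%:R : fps R) i = if i == 0 then n%:R else 0.
Proof.
elim: n => [|n IHn]; first by rewrite if_same.
by rewrite !mulrSr fpsD IHn fps1; case: (i == 0); rewrite ?addr0.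
Qed.

Lemma fps_constX (R : comNzRingType) (c : R) n :
  fps_const c ^+ n = fps_const (c ^+ n).
Proof.
elim: n => [|n IHn]; apply/funext => i.
  by rewrite !expr0 fps1 /fps_const; case: (i == 0).
by rewrite !exprS IHn fps_constM /fps_const; case: (i == 0); rewrite ?mulr0.
Qed.

(** The [q]-th power is additive, and the part of [a] without constant term has a [q]-th power of
    order at least [q]. *)
Lemma fps_Frobenius (R : comNzRingType) (p q : nat) (a : fps R) i :
  p \in [pchar R] -> p.-nat q -> (0 < i < q)%N -> (a ^+ q) i = 0.
Proof.
move=> pcharR pq /andP [i0 iq].
have pcharF : p \in [pchar (fps R)].
  rewrite inE (pcharf_prime pcharR) /=; apply/eqP/funext => j.
  by rewrite fps_natE (pcharf0 pcharR) if_same.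
have -> : a = fps_const (a 0%N) + (a - fps_const (a 0%N)) by rewrite addrC subrK.
rewrite exprDn_pchar; last by rewrite (eq_pnat _ (pcharf_eq pcharF)).
have l1 : low 1 (a - fps_const (a 0%N)).
  by case=> // _; rewrite fpsD fpsN /fps_const subrr.
rewrite fpsD [X in _ + X](lowX l1) ?mul1n // addr0 fps_constX /fps_const.
by case: i i0 {iq}.
Qed.

(** * The ring [R[y] / (y^2 - f)] *)

Definition quad (R : comNzRingType) (f : R) : Type := (R * R)%type.
HB.instance Definition _ (R : comNzRingType) (f : R) :=
  GRing.Zmodule.copy (quad f) (R * R)%type.

Section Quad.
Variables (R : comNzRingType) (f : R).
Notation quad := (quad f).
Implicit Types u v w : quad.

Definition quad_one : quad := (1, 0).
Definition quad_mul u v : quad := (u.1 * v.1 + f * u.2 * v.2, u.1 * v.2 + u.2 * v.1).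

Lemma quad_mulA : associative quad_mul.
Proof. by move=> [a b] [c d] [e g]; congr pair => /=; ring. Qed.
Lemma quad_mulC : commutative quad_mul.
Proof. by move=> [a b] [c d]; congr pair => /=; ring. Qed.
Lemma quad_mul1 : left_id quad_one quad_mul.
Proof. by move=> [a b]; congr pair => /=; ring. Qed.
Lemma quad_mulD : left_distributive quad_mul +%R.
Proof. by move=> [a b] [c d] [e g]; congr pair => /=; ring. Qed.
Lemma quad_one_neq0 : quad_one != 0.
Proof. by apply/eqP => -[/eqP]; rewrite oner_eq0. Qed.

HB.instance Definition _ := GRing.Zmodule_isComNzRing.Build quad
  quad_mulA quad_mulC quad_mul1 quad_mulD quad_one_neq0.

Definition quad_in (a : R) : quad := (a, 0).
Definition quad_conj u : quad := (u.1, - u.2).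
Definition quad_y : quad := (0, 1).
Definition quad_norm u : R := u.1 ^+ 2 - f * u.2 ^+ 2.

Fact quad_in_additive : zmod_morphism quad_in.
Proof. by move=> a b; congr pair; rewrite /= subrr. Qed.
HB.instance Definition _ := GRing.isZmodMorphism.Build R quad quad_in quad_in_additive.
Fact quad_in_multiplicative : monoid_morphism quad_in.
Proof. by split=> // a b; congr pair => /=; ring. Qed.
HB.instance Definition _ :=
  GRing.isMonoidMorphism.Build R quad quad_in quad_in_multiplicative.

Fact quad_conj_additive : zmod_morphism quad_conj.
Proof. by move=> [a b] [c d]; congr pair => /=; ring. Qed.
HB.instance Definition _ :=
  GRing.isZmodMorphism.Build quad quad quad_conj quad_conj_additive.
Fact quad_conj_multiplicative : monoid_morphism quad_conj.
Proof. by split=> [|[a b] [c d]]; congr pair => /=; ring. Qed.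
HB.instance Definition _ :=
  GRing.isMonoidMorphism.Build quad quad quad_conj quad_conj_multiplicative.

Lemma quad_normE u : u * quad_conj u = quad_in (quad_norm u).
Proof. by case: u => a b; congr pair; rewrite /quad_norm /=; ring. Qed.

Lemma quad_normM u v : quad_norm (u * v) = quad_norm u * quad_norm v.
Proof. by case: u v => [a b] [c d]; rewrite /quad_norm /=; ring. Qed.

Lemma quad_y2 : quad_y ^+ 2 = quad_in f.
Proof. by rewrite expr2; congr pair => /=; ring. Qed.

Lemma quad_in_mul a u : quad_in a * u = (a * u.1, a * u.2).
Proof. by case: u => c d; congr pair => /=; ring. Qed.

End Quad.

(** The recursion is part of the conclusion because the pole orders of the coefficients are later
    bounded along it. *)
Lemma fps_half_sqrt (R : comNzRingType) (half : R) (phi : fps R) :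
    half *+ 2 = 1 -> phi 0%N = 1 ->
  exists g : fps R, [/\ g 0%N = 1,
      forall k, g k.+1 = half * (phi k.+1 - \sum_(i < k) g i.+1 * g (k - i)%N)
    & g ^+ 2 = phi].
Proof.
move=> half2 phi0.
(* A coefficient depends on all the previous ones, hence a recursion on the list of them. *)
pose fix gl (n : nat) : seq R := if n is k.+1 then
  rcons (gl k) (half * (phi k.+1 - \sum_(i < k) (gl k)`_i.+1 * (gl k)`_(k - i)%N))
  else [:: 1].
have size_gl n : size (gl n) = n.+1 by elim: n => //= n IHn; rewrite size_rcons IHn.
have glE n m : (n <= m)%N -> (gl m)`_n = (gl n)`_n.
  elim: m => [|m IHm]; first by case: n.
  rewrite leq_eqVlt => /predU1P [->//|ltnm].
  by rewrite /= nth_rcons size_gl ltnm IHm.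
pose g : fps R := fun n => (gl n)`_n; exists g.
have gS k : g k.+1 = half * (phi k.+1 - \sum_(i < k) g i.+1 * g (k - i)%N).
  rewrite /g /= nth_rcons size_gl ltnn eqxx; congr (_ * (_ - _)).
  by apply: eq_bigr => i _; rewrite !(glE _ k) // ?leq_subr // ltn_ord.
split=> //; apply/funext => -[|k]; first by rewrite fpsX0 phi0 expr1n.
rewrite expr2 fpsM big_ord_recl /= subn0 [X in X * _](_ : _ = 1) // mul1r.
rewrite big_ord_recr /= subnn [X in _ * X](_ : _ = 1) // mulr1.
under eq_bigr do rewrite subSS.
rewrite [X in X + _]gS [X in _ + (_ + X)]gS [X in _ + X]addrC addrA -mulr2n.
by rewrite -mulrnAl half2 mul1r subrK.
Qed.

Definition filt (K : finFieldType) (R : Type) (dim : nat -> nat)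
    (enc : forall A, 'rV[K]_(dim A) -> R) (A : nat) (h : R) : Prop :=
  exists u, enc A u = h.

(** * Curves and their quadratic covers *)

(* The coordinate ring of an affine curve over [K] that is free of rank [crk]
   over the polynomials in one coordinate [x], with: the filtration by pole
   order at infinity ([cenc A] parametrises the functions of order at most
   [A], and [cdf] plays the role of the genus); the expansion [cT] at the
   generic point in powers of a multiple of [x - x0]; finitely many rational
   points at which this multiple is nonzero. *)
Record curve (K : finFieldType) := Curve {
  cR : comNzRingType;
  cS : {rmorphism {poly K} -> cR};
  crk : nat;
  cdf : nat;
  cdim : nat -> nat;
  cenc : forall A, 'rV[K]_(cdim A) -> cR;
  cT : {rmorphism cR -> fps cR};
  cpt : finType;
  cev : cpt -> {rmorphism cR -> K};
  curve_dom : forall a b : cR, a * b = 0 -> a = 0 \/ b = 0;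
  cenc_linear : forall A (c : K) u v,
    cenc (c *: u + v : 'rV_(cdim A)) = cS c%:P * cenc u + cenc v;
  cenc_inj : forall A (u : 'rV_(cdim A)), cenc u = 0 -> u = 0;
  cdim_ub : forall A, (cdim A <= crk * A.+1)%N;
  cdim_lb : forall A, (crk * A.+1 <= cdim A + crk * cdf)%N;
  cwt_mono : forall A B h, (A <= B)%N -> filt cenc A h -> filt cenc B h;
  cwt_mul : forall A B g h,
    filt cenc A g -> filt cenc B h -> filt cenc (A + B) (g * h);
  cwt_poly : forall A (p : {poly K}), (size p <= A.+1)%N -> filt cenc A (cS p);
  cwt_ex : forall h, exists A, filt cenc A h;
  cT0 : forall h, cT h 0%N = h;
  cT_const : forall c k, cT (cS c%:P) k.+1 = 0;
  cT_wt : forall A h k,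
    filt cenc A h -> filt cenc (A + 2 * cdf * k) (cT h k);
  cev_const : forall z c, cev z (cS c%:P) = c;
  czeros : forall (o : cpt -> nat) h A, h <> 0 -> filt cenc A h ->
    (forall z, low (o z) (fps_map (cev z) (cT h))) ->
    (\sum_z o z <= crk * A)%N
}.

Section CurveTheory.
Variables (K : finFieldType) (X : curve K).
Notation wt := (filt (@cenc K X)).
Implicit Types g h : cR X.

Lemma wtZD A c g h : wt A g -> wt A h -> wt A (cS X c%:P * g + h).
Proof. by move=> [u <-] [v <-]; exists (c *: u + v); rewrite cenc_linear. Qed.

Lemma wt0 A : wt A 0.
Proof.
exists 0; apply: (addrI (cenc (0 : 'rV[K]_(cdim X A)))); rewrite addr0.
rewrite -[in RHS](scaler0 _ 1) -[in RHS](addr0 (1 *: 0)) cenc_linear.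
by rewrite rmorph1 mul1r.
Qed.

Lemma wtD A g h : wt A g -> wt A h -> wt A (g + h).
Proof. by move=> wg wh; rewrite -[g]mul1r -(rmorph1 (cS X)); exact: wtZD. Qed.

Lemma wtZ A c g : wt A g -> wt A (cS X c%:P * g).
Proof. by move=> wg; rewrite -[X in wt _ X]addr0; apply: wtZD => //; exact: wt0. Qed.

Lemma wtN A g : wt A g -> wt A (- g).
Proof. by move=> wg; rewrite -mulN1r -(rmorphN1 (cS X)) -(polyCN 1); exact: wtZ. Qed.

Lemma wtB A g h : wt A g -> wt A h -> wt A (g - h).
Proof. by move=> wg wh; apply: wtD => //; exact: wtN. Qed.

Lemma wt_sum A (I : Type) (r : seq I) (P : pred I) (F : I -> cR X) :
  (forall i, P i -> wt A (F i)) -> wt A (\sum_(i <- r | P i) F i).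
Proof.
move=> wF; elim/big_rec: _ => [|i h Pi wh]; first exact: wt0.
by apply: wtD => //; exact: wF.
Qed.

Lemma wt1 : wt 0 1.
Proof. by rewrite -(rmorph1 (cS X)); apply: cwt_poly; rewrite size_poly1. Qed.

Lemma wtX A h n : wt A h -> wt (A * n) (h ^+ n).
Proof.
move=> wh; elim: n => [|n IHn]; first by rewrite muln0; exact: wt1.
by rewrite mulnS exprS; exact: cwt_mul.
Qed.

Lemma curve_sq0 h : h ^+ 2 = 0 -> h = 0.
Proof. by rewrite expr2 => /curve_dom []. Qed.

End CurveTheory.

(** * Double covers of a curve *)

Section QuadCurve.
Variables (K : finFieldType) (X : curve K) (f : cR X) (w : nat).
Notation wt := (filt (@cenc K X)).
Hypothesis two_neq0 : (2 : K) != 0.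
Hypothesis wt_f : wt (2 * w) f.
Hypothesis nonsq : forall a b : cR X, a ^+ 2 = f * b ^+ 2 -> b = 0.

Notation Q := (quad f).
Notation qin := (@quad_in (cR X) f).
Notation qy := (quad_y f).

Let half : cR X := cS X (2^-1)%:P.

Lemma quad_half2 : half *+ 2 = 1.
Proof.
have h2 : (2^-1 *+ 2 : K) = 1 by rewrite -[_ *+ 2]mulr_natr mulVf.
by rewrite /half -rmorphMn -polyCMn h2 rmorph1.
Qed.

Lemma quad_norm_eq0 (u : Q) : quad_norm u = 0 -> u = 0.
Proof.
case: u => a b /eqP; rewrite /quad_norm /= subr_eq0 => /eqP e.
have b0 := nonsq e; move: e; rewrite b0 expr0n mulr0 => /curve_sq0 a0.
by rewrite a0.
Qed.

Lemma quad_dom (u v : Q) : u * v = 0 -> u = 0 \/ v = 0.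
Proof.
move/(congr1 (@quad_norm _ f)); rewrite quad_normM.
have -> : quad_norm (0 : Q) = 0 by rewrite /quad_norm /= expr0n mulr0 subrr.
by case/curve_dom => /quad_norm_eq0; [left | right].
Qed.

(** The coordinate [y] has pole order at most [w], so the coefficient of [y] is allowed order
    [A - w]. When [A < w] it must be zero; the truncated subtraction would still allow the functions
    of order [0]. *)
Definition quad_dimw A := if (w <= A)%N then cdim X (A - w) else 0%N.
Definition quad_encw A : 'rV[K]_(quad_dimw A) -> cR X :=
  match (w <= A)%N as b return 'rV[K]_(if b then cdim X (A - w) else 0%N) -> cR X with
  | true => fun u => cenc u
  | false => fun=> 0
  end.
Definition quad_dim A := (cdim X A + quad_dimw A)%N.
Definition quad_enc A (u : 'rV[K]_(quad_dim A)) : Q :=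
  (cenc (lsubmx u), quad_encw (rsubmx u)).

Lemma quad_encw_linear A (c : K) (u v : 'rV_(quad_dimw A)) :
  quad_encw (c *: u + v) = cS X c%:P * quad_encw u + quad_encw v.
Proof.
move: u v; rewrite /quad_encw /quad_dimw; case: (w <= A)%N => u v.
  exact: cenc_linear.
by rewrite mulr0 addr0.
Qed.

Lemma quad_encw_inj A (u : 'rV_(quad_dimw A)) : quad_encw u = 0 -> u = 0.
Proof.
move: u; rewrite /quad_encw /quad_dimw; case: (w <= A)%N => u; first exact: cenc_inj.
by rewrite (thinmx0 u).
Qed.

Definition quad_wtw A (b : cR X) := if (w <= A)%N then wt (A - w) b else b = 0.

Lemma quad_encwP A b : (exists u, @quad_encw A u = b) <-> quad_wtw A b.
Proof.
rewrite /quad_encw /quad_dimw /quad_wtw; case: (w <= A)%N => //.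
by split=> [[u <-]|->]; [|exists 0].
Qed.

Notation qwt := (filt quad_enc).

Lemma quad_wtP A (u : Q) : qwt A u <-> wt A u.1 /\ quad_wtw A u.2.
Proof.
split=> [[v <-]|].
  by split; [exists (lsubmx v) | apply/quad_encwP; exists (rsubmx v)].
case: u => a b [[v1 /= <-] /quad_encwP [v2 <-]].
by exists (row_mx v1 v2); rewrite /quad_enc row_mxKl row_mxKr.
Qed.

Lemma quad_wtw_le A B b : (A + w <= B)%N -> wt A b -> quad_wtw B b.
Proof.
move=> leAB wb; rewrite /quad_wtw ifT; last lia.
by apply: cwt_mono wb; lia.
Qed.

Lemma quad_wtw0 A : quad_wtw A 0.
Proof. by rewrite /quad_wtw; case: ifP => // _; exact: wt0. Qed.

Lemma quad_wtwP A b :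
  quad_wtw A b -> b = 0 \/ exists2 B, (B + w = A)%N & wt B b.
Proof.
rewrite /quad_wtw; case: ifP => [lewA wb|_ ->]; last by left.
by right; exists (A - w)%N; rewrite ?subnK.
Qed.

Lemma quad_wtw_mono A B b : (A <= B)%N -> quad_wtw A b -> quad_wtw B b.
Proof.
move=> leAB /quad_wtwP [->|[C eC wb]]; first exact: quad_wtw0.
by apply: quad_wtw_le wb; lia.
Qed.

Lemma quad_wtwD A b c : quad_wtw A b -> quad_wtw A c -> quad_wtw A (b + c).
Proof.
by rewrite /quad_wtw; case: ifP => [_|_ -> ->]; [exact: wtD | rewrite addr0].
Qed.

Lemma quad_wtwM A B a b : wt A a -> quad_wtw B b -> quad_wtw (A + B) (a * b).
Proof.
move=> wa /quad_wtwP [->|[C <- wb]]; first by rewrite mulr0; exact: quad_wtw0.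
by apply: quad_wtw_le (cwt_mul wa wb); lia.
Qed.

Lemma quad_wtwfM A B a b :
  quad_wtw A a -> quad_wtw B b -> wt (A + B) (f * a * b).
Proof.
case/quad_wtwP => [->|[C <- wa]]; first by rewrite mulr0 mul0r; move=> _; exact: wt0.
case/quad_wtwP => [->|[D <- wb]]; first by rewrite mulr0; exact: wt0.
by apply: cwt_mono (cwt_mul (cwt_mul wt_f wa) wb); lia.
Qed.

Definition quad_S : {rmorphism {poly K} -> Q} := qin \o cS X.

Lemma quad_enc_linear A (c : K) (u v : 'rV_(quad_dim A)) :
  quad_enc (c *: u + v) = quad_S c%:P * quad_enc u + quad_enc v.
Proof.
rewrite /quad_enc !linearP cenc_linear quad_encw_linear /quad_S /=.
by rewrite quad_in_mul.
Qed.

Lemma quad_enc_inj A (u : 'rV_(quad_dim A)) : quad_enc u = 0 -> u = 0.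
Proof.
by case=> /cenc_inj l0 /quad_encw_inj r0; rewrite -(hsubmxK u) l0 r0 row_mx0.
Qed.

Lemma quad_dim_ub A : (quad_dim A <= 2 * crk X * A.+1)%N.
Proof.
rewrite /quad_dim /quad_dimw; have := cdim_ub X A.
by case: ifP => [_|_]; [have := cdim_ub X (A - w)|]; nia.
Qed.

Lemma quad_dim_lb A :
  (2 * crk X * A.+1 <= quad_dim A + 2 * crk X * (cdf X + w))%N.
Proof.
rewrite /quad_dim /quad_dimw; have := cdim_lb X A.
case: (leqP w A) => [lewA|ltAw]; last by nia.
by have := cdim_lb X (A - w); nia.
Qed.

Lemma quad_wt_mono A B h : (A <= B)%N -> qwt A h -> qwt B h.
Proof.
move=> leAB /quad_wtP [wa wb]; apply/quad_wtP; split.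
  exact: cwt_mono wa.
exact: quad_wtw_mono wb.
Qed.

Lemma quad_wt_mul A B g h : qwt A g -> qwt B h -> qwt (A + B) (g * h).
Proof.
move=> /quad_wtP [wa wb] /quad_wtP [wc wd]; apply/quad_wtP; split=> /=.
  by apply: wtD; [exact: cwt_mul | exact: quad_wtwfM].
by apply: quad_wtwD; [exact: quad_wtwM | rewrite mulrC addnC; exact: quad_wtwM].
Qed.

Lemma quad_wt_in A a : wt A a -> qwt A (qin a).
Proof. by move=> wa; apply/quad_wtP; split=> //; exact: quad_wtw0. Qed.

Lemma quad_wt_poly A (p : {poly K}) : (size p <= A.+1)%N -> qwt A (quad_S p).
Proof. by move=> lep; apply/quad_wt_in/cwt_poly. Qed.

Lemma quad_wt_y : qwt w qy.
Proof.
apply/quad_wtP; split; first exact: wt0.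
by apply: quad_wtw_le (wt1 X); rewrite add0n.
Qed.

Lemma quad_wt_ex h : exists A, qwt A h.
Proof.
case: h => a b; have [A wa] := cwt_ex a; have [B wb] := cwt_ex b.
exists (A + B + w)%N; apply/quad_wtP; split; first by apply: cwt_mono wa; lia.
by apply: quad_wtw_le wb; lia.
Qed.

(* The square root of the expansion of [f], divided by [quad_y], after
   rescaling the expansion variable by [f]. *)
Let phi : fps (cR X) := fun k => if k is k'.+1 then f ^+ k' * cT X f k else 1.

Lemma quad_g_exists : exists g : fps (cR X), [/\ g 0%N = 1,
  fps_const f * g ^+ 2 = fps_scale f (cT X f) &
  forall k, wt (2 * (cdf X + w) * k) (g k)].
Proof.
have [g [g0 gS g2]] := @fps_half_sqrt _ _ phi quad_half2 erefl.
exists g; split=> //.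
  rewrite g2; apply/funext => -[|k]; rewrite fps_constM /fps_scale /=.
    by rewrite cT0 mulrC.
  by rewrite exprS mulrA.
elim/ltn_ind => -[_|k IHk]; first by rewrite g0 muln0; exact: wt1.
rewrite gS; apply: wtZ; apply: wtB.
  (* The power of [f] contributes [2 w k] and the coefficient [2 w + 2 cdf (k + 1)]: in all exactly
     [2 (cdf + w) (k + 1)], so a double cover adds [w] to [cdf]. *)
  have := cwt_mul (wtX k wt_f) (cT_wt k.+1 wt_f).
  by apply: cwt_mono; nia.
apply: wt_sum => i _; have ltik := ltn_ord i.
have wi : wt (2 * (cdf X + w) * i.+1) (g i.+1) by apply: IHk; lia.
have wj : wt (2 * (cdf X + w) * (k - i)) (g (k - i)%N) by apply: IHk; lia.
by apply: cwt_mono (cwt_mul wi wj); nia.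
Qed.

Definition quad_g : fps (cR X) := projT1 (cid quad_g_exists).

Lemma quad_gP : [/\ quad_g 0%N = 1,
  fps_const f * quad_g ^+ 2 = fps_scale f (cT X f) &
  forall k, wt (2 * (cdf X + w) * k) (quad_g k)].
Proof. by rewrite /quad_g; case: cid. Qed.

Definition quad_i : {rmorphism fps (cR X) -> fps Q} := fps_map qin.
Definition quad_sT : {rmorphism cR X -> fps (cR X)} := fps_scale f \o cT X.
Lemma quad_sT0 : quad_sT 0 = 0. Proof. exact: rmorph0. Qed.
Definition quad_gy : fps Q := quad_i quad_g * fps_const qy.

Lemma quad_i_const a : quad_i (fps_const a) = fps_const (qin a).
Proof. by apply/funext => -[|k]; rewrite /quad_i /= /fps_map /fps_const /= ?rmorph0. Qed.

Lemma quad_gy2 : quad_gy ^+ 2 = quad_i (quad_sT f).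
Proof.
have [_ g2 _] := quad_gP.
rewrite exprMn fps_constX quad_y2 -rmorphXn -quad_i_const -rmorphM mulrC g2.
by [].
Qed.

(** The expansion of [y] is [quad_gy], a square root of the rescaled expansion of [f]; that of
    [u.1 + u.2 y] is then forced. *)
Definition quad_T (u : Q) : fps Q := quad_i (quad_sT u.1) + quad_i (quad_sT u.2) * quad_gy.

Fact quad_T_additive : zmod_morphism quad_T.
Proof. by move=> u v; rewrite /quad_T /= !rmorphB /=; ring. Qed.
HB.instance Definition _ :=
  GRing.isZmodMorphism.Build Q (fps Q) quad_T quad_T_additive.

Fact quad_T_multiplicative : monoid_morphism quad_T.
Proof.
split=> [|u v]; rewrite /quad_T; first by rewrite !rmorph1 !rmorph0 mul0r addr0.
rewrite [(u * v).1]/(_ * _ + _ * _ * _) [(u * v).2]/(_ * _ + _ * _).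
rewrite !(rmorphD quad_sT, rmorphM quad_sT) !(rmorphD quad_i, rmorphM quad_i).
by rewrite -quad_gy2; ring.
Qed.
HB.instance Definition _ :=
  GRing.isMonoidMorphism.Build Q (fps Q) quad_T quad_T_multiplicative.

Lemma quad_TE u k :
  quad_T u k = (quad_sT u.1 k, (quad_sT u.2 * quad_g) k).
Proof.
rewrite /quad_T /quad_gy fpsD mulrA -rmorphM mulrC fps_constM /quad_i /=.
rewrite /fps_map mulrC quad_in_mul; congr pair => /=; first by rewrite mulr0 addr0.
by rewrite mulr1 add0r.
Qed.

Lemma quad_T0 u : quad_T u 0%N = u.
Proof.
have [g0 _ _] := quad_gP.
rewrite quad_TE fpsM0 g0 mulr1 /quad_sT /= /fps_scale expr0 !mul1r !cT0.
by case: u.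
Qed.

Lemma quad_T_const c k : quad_T (quad_S c%:P) k.+1 = 0.
Proof.
rewrite quad_TE quad_sT0 mul0r; congr pair.
by rewrite /= /fps_scale cT_const mulr0.
Qed.

Lemma quad_sT_wt A a k : wt A a -> wt (A + 2 * (cdf X + w) * k) (quad_sT a k).
Proof.
by move=> wa; apply: cwt_mono (cwt_mul (wtX k wt_f) (cT_wt k wa)); nia.
Qed.

Lemma quad_T_wt A h k : qwt A h -> qwt (A + 2 * (cdf X + w) * k) (quad_T h k).
Proof.
move=> /quad_wtP [wa wb]; apply/quad_wtP; rewrite quad_TE; split.
  exact: quad_sT_wt.
case/quad_wtwP: wb => [->|[B eB wb]].
  by rewrite [X in quad_wtw _ X](_ : _ = 0) ?quad_sT0 ?mul0r //; exact: quad_wtw0.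
apply: (@quad_wtw_le (B + 2 * (cdf X + w) * k)); first by lia.
rewrite fpsM; apply: wt_sum => i _; have [_ _ wg] := quad_gP.
have := cwt_mul (quad_sT_wt i wb) (wg (k - i)%N).
by apply: cwt_mono; have := ltn_ord i; nia.
Qed.

(** The points with [y = 0] are left out: the expansion variable has been multiplied by [f], so
    where [f] vanishes the expansion no longer measures orders of vanishing. *)
Definition quad_pt : finType :=
  {p : cpt X * K | (p.2 ^+ 2 == cev p.1 f) && (p.2 != 0)}.

Implicit Type p : quad_pt.

Lemma quad_pt_sq p : (val p).2 ^+ 2 = cev (val p).1 f.
Proof. by have /andP [/eqP] := valP p. Qed.
Lemma quad_pt_neq0 p : (val p).2 != 0.
Proof. by have /andP [] := valP p. Qed.

Definition quad_ev p (u : Q) : K :=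
  cev (val p).1 u.1 + cev (val p).1 u.2 * (val p).2.

Fact quad_ev_additive p : zmod_morphism (quad_ev p).
Proof. by move=> u v; rewrite /quad_ev /= !rmorphB; ring. Qed.
HB.instance Definition _ p :=
  GRing.isZmodMorphism.Build Q K (quad_ev p) (quad_ev_additive p).
Fact quad_ev_multiplicative p : monoid_morphism (quad_ev p).
Proof.
split=> [|u v]; rewrite /quad_ev /=; first by rewrite rmorph1 rmorph0 mul0r addr0.
by rewrite !rmorphD !rmorphM -quad_pt_sq; ring.
Qed.
HB.instance Definition _ p :=
  GRing.isMonoidMorphism.Build Q K (quad_ev p) (quad_ev_multiplicative p).

Definition quad_evr p : {rmorphism Q -> K} := quad_ev p.

Lemma quad_ev_const p c : quad_evr p (quad_S c%:P) = c.
Proof. by rewrite /quad_evr /= /quad_ev /= cev_const rmorph0 mul0r addr0. Qed.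

Lemma quad_pt_conj_subproof p :
  (((val p).1, - (val p).2).2 ^+ 2 == cev ((val p).1, - (val p).2).1 f)
  && (((val p).1, - (val p).2).2 != 0).
Proof. by rewrite /= sqrrN oppr_eq0 quad_pt_sq eqxx quad_pt_neq0. Qed.
Definition quad_pt_conj p : quad_pt :=
  Sub ((val p).1, - (val p).2) (quad_pt_conj_subproof p).

Lemma quad_ev_conj p (u : Q) : quad_ev (quad_pt_conj p) u = quad_ev p (quad_conj u).
Proof. by rewrite /quad_ev /= rmorphN mulrN mulNr. Qed.

Lemma quad_T_conj u k : quad_T (quad_conj u) k = quad_conj (quad_T u k).
Proof. by rewrite !quad_TE [quad_sT (quad_conj u).2]rmorphN mulNr. Qed.

Lemma quad_pt_fiber p p0 : (val p).1 = (val p0).1 -> p = p0 \/ p = quad_pt_conj p0.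
Proof.
move=> e1; have : (val p).2 ^+ 2 == (val p0).2 ^+ 2 by rewrite !quad_pt_sq e1.
rewrite eqf_sqr => /orP [] /eqP e2; [left | right]; apply/val_inj => /=;
  by rewrite [LHS]surjective_pairing e1 e2 // -surjective_pairing.
Qed.

Lemma quad_pt_conj_neq p : quad_pt_conj p != p.
Proof.
apply/eqP => /(congr1 (fun p => (val p).2)) /= /eqP.
rewrite -subr_eq0 -opprD oppr_eq0 -mulr2n -mulr_natl mulf_eq0 (negPf two_neq0) /=.
by rewrite (negPf (quad_pt_neq0 p)).
Qed.

(* The norm of [h] vanishes at [z] to the sum of the orders of [h] at the two
   points above [z]. *)
Lemma quad_zeros (o : quad_pt -> nat) h A : h <> 0 -> qwt A h ->
  (forall p, low (o p) (fps_map (quad_evr p) (quad_T h))) ->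
  (\sum_p o p <= 2 * crk X * A)%N.
Proof.
move=> h0 wh lo; pose N := quad_norm h.
have N0 : N <> 0 by move/quad_norm_eq0.
have wN : wt (2 * A) N.
  move/quad_wtP: wh => [wa wb]; rewrite /N /quad_norm mul2n -addnn !expr2 mulrA.
  by apply: wtB; [exact: cwt_mul | exact: quad_wtwfM].
pose oz z := (\sum_(p | (val p).1 == z) o p)%N.
have -> : (\sum_p o p = \sum_z oz z)%N.
  by rewrite (partition_big (fun p => (val p).1) xpredT).
have := @czeros _ X oz _ _ N0 wN; rewrite mulnA (mulnC _ 2%N); apply=> z.
rewrite /oz; case: (pickP (fun p : quad_pt => (val p).1 == z)) => [p0 /eqP <-|no].
  have -> : (\sum_(p | (val p).1 == (val p0).1) o p = o p0 + o (quad_pt_conj p0))%N.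
    rewrite (bigD1 p0) //= (bigD1 (quad_pt_conj p0)) /=; last first.
      by rewrite eqxx quad_pt_conj_neq.
    rewrite big1 ?addn0 // => p /andP [/andP [/eqP e1 n1] n2].
    by case: (quad_pt_fiber e1) => e; rewrite e eqxx in n1 n2.
  set pc := quad_pt_conj p0.
  have ef : cev (val p0).1 f != 0.
    by rewrite -quad_pt_sq expf_neq0 ?quad_pt_neq0.
  apply: (low_scale ef).
  have -> : fps_scale (cev (val p0).1 f) (fps_map (cev (val p0).1) (cT X N)) =
      fps_map (quad_evr p0) (quad_T (qin N)).
    apply/funext => k; rewrite /fps_map quad_TE quad_sT0 mul0r fps0.
    rewrite /quad_evr /= /quad_ev /= rmorph0 mul0r addr0 /fps_scale.
    by rewrite rmorphM rmorphXn.
  rewrite -quad_normE [quad_T _]rmorphM rmorphM; apply: lowM; first exact: lo.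
  rewrite [X in low _ X](_ : _ = fps_map (quad_evr pc) (quad_T h)); last first.
    apply/funext => k; rewrite -[LHS]/(quad_ev p0 (quad_T (quad_conj h) k)).
    by rewrite quad_T_conj /fps_map /= quad_ev_conj.
  exact: lo.
by rewrite big1 // => p; rewrite no.
Qed.

Definition quad_curve : curve K :=
  @Curve K Q quad_S (2 * crk X) (cdf X + w) quad_dim quad_enc quad_T quad_pt quad_evr
    quad_dom quad_enc_linear quad_enc_inj quad_dim_ub quad_dim_lb quad_wt_mono
    quad_wt_mul quad_wt_poly quad_wt_ex quad_T0 quad_T_const quad_T_wt
    quad_ev_const quad_zeros.

End QuadCurve.

(** * The affine line *)

Section BaseCurve.
Variable K : finFieldType.
Implicit Type p : {poly K}.

Definition poly_fps (R : nzRingType) (p : {poly R}) : fps R := fun i => p`_i.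

Fact poly_fps_additive (R : comNzRingType) : zmod_morphism (@poly_fps R).
Proof. by move=> p q; apply/funext => i; rewrite /poly_fps coefB. Qed.
HB.instance Definition _ (R : comNzRingType) :=
  GRing.isZmodMorphism.Build {poly R} (fps R) (@poly_fps R) (@poly_fps_additive R).
Fact poly_fps_multiplicative (R : comNzRingType) : monoid_morphism (@poly_fps R).
Proof.
split=> [|p q]; apply/funext => i; first by rewrite /poly_fps coef1.
by rewrite /poly_fps coefM.
Qed.
HB.instance Definition _ (R : comNzRingType) :=
  GRing.isMonoidMorphism.Build {poly R} (fps R) (@poly_fps R)
    (@poly_fps_multiplicative R).

Definition base_S : {rmorphism {poly K} -> {poly K}} := idfun.

(** Taylor expansion at the generic point. Its coefficients are the Hasse derivatives, which detect
    multiplicities in any characteristic. *)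
Definition base_T : {rmorphism {poly K} -> fps {poly K}} :=
  @poly_fps {poly K} \o (comp_poly ('X + 'X%:P) \o map_poly polyC).

Lemma base_TE p k : base_T p k = p^`N(k).
Proof.
rewrite /base_T /= /poly_fps /comp_poly addrC nderiv_taylor; last exact: commr_polyX.
rewrite !size_map_polyC.
have -> : \sum_(i < size p) ((p^:P)^:P)^`N(i).['X%:P] * 'X^i = \poly_(i < size p) p^`N(i).
  rewrite poly_def; apply: eq_bigr => i _.
  rewrite !nderivn_map horner_map /= -mul_polyC; congr (_%:P * _).
  exact: comp_polyXr.
rewrite coef_poly; case: ltnP => // lepk.
by rewrite nderivn_poly0.
Qed.

Definition base_enc A (u : 'rV[K]_A.+1) : {poly K} := rVpoly u.

Lemma base_enc_linear A (c : K) (u v : 'rV_A.+1) :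
  base_enc (c *: u + v) = base_S c%:P * base_enc u + base_enc v.
Proof. by rewrite /base_enc linearP /= mul_polyC. Qed.

Lemma base_enc_inj A (u : 'rV_A.+1) : base_enc u = 0 -> u = 0.
Proof. by move=> e; rewrite -(rVpolyK u) -/(base_enc u) e linear0. Qed.

Lemma base_wtP A p : filt base_enc A p <-> (size p <= A.+1)%N.
Proof.
split=> [[u <-]|lep]; first exact: size_poly.
by exists (poly_rV p); rewrite /base_enc poly_rV_K.
Qed.

Lemma base_dom p q : p * q = 0 -> p = 0 \/ q = 0.
Proof. by move/eqP; rewrite mulf_eq0 => /orP [] /eqP; [left | right]. Qed.

Lemma base_dim_ub A : (A.+1 <= 1 * A.+1)%N. Proof. by rewrite mul1n. Qed.
Lemma base_dim_lb A : (1 * A.+1 <= A.+1 + 1 * 0)%N. Proof. lia. Qed.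

Lemma base_wt_mono A B p :
  (A <= B)%N -> filt base_enc A p -> filt base_enc B p.
Proof. by move=> leAB /base_wtP lep; apply/base_wtP; lia. Qed.

Lemma base_wt_mul A B p q :
  filt base_enc A p -> filt base_enc B q -> filt base_enc (A + B) (p * q).
Proof.
move=> /base_wtP lep /base_wtP leq; apply/base_wtP.
by apply: leq_trans (size_polyMleq _ _) _; lia.
Qed.

Lemma base_wt_poly A p : (size p <= A.+1)%N -> filt base_enc A (base_S p).
Proof. by move=> lep; apply/base_wtP. Qed.

Lemma base_wt_ex p : exists A, filt base_enc A p.
Proof. by exists (size p); apply/base_wtP. Qed.

Lemma base_T0 p : base_T p 0%N = p.
Proof. by rewrite base_TE nderivn0. Qed.
Lemma base_T_const c k : base_T (base_S c%:P) k.+1 = 0.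
Proof. by rewrite base_TE nderivnC. Qed.
Lemma base_T_wt A p k : filt base_enc A p ->
  filt base_enc (A + 2 * 0 * k) (base_T p k).
Proof.
rewrite muln0 mul0n addn0 base_TE => /base_wtP lep; apply/base_wtP.
apply/leq_sizeP => j leAj; rewrite coef_nderivn nth_default ?mul0rn //.
by apply: leq_trans lep _; lia.
Qed.

Definition base_ev (z : K) : {rmorphism {poly K} -> K} := horner_eval z.

Lemma base_ev_const z c : base_ev z (base_S c%:P) = c.
Proof. exact: hornerC. Qed.

Lemma base_low_dvd z m p : low m (fps_map (base_ev z) (base_T p)) ->
  ('X - z%:P) ^+ m %| p.
Proof.
move=> lp; have e : p = (p^:P).[z%:P + ('X - z%:P)].
  by rewrite addrC subrK -[RHS]/(p \Po 'X) comp_polyXr.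
rewrite [X in _ %| X]e nderiv_taylor; last exact: mulrC.
elim/big_rec: _ => [|i r _ dr]; first exact: dvdp0.
apply: dvdp_add dr; case: (ltnP i m) => [ltim|lemi]; last first.
  by apply/dvdp_mull/dvdp_exp2l.
have := lp i ltim; rewrite /fps_map base_TE /base_ev /= /horner_eval => p0.
by rewrite nderivn_map horner_map /= p0 mul0r dvdp0.
Qed.

Lemma dvdp_prod_XsubC_exp (o : K -> nat) (s : seq K) p : uniq s ->
    (forall z, z \in s -> ('X - z%:P) ^+ o z %| p) ->
  \prod_(z <- s) ('X - z%:P) ^+ o z %| p.
Proof.
elim: s => [|z s IHs] /=; first by rewrite big_nil dvd1p.
move=> /andP [zs us] dp; rewrite big_cons Gauss_dvdp.
  by rewrite dp ?mem_head //= IHs // => y ys; rewrite dp // inE ys orbT.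
rewrite coprimep_expl // big_seq; elim/big_rec: _ => [|y r ys cr].
  exact: coprimep1.
rewrite coprimepMr cr andbT coprimep_expr // coprimep_XsubC2 // subr_eq0.
by apply: contraNneq zs => <-.
Qed.

Lemma base_zeros (o : K -> nat) p A : p <> 0 -> filt base_enc A p ->
    (forall z, low (o z) (fps_map (base_ev z) (base_T p))) ->
  (\sum_z o z <= 1 * A)%N.
Proof.
move=> /eqP p0 /base_wtP sp lo; rewrite mul1n -ltnS; apply: leq_trans sp.
have := @dvdp_prod_XsubC_exp o (index_enum K) p (index_enum_uniq K).
move=> /(_ (fun z _ => base_low_dvd (lo z))) /(dvdp_leq p0); apply: leq_trans.
rewrite size_prod_seq; last by move=> z _; rewrite expf_neq0 // polyXsubC_eq0.
have -> : (\sum_i size (('X - i%:P) ^+ o i) = \sum_i o i + size (index_enum K))%N.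
  by rewrite -sum1_size -big_split /=; apply: eq_bigr => z _; rewrite size_exp_XsubC addn1.
by rewrite -addSn addnK.
Qed.

Definition base_curve : curve K :=
  @Curve K {poly K} base_S 1 0 S base_enc base_T K base_ev
    base_dom base_enc_linear base_enc_inj base_dim_ub base_dim_lb base_wt_mono
    base_wt_mul base_wt_poly base_wt_ex base_T0 base_T_const base_T_wt
    base_ev_const base_zeros.

End BaseCurve.

Lemma common_kernel (K : fieldType) (T : finType) (s : nat) (m : 'I_s -> nat)
    (t : forall i, T -> 'rV[K]_(m i)) :
    (\sum_i m i < #|T|)%N ->
  exists2 c : T -> K, exists x, c x != 0 & forall i, \sum_x c x *: t i x = 0.
Proof.
pose M i : 'M[K]_(#|T|, m i) := \matrix_(r < #|T|) t i (enum_val r).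
move=> ltmn; have : kermx (\mxrow_i M i) != 0.
  rewrite kermx_eq0 /row_free; apply: contraTneq ltmn => <-.
  by rewrite -leqNgt rank_leq_col.
case/rowV0Pn => v /sub_kermxP; rewrite mul_mxrow -mxrow0 => /eq_mxrowP e v0.
exists (fun x => v 0 (enum_rank x)).
  case/rV0Pn: v0 => r nz; exists (enum_val r); by rewrite enum_valK.
move=> i; have := e i; rewrite mulmx_sum_row => ei; rewrite -[RHS]ei.
rewrite (reindex (@enum_val T xpredT)) /=; last exact: onW_bij (enum_val_bij T).
by apply: eq_bigr => r _; rewrite enum_valK rowK.
Qed.

(** * Stepanov's method *)

Section Stepanov.
Variables (K : finFieldType) (X : curve K) (p q : nat).
Hypotheses (pcharK : p \in [pchar K]) (cardK : #|K| = q) (p_q : p.-nat q).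
Notation wt := (filt (@cenc K X)).
Implicit Types (g h : cR X) (z : cpt X).

Definition expand z h : fps K := fps_map (cev z) (cT X h).

Lemma cR_pchar : p \in [pchar (cR X)].
Proof. by apply: (rmorph_pchar (cS X)); apply: (rmorph_pchar polyC). Qed.

Lemma constXq (c : K) : cS X c%:P ^+ q = cS X c%:P.
Proof. by rewrite -rmorphXn -rmorphXn /= -cardK expf_card. Qed.

Lemma exprBq g h : (g - h) ^+ q = g ^+ q - h ^+ q.
Proof.
have pq : [pchar (cR X)].-nat q by rewrite (eq_pnat _ (pcharf_eq cR_pchar)).
apply: (addIr (h ^+ q)); rewrite -exprDn_pchar // !subrK //.
Qed.

Lemma expand_const z c : expand z (cS X c%:P) = fps_const c.
Proof.
apply/funext => -[|k]; rewrite /expand /fps_map.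
  by rewrite cT0 cev_const.
by rewrite cT_const rmorph0.
Qed.

Lemma expandM z g h : expand z (g * h) = expand z g * expand z h.
Proof. by rewrite /expand !rmorphM. Qed.
Lemma expandB z g h : expand z (g - h) = expand z g - expand z h.
Proof. by rewrite /expand !rmorphB. Qed.
Lemma expandX z h n : expand z (h ^+ n) = expand z h ^+ n.
Proof. by rewrite /expand !rmorphXn. Qed.

Lemma order_bound z h A m :
  h <> 0 -> wt A h -> low m (expand z h) -> (m <= crk X * A)%N.
Proof.
move=> h0 wh lm; pose o y := if y == z then m else 0%N.
have := @czeros _ X o h A h0 wh; rewrite (bigD1 z) //= /o eqxx big1; last first.
  by move=> y /negPf ->.
rewrite addn0; apply=> y; case: eqP => [->//|_]; exact: low0.
Qed.

Lemma order_ex z h : h <> 0 ->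
  exists m, low m (expand z h) /\ expand z h m != 0.
Proof.
move=> h0; have [A wh] := cwt_ex h.
have [/existsP [m nz]|/existsPn allz] :=
    boolP [exists m : 'I_(crk X * A).+1, expand z h m != 0].
  case: (@ex_minnP (fun m => expand z h m != 0)); first by exists m.
  move=> k nzk mink; exists k; split=> // i ltik; apply/eqP.
  by apply: contraTT ltik => /mink; rewrite -leqNgt.
have /(order_bound h0 wh) : low (crk X * A).+1 (expand z h).
  by move=> i lti; have := allz (Ordinal lti); rewrite negbK => /eqP.
by rewrite ltnn.
Qed.

Lemma expand_sum z (I : Type) (r : seq I) (F : I -> cR X) :
  expand z (\sum_(i <- r) F i) = \sum_(i <- r) expand z (F i).
Proof. by rewrite /expand !rmorph_sum. Qed.

(* Functions of degree less than [q] are linearly independent over the [q]-th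
   powers, as seen on orders of vanishing at a rational point. *)
Lemma qpower_indep z A n (h u : 'I_n -> cR X) :
    (crk X * A < q)%N -> (forall k, wt A (h k)) ->
    (forall c : 'I_n -> K, \sum_k cS X (c k)%:P * u k = 0 -> forall k, c k = 0) ->
    \sum_k h k * u k ^+ q = 0 ->
  forall k, h k = 0.
Proof.
move=> ltAq; elim: n h u => [|n IHn] h u wh free_u rel; first by case.
have u0 k : u k <> 0.
  move=> uk0; pose c j : K := (j == k)%:R.
  have /free_u/(_ k) : \sum_j cS X (c j)%:P * u j = 0.
    rewrite (bigD1 k) //= uk0 mulr0 big1 ?addr0 // => j /negPf njk.
    by rewrite /c njk polyC0 rmorph0 mul0r.
  by rewrite /c eqxx => /eqP; rewrite oner_eq0.
pose ord k := projT1 (cid (order_ex z (@u0 k))).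
have ordP k : low (ord k) (expand z (u k)) /\ expand z (u k) (ord k) != 0.
  by rewrite /ord; case: cid.
(* Gaussian elimination on orders: a function of least order is subtracted from the others so as to
   raise their orders above its own. *)
pose k0 := [arg min_(k < ord0) ord k].
have min_k0 k : (ord k0 <= ord k)%N by rewrite /k0; case: arg_minnP => // i _; exact.
have [lowk0 lead0] := ordP k0.
pose m := ord k0; pose l j := lift k0 j.
pose c j := expand z (u (l j)) m / expand z (u k0) m.
pose u' j := u (l j) - cS X (c j)%:P * u k0.
pose h0' := h k0 + \sum_j cS X (c j)%:P * h (l j).
have rel' : h0' * u k0 ^+ q + \sum_j h (l j) * u' j ^+ q = 0.
  rewrite -[RHS]rel (bigD1_ord k0) //= /h0' mulrDl -addrA; congr (_ + _).
  rewrite mulr_suml -big_split /=; apply: eq_bigr => j _.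
  by rewrite /u' exprBq exprMn constXq; ring.
have low_u' j : low m.+1 (expand z (u' j)).
  rewrite /u' expandB expandM expand_const => i; rewrite ltnS leq_eqVlt.
  have lowj : low m (expand z (u (l j))) by apply: low_le (ordP (l j)).1; exact: min_k0.
  rewrite fpsD fpsN fps_constM => /predU1P [->|ltim].
    by rewrite /c divfK // subrr.
  by rewrite lowj // lowk0 // mulr0 subrr.
have h0'0 : h0' = 0.
  apply/eqP/negPn/negP => /eqP h0'n.
  have wh' : wt A h0'.
    by apply: wtD => //; apply: wt_sum => j _; exact: wtZ.
  (* In the relation, the other terms vanish to order [(m + 1) q] and [u k0 ^+ q] to order exactly
     [m q]. Hence [h0'] vanishes to order [q], which exceeds the number of zeros that its pole order
     allows. *)
  have lowq : low q (expand z h0').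
    apply: (@lowM_cancel _ (m * q) _ (expand z (u k0) ^+ q)).
    - exact: lowX.
    - by rewrite low_leadX // expf_neq0.
    rewrite -expandX -expandM mulrC.
    have -> : h0' * u k0 ^+ q = - \sum_j h (l j) * u' j ^+ q.
      by apply/eqP; rewrite -addr_eq0 rel'.
    rewrite -[- _]sub0r expandB; apply: lowD; last apply: lowN.
      by move=> i _; rewrite /expand !rmorph0.
    rewrite expand_sum; apply: low_sum => j _; rewrite expandM expandX mulrC.
    have := lowX (n := q) (low_u' j); rewrite mulSn addnC => lx.
      by apply: low_le (lowM lx (@low0 _ _)); lia.
  by have := order_bound h0'n wh' lowq; lia.
have hl j : h (l j) = 0.
  move: j; apply: (IHn _ u'); first by move=> j; exact: wh.
    move=> d sd; pose d' k := if unlift k0 k is Some j then d j else - \sum_j d j * c j.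
    have d'l j : d' (l j) = d j by rewrite /d' liftK.
    have /free_u d'0 : \sum_k cS X (d' k)%:P * u k = 0.
      rewrite (bigD1_ord k0) //= -[RHS]sd /d' unlift_none polyCN rmorphN mulNr.
      rewrite !rmorph_sum mulr_suml -sumrN -big_split /=; apply: eq_bigr => j _.
      by rewrite liftK /u' -/(l j) polyCM rmorphM; ring.
    by move=> j; rewrite -d'l.
  by rewrite -[RHS]rel' h0'0 mul0r add0r.
move=> k; case: (unliftP k0 k) => [j|] -> ; first exact: hl.
by rewrite -h0'0 /h0' big1 ?addr0 // => j _; rewrite hl mulr0.
Qed.

Lemma cenc0 A : cenc (0 : 'rV_(cdim X A)) = 0.
Proof.
have := cenc_linear (-1) (0 : 'rV_(cdim X A)) 0; rewrite scaler0 addr0.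
by rewrite polyCN rmorphN rmorph1 mulN1r addNr.
Qed.

Lemma cenc_sum A (I : Type) (r : seq I) (c : I -> K) (u : I -> 'rV_(cdim X A)) :
  cenc (\sum_(i <- r) c i *: u i) = \sum_(i <- r) cS X (c i)%:P * cenc (u i).
Proof.
elim/big_rec2: _ => [|j y v _ <-]; first exact: cenc0.
by rewrite cenc_linear.
Qed.

Lemma cT_lin c h k : cT X (cS X c%:P * h) k = cS X c%:P * cT X h k.
Proof.
rewrite rmorphM [cT X _](_ : _ = fps_const (cS X c%:P)) ?fps_constM //.
by apply/funext => -[|i]; rewrite ?cT0 ?cT_const.
Qed.

(** Below order [q], the expansion treats a [q]-th power as a constant. *)
Lemma cT_powq h u i : (i < q)%N -> cT X (h * u ^+ q) i = cT X h i * u ^+ q.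
Proof.
move=> ltiq; rewrite rmorphM rmorphXn mulrC fpsM big_ord_recl /= subn0.
rewrite big1 ?addr0 => [|j _]; first by rewrite fpsX0 cT0 mulrC.
rewrite (fps_Frobenius _ cR_pchar p_q) ?mul0r //=.
by apply: leq_ltn_trans ltiq; rewrite /bump; have := ltn_ord j; lia.
Qed.

Lemma cev_expq z h : cev z (h ^+ q) = cev z h.
Proof. by rewrite rmorphXn /= -cardK expf_card. Qed.

(** The auxiliary function is [Psi = sum_k h_k b_k^q], where the [b_k] form a basis of the functions
    of order at most [B] and the [h_k], of order at most [A], are unknown. Below order [q] the
    [b_k^q] behave as constants, and at a rational point [b_k^q] takes the value of [b_k]. So [Psi]
    vanishes to order [s] at all points as soon as the functions [sum_k (T h_k)_i b_k], for [i < s],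
    are zero. These have small pole order, which leaves fewer conditions than unknowns. *)
Lemma stepanov s A B : (s <= q)%N -> (crk X * A < q)%N ->
    (\sum_(i < s) cdim X (A + B + 2 * cdf X * i) < cdim X A * cdim X B)%N ->
  (s * #|cpt X| <= crk X * (A + q * B))%N.
Proof.
move=> lesq ltAq ltdim.
case: (pickP (mem (cpt X))) => [z0 _|no]; last first.
  by rewrite (eq_card0 no) muln0.
pose a j := cenc (delta_mx 0 j : 'rV_(cdim X A)).
pose b k := cenc (delta_mx 0 k : 'rV_(cdim X B)).
have wa j : wt A (a j) by eexists.
have wb k : wt B (b k) by eexists.
have tP (i : 'I_s) (jk : 'I_(cdim X A) * 'I_(cdim X B)) :
    wt (A + B + 2 * cdf X * i) (cT X (a jk.1) i * b jk.2).
  by rewrite addnAC; apply: cwt_mul => //; exact: cT_wt.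
pose t i jk := projT1 (cid (tP i jk)).
have tE i jk : cenc (t i jk) = cT X (a jk.1) i * b jk.2 by rewrite /t; case: cid.
have [|c [[j0 k0] /eqP nz] rel] := @common_kernel _ _ _ _ t.
  by rewrite card_prod !card_ord.
pose h k := \sum_j cS X (c (j, k))%:P * a j.
have wh k : wt A (h k) by apply: wt_sum => j _; exact: wtZ.
have hE k : h k = cenc (\row_j c (j, k)).
  rewrite [in RHS](row_sum_delta (\row_j c (j, k))) cenc_sum.
  by apply: eq_bigr => j _; rewrite mxE.
have relh (i : 'I_s) : \sum_k cT X (h k) i * b k = 0.
  have := congr1 (@cenc _ _ _) (rel i); rewrite cenc_sum cenc0 => r0; rewrite -[RHS]r0.
  have -> : \sum_x cS X (c x)%:P * cenc (t i x) =
      \sum_j \sum_k cS X (c (j, k))%:P * cenc (t i (j, k)).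
    by rewrite pair_big; apply: eq_bigr => -[].
  rewrite exchange_big /=; apply: eq_bigr => k _.
  rewrite rmorph_sum fps_sum mulr_suml; apply: eq_bigr => j _.
  by rewrite cT_lin tE mulrA.
pose Psi := \sum_k h k * b k ^+ q.
have Psi0 : Psi <> 0.
  move=> P0; have := qpower_indep z0 ltAq wh _ P0 => /(_ _ k0) h0.
  have /h0 : forall d : 'I_(cdim X B) -> K,
      \sum_k cS X (d k)%:P * b k = 0 -> forall k, d k = 0.
    move=> d sd k; have : cenc (\row_k d k) = 0.
      rewrite (row_sum_delta (\row_k d k)) cenc_sum -[RHS]sd.
      by apply: eq_bigr => i _; rewrite mxE.
    by move/cenc_inj/rowP => /(_ k); rewrite !mxE.
  by rewrite hE => /cenc_inj/rowP/(_ j0); rewrite !mxE.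
have wPsi : wt (A + q * B) Psi.
  apply: wt_sum => k _; apply: cwt_mul => //.
  by rewrite mulnC; exact: wtX.
have := @czeros _ X (fun=> s) Psi _ Psi0 wPsi.
rewrite sum_nat_const mulnC; apply=> z i ltis.
rewrite /fps_map /Psi rmorph_sum fps_sum.
have ltiq : (i < q)%N by lia.
under eq_bigr do rewrite cT_powq //.
rewrite rmorph_sum; under eq_bigr do rewrite rmorphM cev_expq -rmorphM.
by rewrite -rmorph_sum (relh (Ordinal ltis)) rmorph0.
Qed.

End Stepanov.

(** * Points of double covers and of their twists *)

Section PointCount.
Variables (K : finFieldType) (p q s : nat).
Hypotheses (pcharK : p \in [pchar K]) (cardK : #|K| = q) (p_q : p.-nat q).
Hypothesis two_neq0 : (2 : K) != 0.
Hypotheses (s_ge10 : (10 <= s)%N) (s_le : (s ^ 2 <= q)%N) (q_le : (q <= s * (s + 2))%N).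

Lemma curve_card_ub (X : curve K) :
    (0 < crk X)%N -> (0 < cdf X)%N -> (2 * crk X * cdf X <= q)%N ->
  (#|cpt X| <= q + 8 * crk X * cdf X * (s + 2))%N.
Proof.
set n := crk X; set W := cdf X => n0 W0 nWq.
(* [A] is the largest order with [n A < q]. There are about [n s (A + B + W s)] conditions. The part
   [s] of [n b] absorbs the term in [A], and the excess [6 n W] absorbs [W s^2], which is at most
   [W q], since [q <= 2 n a]. *)
pose A := (q.-1 %/ n)%N; pose b := ((s + 6 * n * W) %/ n).+1; pose B := (b + W).-1.
have q0 : (0 < q)%N by nia.
have nA : (n * A < q)%N.
  by have := leq_trunc_div q.-1 n; rewrite -/A mulnC; lia.
have nA1 : (q <= n * A.+1)%N.
  by have := ltn_ceil q.-1 n0; rewrite -/A mulnC; lia.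
have nb1 : (s + 6 * (n * W) < n * b)%N.
  by have := ltn_ceil (s + 6 * n * W) n0; rewrite -/b; lia.
have nb2 : (n * b <= s + 6 * (n * W) + n)%N.
  by have := leq_trunc_div (s + 6 * n * W) n; rewrite /b mulnS; lia.
have leWA : (W <= A.+1)%N by nia.
pose a := (A.+1 - W)%N.
have eA : A.+1 = (a + W)%N by rewrite /a subnK.
have eB : B.+1 = (b + W)%N by rewrite /B prednK // addn_gt0 W0 orbT.
have na : (q <= 2 * (n * a))%N by move: nA1; rewrite eA mulnDr; nia.
have DA : (n * a <= cdim X A)%N.
  by have := cdim_lb X A; rewrite -/n -/W eA; lia.
have DB : (n * b <= cdim X B)%N.
  by have := cdim_lb X B; rewrite -/n -/W eB; lia.
pose P := (n * W)%N; have P0 : (0 < P)%N by rewrite muln_gt0 n0 W0.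
have nP : (n <= P)%N by rewrite leq_pmulr.
have key : (s * (a + b + 2 * W + W * s) < n * a * b)%N.
  have h1 : (a * s + 6 * P * a <= n * a * b)%N.
    have : (a * (s + 6 * P) <= a * (n * b))%N by rewrite leq_mul2l (ltnW nb1) orbT.
    by rewrite mulnDr; lia.
  suff h2 : (s * (b + 2 * W + W * s) < 6 * P * a)%N.
    have -> : (s * (a + b + 2 * W + W * s) = a * s + s * (b + 2 * W + W * s))%N by lia.
    by lia.
  rewrite -(ltn_pmul2l n0).
  have h3 : (3 * P * q <= n * (6 * P * a))%N.
    have : (3 * P * q <= 3 * P * (2 * (n * a)))%N by rewrite leq_mul2l na orbT.
    by lia.
  apply: leq_trans h3.
  have h4 : (n * (s * (b + 2 * W + W * s)) <= s ^ 2 + 9 * P * s + P * s ^ 2)%N.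
    have -> : (n * (s * (b + 2 * W + W * s)) = s * (n * b) + 2 * s * P + P * s ^ 2)%N.
      by rewrite /P; lia.
    have : (s * (n * b) <= s * (s + 7 * P))%N by rewrite leq_mul2l; apply/orP; right; lia.
    by lia.
  apply: leq_ltn_trans h4 _.
  have h5 : (s ^ 2 <= P * q)%N by apply: leq_trans s_le _; rewrite leq_pmull.
  have h6 : (P * s ^ 2 <= P * q)%N by rewrite leq_mul2l s_le orbT.
  have h7 : (9 * P * s < P * q)%N.
    rewrite (mulnC 9%N) -mulnA ltn_pmul2l //; apply: leq_trans s_le.
    have : (s * 10 <= s * s)%N by rewrite leq_mul2l s_ge10 orbT.
    by rewrite -[(s ^ 2)%N]/(s * s)%N; lia.
  by lia.
have lesq : (s <= q)%N by apply: leq_trans s_le; rewrite leq_pmulr //; lia.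
have sumD : (\sum_(i < s) cdim X (A + B + 2 * W * i) <= n * s * (A + B + 1 + W * s))%N.
  have : (\sum_(i < s) cdim X (A + B + 2 * W * i) <=
      \sum_(i < s) n * (A + B + 1 + 2 * W * i))%N.
    by apply: leq_sum => i _; apply: leq_trans (cdim_ub X _) _; rewrite -/n; lia.
  rewrite -big_distrr big_split /= sum_nat_const card_ord -big_distrr /=.
  move/leq_trans; apply; rewrite -!mulnA leq_mul2l; apply/orP; right.
  have sum_s m : (2 * \sum_(i < m) i <= m * m)%N.
    elim: m => [|m IHm]; first by rewrite big_ord0.
    rewrite big_ord_recr /= mulnDr; apply: leq_trans (leq_add IHm (leqnn _)) _.
    by lia.
  have : (W * (2 * \sum_(i < s) i) <= W * (s * s))%N by rewrite leq_mul2l sum_s orbT.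
  by move=> h; rewrite (mulnDr s (A + B + 1)) leq_add2l mulnCA (mulnCA s W).
have ltD : (\sum_(i < s) cdim X (A + B + 2 * W * i) < cdim X A * cdim X B)%N.
  apply: leq_ltn_trans sumD _; apply: leq_trans (leq_mul DA DB).
  have -> : (n * a * (n * b) = n * (n * a * b))%N by lia.
  rewrite -mulnA ltn_pmul2l //; apply: leq_ltn_trans key.
  by rewrite leq_mul2l; apply/orP; right; lia.
have st := stepanov pcharK cardK p_q lesq nA ltD.
have nB : (n * B <= s + 7 * P)%N.
  have : (n * B.+1 = n * b + P)%N by rewrite eB mulnDr.
  by rewrite mulnS; lia.
rewrite -(leq_pmul2l (m := s)); last by lia.
apply: (leq_trans st); rewrite -/n.
have -> : (n * (A + q * B) = n * A + q * (n * B))%N by lia.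
have h1 : (q * (n * B) <= q * (s + 7 * P))%N by rewrite leq_mul2l nB orbT.
have h2 : (q * (8 * P) <= s * (s + 2) * (8 * P))%N by rewrite leq_mul2r q_le orbT.
have h3 : (q <= q * P)%N by rewrite leq_pmulr.
have -> : (s * (q + 8 * n * W * (s + 2)) = s * q + s * (s + 2) * (8 * P))%N by rewrite /P; lia.
by lia.
Qed.

(** Squaring is at most two-to-one, so at least half of the nonzero elements are squares; a
    nonsquare exists because [1] and [-1] have the same square. The squares and a single coset of
    them then exhaust the nonzero elements. *)
Lemma nonsquare_ex : exists2 c : K, c != 0 &
  forall a, a != 0 -> (exists x, x ^+ 2 = a) \/ (exists x, x ^+ 2 = c * a).
Proof.
pose U := [set x : K | x != 0]; pose S := [set x ^+ 2 | x in U].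
have sqS x : x != 0 -> (x ^+ 2 \in S) by move=> x0; apply: imset_f; rewrite inE.
have S0 x : x \in S -> x != 0 by case/imsetP => y; rewrite inE => y0 ->; rewrite expf_neq0.
have SM x y : x \in S -> y \in S -> x * y \in S.
  move=> /imsetP [x' + ->] /imsetP [y' + ->]; rewrite !inE -exprMn => x0 y0.
  by apply: sqS; rewrite mulf_neq0.
have SV x : x \in S -> x^-1 \in S.
  by move=> /imsetP [x' + ->]; rewrite inE -exprVn => x0; apply: sqS; rewrite invr_eq0.
have cardU : (#|U| <= 2 * #|S|)%N.
  rewrite -sum1_card (partition_big (fun x => x ^+ 2) (mem S)) /=; last first.
    by move=> x; rewrite inE => /sqS.
  rewrite mulnC -sum_nat_const; apply: leq_sum => y /imsetP [x _ ->].
  rewrite sum1dep_card; apply: (@leq_trans #|[set x; - x]|).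
    by apply: subset_leq_card; apply/subsetP => z; rewrite !inE eqf_sqr => /andP [].
  by rewrite cards2; case: (x != - x).
have [c cU cS] : exists2 c, c \in U & c \notin S.
  apply/exists_inP; apply: contraT; rewrite negb_exists_in => /forall_inP allS.
  have SU : U \subset S by apply/subsetP => x xU; have := allS x xU; rewrite negbK.
  have /imset_injP inj : #|S| == #|U|.
    by rewrite eqn_leq leq_imset_card subset_leq_card.
  have := inj 1 (-1); rewrite !inE oner_eq0 oppr_eq0 oner_eq0 sqrrN => /(_ isT isT erefl).
  move/eqP; rewrite -subr_eq0 opprK -mulr2n => two0.
  by case/negP: two_neq0.
move: (cU); rewrite inE => c0; exists c => // a a0.
have inS x : x \in S -> exists y, y ^+ 2 = x by case/imsetP => y _ ->; exists y.
have [/inS|aS] := boolP (a \in S); [by left | right; apply: inS].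
apply: contraT => caS.
pose cS' := [set c * x | x in S].
have disj : [disjoint S & cS'].
  apply/pred0P => x /=; apply: contraNF cS => /andP [xS /imsetP [y yS exy]].
  by rewrite -(mulfK (S0 y yS) c) -exy SM // SV.
have : (#|a |: (S :|: cS')| <= #|U|)%N.
  apply: subset_leq_card; apply/subsetP => x; rewrite !inE => /or3P [/eqP ->//|/S0 //|].
  by case/imsetP => y /S0 y0 ->; rewrite mulf_neq0.
rewrite cardsU1 inE negb_or aS /= => h.
have acS' : a \notin cS'.
  apply: contra caS => /imsetP [y yS ->]; rewrite mulrA -expr2; apply: SM => //.
  exact: sqS.
move: h; rewrite acS' cardsU (eqP (_ : #|S :&: cS'| == 0)%N); last first.
  by rewrite cards_eq0 setI_eq0.
have -> : #|cS'| = #|S| by apply: card_imset; exact: mulfI.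
by rewrite subn0 addnn -mul2n /= add1n ltnNge cardU.
Qed.

Section Step.
Variables (X : curve K) (f : cR X) (w : nat).
Hypothesis wt_f : filt (@cenc K X) (2 * w) f.
Hypothesis nonsq : forall c : K, c != 0 ->
  forall a b : cR X, a ^+ 2 = cS X c%:P * f * b ^+ 2 -> b = 0.

Lemma nonsq1 (a b : cR X) : a ^+ 2 = f * b ^+ 2 -> b = 0.
Proof.
move=> e; apply: (nonsq (oner_neq0 K) (a := a)).
by rewrite rmorph1 mul1r.
Qed.

Definition quad_step := quad_curve two_neq0 wt_f nonsq1.

(** Above a point where [f] does not vanish, one of the covers [y^2 = f] and [y^2 = c f] has two
    points. The upper bound for the second cover is therefore a lower bound for the first. *)
Lemma quad_step_card : (0 < crk X)%N -> (0 < cdf X + w)%N ->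
    (2 * (2 * crk X) * (cdf X + w) <= q)%N ->
  (2 * #|cpt X| <= #|cpt quad_step| + q + 4 * crk X * w +
    16 * crk X * (cdf X + w) * (s + 2))%N.
Proof.
move=> n0 W0 lenW; have [c c0 cP] := nonsquare_ex.
have wcf : filt (@cenc K X) (2 * w) (cS X c%:P * f) by exact: wtZ.
have nonsqc (a b : cR X) : a ^+ 2 = cS X c%:P * f * b ^+ 2 -> b = 0 by exact: nonsq.
pose Y := quad_curve two_neq0 wcf nonsqc.
have cardY : (#|cpt Y| <= q + 8 * (2 * crk X) * (cdf X + w) * (s + 2))%N.
  by apply: (@curve_card_ub Y) => //=; lia.
have f0 : f <> 0.
  move=> f0; have := @nonsq1 0 1; rewrite f0 mul0r expr0n => /(_ erefl) /eqP.
  by rewrite oner_eq0.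
pose Z := [pred z : cpt X | cev z f == 0].
have cardZ : (#|Z| <= crk X * (2 * w))%N.
  have := @czeros _ X (fun z => (z \in Z : nat)) f _ f0 wt_f.
  have -> : (\sum_z (z \in Z : nat) = #|Z|)%N.
    by rewrite -sum1_card [RHS]big_mkcond; apply: eq_bigr => z _; case: (z \in Z).
  apply=> z i; case: (boolP (z \in Z)) => //=; rewrite inE => /eqP fz.
  by case: i => // _; rewrite /fps_map cT0.
suff : (2 * #|cpt X| <= #|cpt quad_step| + #|cpt Y| + 2 * #|Z|)%N by lia.
pose rt (g : cR X) z := [pred x : K | (x ^+ 2 == cev z g) && (x != 0)].
have cardQ (g : cR X) : #|quad_pt g| = (\sum_(z : cpt X) #|rt g z|)%N.
  rewrite card_sig -sum1_card (eq_bigl (fun u : cpt X * K => true &&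
    ((u.2 ^+ 2 == cev u.1 g) && (u.2 != 0)))) //.
  rewrite -(pair_big_dep xpredT (fun z x => (x ^+ 2 == cev z g) && (x != 0)) (fun _ _ => 1%N)).
  by apply: eq_bigr => z _; rewrite sum1_card.
rewrite [#|cpt quad_step|]cardQ [#|cpt Y|]cardQ -(sum1_card Z) (big_mkcond (mem Z)).
rewrite -sum1_card !big_distrr -!big_split /=; apply: leq_sum => z _.
case: (boolP (z \in Z)) => [_|]; first by rewrite leq_addl.
rewrite inE => fz; rewrite muln0 addn0.
have two (g : cR X) (x : K) : x ^+ 2 = cev z g -> cev z g != 0 ->
    (2 <= #|rt g z|)%N.
  move=> ex gz; have x0 : x != 0 by apply: contraNneq gz => x0; rewrite -ex x0 expr0n.
  have -> : 2%N = #|[set x; - x]|.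
    rewrite cards2 -addr_eq0 -mulr2n -mulr_natl mulf_neq0 //.
  apply: subset_leq_card; apply/subsetP => y; rewrite !inE => /orP [] /eqP ->.
    by rewrite ex eqxx.
  by rewrite sqrrN ex eqxx oppr_eq0.
case: (cP _ fz) => -[x ex]; first by apply: leq_trans (two _ _ ex fz) (leq_addr _ _).
have ecf : cev z (cS X c%:P * f) = c * cev z f by rewrite rmorphM cev_const.
rewrite -ecf in ex; apply: leq_trans (two _ _ ex _) (leq_addl _ _).
by rewrite ecf mulf_neq0.
Qed.

End Step.

Variable M : nat.
Hypothesis M_q : (4 * 2 ^ M * (2 * M) <= q)%N.

(** The deficit of points doubles with each cover and gains at most [2^(j+1) * 17 M (s + 2)]: a
    share 16 for the bound on the twist, and 1 for the zeros of the radicand. The bound on [cdf]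
    reflects radicands with [w <= 2]. *)
Definition tower_ok j (X : curve K) :=
  [/\ crk X = (2 ^ j)%N, (cdf X <= 2 * j)%N &
      (q <= #|cpt X| + 2 ^ j * j * (17 * M * (s + 2)))%N].

Lemma tower_ok0 : tower_ok 0 (base_curve K).
Proof. by split=> //=; rewrite cardK muln0 mul0n addn0. Qed.

Lemma tower_ok_step j (X : curve K) (f : cR X) w
    (wt_f : filt (@cenc K X) (2 * w) f)
    (nonsq : forall c : K, c != 0 ->
      forall a b : cR X, a ^+ 2 = cS X c%:P * f * b ^+ 2 -> b = 0) :
  (j < M)%N -> (0 < w <= 2)%N -> tower_ok j X -> tower_ok j.+1 (quad_step wt_f nonsq).
Proof.
move=> ltjM /andP [w0 w2] [rkX dfX cardX]; split; rewrite /= ?rkX ?expnS //; first by lia.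
have le2 : (2 ^ j.+1 <= 2 ^ M)%N by rewrite leq_exp2l.
have := @quad_step_card X f w wt_f nonsq; rewrite rkX expn_gt0 /=.
have e1 : (0 < cdf X + w)%N by rewrite addn_gt0 w0 orbT.
have le_df : (cdf X + w <= 2 * j + 2)%N by lia.
have e2 : (2 * (2 * 2 ^ j) * (cdf X + w) <= q)%N.
  apply: leq_trans M_q; rewrite -expnS.
  have : (cdf X + w <= 2 * M)%N by lia.
  by move: le2; nia.
move=> /(_ isT e1 e2).
move: cardX e1 e2 le2; set N := (2 ^ j)%N; set T := (s + 2)%N => cardX _ _ _ h.
have T4 : (4 <= T)%N by rewrite /T; lia.
have h0 : (N * T * (cdf X + w) <= N * T * (2 * j + 2))%N by rewrite leq_mul2l le_df orbT.
have h1 : (16 * N * (2 * j + 2) * T <= 32 * N * (M * T))%N.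
  have : (N * T * (j + 1) <= N * T * M)%N by rewrite leq_mul2l; apply/orP; right; lia.
  by lia.
have h2 : (4 * N * w <= 2 * N * (M * T))%N.
  have h3 : (4 <= M * T)%N by apply: leq_trans T4 _; rewrite leq_pmull //; lia.
  have : (2 * N * 4 <= 2 * N * (M * T))%N by rewrite leq_mul2l h3 orbT.
  have : (4 * N * w <= 4 * N * 2)%N by rewrite leq_mul2l w2 orbT.
  by lia.
move: #|cpt X| #|_| cardX h => c1 c2 cardX h.
by lia.
Qed.

End PointCount.

(** The multiplicity of [r] would be even on one side and odd on the other. *)
Lemma nonsq_simple_root (K : fieldType) (p p' a b : {poly K}) r :
    p = ('X - r%:P) * p' -> ~~ root p' r -> a ^+ 2 = p * b ^+ 2 -> b = 0.
Proof.
move=> -> p'r e; apply/eqP/negPn/negP => b0.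
have p'0 : p' != 0 by apply: contraNneq p'r => ->; rewrite root0.
have X0 : 'X - r%:P != 0 by rewrite polyXsubC_eq0.
have a0 : a != 0 by rewrite -sqrf_eq0 e !mulf_neq0 ?expf_neq0.
have := congr1 (mup r) e; rewrite !expr2 !mupM ?mulf_neq0 //.
rewrite -['X - _]expr1 mup_XsubCX eqxx (mupNroot p'r).
by move=> h; have := congr1 odd h; rewrite addn0 !oddD !addbb.
Qed.

(** * A tower of square roots that yields 2-power torsion *)

(* Halving a point of abscissa [x] on [y^2 = x (x + (a + b)^2) (x + 4 a b)]
   under the isogeny that maps [x'] to [(x' - a b)^2 / x']. *)
Section Halving.
Variables (R : comNzRingType) (h a b x : R).
Hypothesis h2 : h * 2 = 1.

Lemma halving_norm : (a * b + h * x) ^+ 2 - x * (x + 4 * a * b) * h ^+ 2 = (a * b) ^+ 2.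
Proof.
have -> : (a * b + h * x) ^+ 2 - x * (x + 4 * a * b) * h ^+ 2 =
    (a * b) ^+ 2 + (1 - h * 2) * (2 * h * a * b * x) by ring.
by rewrite h2 subrr mul0r addr0.
Qed.

(** With [halving_norm], this computes the norm of the next radicand [x' (x' + b^2)] from the
    extension by [v]: up to squares it is [x + (a + b)^2]. *)
Lemma halving_normD :
  (a * b + h * x + b ^+ 2) ^+ 2 - x * (x + 4 * a * b) * h ^+ 2 =
  b ^+ 2 * (x + (a + b) ^+ 2).
Proof.
have -> : (a * b + h * x + b ^+ 2) ^+ 2 - x * (x + 4 * a * b) * h ^+ 2 =
    (a * b + h * x) ^+ 2 - x * (x + 4 * a * b) * h ^+ 2 +
    b ^+ 2 * (b ^+ 2 + 2 * (a * b) + h * 2 * x) by ring.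
by rewrite halving_norm h2; ring.
Qed.

(** This shows that [x' (x' + a^2) (x' + b^2)] is [x'^2] times [x + (a + b)^2], hence provides the
    ordinate of the new point. *)
Lemma halving_eq v (x' := a * b + h * x + h * v) : v ^+ 2 = x * (x + 4 * a * b) ->
  (x' + a ^+ 2) * (x' + b ^+ 2) = x' * (x + (a + b) ^+ 2).
Proof.
move=> ev; apply/eqP; rewrite -subr_eq0; apply/eqP.
have -> : (x' + a ^+ 2) * (x' + b ^+ 2) - x' * (x + (a + b) ^+ 2) =
    h ^+ 2 * (v ^+ 2 - x * (x + 4 * a * b)) +
    (h * 2 - 1) * (h * x ^+ 2 + a * b * x * (h * 2 + 1) + h * x * v).
  by rewrite /x'; ring.
by rewrite ev h2 !subrr mulr0 mul0r addr0.
Qed.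

End Halving.

Section Tower.
Variables (K : finFieldType) (p q s M : nat).
Hypotheses (pcharK : p \in [pchar K]) (cardK : #|K| = q) (p_q : p.-nat q).
Hypothesis two_neq0 : (2 : K) != 0.
Hypotheses (s_ge10 : (10 <= s)%N) (s_le : (s ^ 2 <= q)%N) (q_le : (q <= s * (s + 2))%N).
Hypothesis M_q : (4 * 2 ^ M * (2 * M) <= q)%N.

(** Nonsquare in the geometric sense, up to constants: both the cover by [f] and its twists are then
    domains. *)
Definition nonsquare (X : curve K) (f : cR X) := forall c : K, c != 0 ->
  forall a b : cR X, a ^+ 2 = cS X c%:P * f * b ^+ 2 -> b = 0.

Notation hlf X := (cS X (2^-1)%:P).
Notation wt X := (filt (@cenc K X)).
Notation tower_ok := (@tower_ok K q s M).

Lemma hlf2 (X : curve K) : hlf X * 2 = 1.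
Proof. by rewrite mulr_natr (quad_half2 X two_neq0). Qed.

Lemma cS_neq0 (X : curve K) (c : K) : c != 0 -> cS X c%:P <> 0.
Proof.
move=> c0 e; have := congr1 (fun a => a * cS X (c^-1)%:P) e.
by rewrite mul0r -rmorphM -polyCM mulfV // rmorph1 => /eqP; rewrite oner_eq0.
Qed.

Lemma curve_mul_neq0 (X : curve K) (a b : cR X) : a <> 0 -> b <> 0 -> a * b <> 0.
Proof. by move=> a0 b0 /curve_dom []. Qed.

Lemma curve_sq_neq0 (X : curve K) (a : cR X) : a <> 0 -> a ^+ 2 <> 0.
Proof. by move=> a0; rewrite expr2; apply: curve_mul_neq0. Qed.

Lemma nonsquare_neq0 (X : curve K) (f : cR X) : nonsquare f -> f <> 0.
Proof.
move=> ns f0; have : (1 : cR X) = 0; last by move/eqP; rewrite oner_eq0.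
by apply: (ns 1 (oner_neq0 K) 0); rewrite f0 mulr0 mul0r expr0n.
Qed.

Lemma nonsquareM2 (X : curve K) (f g : cR X) : g <> 0 ->
  nonsquare f -> nonsquare (g ^+ 2 * f).
Proof.
move=> g0 ns c c0 a b e; have : g * b = 0.
  by apply: (ns c c0 a); rewrite e; ring.
by case/curve_dom.
Qed.

Section QuadStep.
Variables (X : curve K) (f : cR X) (w : nat).
Hypotheses (wt_f : wt X (2 * w) f) (ns_f : nonsquare f).

Notation Y := (quad_step two_neq0 wt_f ns_f).
Notation qin := (@quad_in (cR X) f).

Definition curve_in : {rmorphism cR X -> cR Y} := qin.
Definition curve_y : cR Y := quad_y f.
Definition curve_norm (u : cR Y) : cR X := quad_norm (u : quad f).

Lemma curve_y2 : curve_y ^+ 2 = curve_in f. Proof. exact: quad_y2. Qed.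
Lemma curve_normM u v : curve_norm (u * v) = curve_norm u * curve_norm v.
Proof. exact: quad_normM. Qed.
Lemma curve_norm_in a : curve_norm (curve_in a) = a ^+ 2.
Proof. by rewrite /curve_norm /quad_norm /= expr0n mulr0 subr0. Qed.
Lemma curve_norm_y : curve_norm curve_y = - f.
Proof. by rewrite /curve_norm /quad_norm /= expr0n expr1n mulr1 sub0r. Qed.
Lemma curve_norm_eq0 u : curve_norm u = 0 -> u = 0.
Proof. exact: (quad_norm_eq0 (nonsq1 ns_f)). Qed.
Lemma curve_in_S t : cS Y t = curve_in (cS X t). Proof. by []. Qed.
Lemma curve_in_inj a : curve_in a = 0 -> a = 0. Proof. by case. Qed.
Lemma curve_wt_in A a : wt X A a -> wt Y A (curve_in a).
Proof. exact: quad_wt_in. Qed.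
Lemma curve_wt_y : wt Y w curve_y. Proof. exact: quad_wt_y. Qed.
Lemma curve_in_ev (z : cpt Y) a : cev z (curve_in a) = cev (val z).1 a.
Proof. by rewrite /= /quad_evr /= /quad_ev /= rmorph0 mul0r addr0. Qed.
Lemma curve_y_ev (z : cpt Y) : cev z curve_y != 0.
Proof.
rewrite /= /quad_evr /= /quad_ev /= rmorph0 rmorph1 add0r mul1r.
exact: quad_pt_neq0.
Qed.

(** The norm of [c g y B^2] is [- f] times a square, and [- f] is not a square. *)
Lemma nonsquare_y (g : cR X) : g <> 0 -> nonsquare (curve_in g * curve_y).
Proof.
move=> g0 c c0 A B e; apply: curve_norm_eq0.
have : cS X c%:P * g * curve_norm B = 0.
  apply: (@ns_f (-1) _ (curve_norm A)); first by rewrite oppr_eq0 oner_eq0.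
  have := congr1 curve_norm e; rewrite expr2 !curve_normM -expr2 => ->.
  rewrite curve_in_S !curve_norm_in curve_norm_y polyCN rmorphN rmorph1.
  by ring.
case/curve_dom => // /curve_dom [] // /(cS_neq0 c0) [].
Qed.

(** As in Kummer theory, an element of the base becomes a square after adjunction of a root of [f]
    only if it, or its product by [f], was one already. *)
Lemma nonsquare_in (g : cR X) :
  nonsquare g -> nonsquare (g * f) -> nonsquare (curve_in g).
Proof.
move=> ns_g ns_gf c c0 A B e; apply: curve_norm_eq0.
set b := curve_norm B; pose C : quad f := A * quad_conj (B : quad f).
have eC : C ^+ 2 = curve_in (cS X c%:P * g * b ^+ 2) :> quad f.
  rewrite rmorphM rmorphXn -[curve_in b]quad_normE rmorphM -curve_in_S /C.
  by rewrite exprMn [A ^+ 2]e; ring.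
case: C eC => c1 c2 eC.
have e1 : c1 ^+ 2 + f * c2 ^+ 2 = cS X c%:P * g * b ^+ 2.
  have := congr1 (fun u : quad f => u.1) eC; rewrite expr2 /= => <-; ring.
have e2 : c1 * c2 = 0.
  have h0 := congr1 (fun u : quad f => u.2) eC; rewrite expr2 /= in h0.
  by rewrite -[LHS]mul1r -(hlf2 X) -[RHS](mulr0 (hlf X)) -[X in _ = _ * X]h0; ring.
case/curve_dom: e2 => e2; rewrite e2 expr0n ?mulr0 ?addr0 ?add0r in e1.
  have : b = 0; last by [].
  apply: (ns_gf _ c0 (f * c2)); rewrite exprMn expr2 -mulrA e1; ring.
exact: (ns_g _ c0 c1).
Qed.

End QuadStep.

(** The arithmetic-geometric mean of [1] and [x]; the next radicand is [al k * rh k]. The condition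
    on [1 + x] is carried along because the second half of the tower begins with its square root,
    and the third condition is what keeps the second one true after an extension. *)
Record rho_tower k (X : curve K) (al rh : nat -> cR X) : Prop := RhoTower {
  rho_ok : tower_ok k X;
  rho_al0 : al 0%N = 1;
  rho_rh0 : rh 0%N = cS X 'X;
  rho_al : forall j, (j < k)%N -> al j.+1 = hlf X * (al j + rh j);
  rho_rh : forall j, (j < k)%N -> rh j.+1 ^+ 2 = al j * rh j;
  rho_wt : forall j, (j <= k)%N -> wt X 1 (al j) /\ wt X 1 (rh j);
  rho_ev : forall z j, (0 < j <= k)%N -> cev z (rh j) != 0;
  rho_ns : nonsquare (al k * rh k);
  rho_ns1 : nonsquare (1 + cS X 'X);
  rho_nsx : nonsquare ((1 + cS X 'X) * (al k * rh k))
}.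

Lemma rho_tower0 : exists (X : curve K) (al rh : nat -> cR X), rho_tower 0 al rh.
Proof.
have e1 : (1 + 'X : {poly K}) = 'X - (-1)%:P by rewrite polyCN opprK addrC.
exists (base_curve K), (fun=> 1), (fun=> 'X); split=> //.
- exact: tower_ok0.
- move=> j _; split; first by apply: cwt_mono (wt1 (base_curve K)).
  by apply: (@cwt_poly K (base_curve K) 1 'X); rewrite size_polyX.
- by move=> z [].
- move=> c c0 a b; apply: (@nonsq_simple_root _ _ c%:P _ _ 0); last by rewrite rootC.
  by rewrite /= subr0 mul1r mulrC.
- move=> c c0 a b; apply: (@nonsq_simple_root _ _ c%:P _ _ (-1)); last by rewrite rootC.
  by rewrite /= -e1 mulrC.
- move=> c c0 a b; apply: (@nonsq_simple_root _ _ (c%:P * (1 + 'X)) _ _ 0).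
    by rewrite /= subr0 mul1r; ring.
  by rewrite rootM rootC negb_or c0 /= rootE !hornerE oner_eq0.
Qed.

Lemma rho_al_neq0 k (X : curve K) (al rh : nat -> cR X) :
  rho_tower k al rh -> hlf X * (al k + rh k) <> 0.
Proof.
move=> T /curve_dom [|e0].
  by apply: cS_neq0; rewrite invr_eq0.
have : (1 : cR X) = 0; last by move/eqP; rewrite oner_eq0.
apply: (rho_ns T (c := -1) _ (a := al k)); first by rewrite oppr_eq0 oner_eq0.
have -> : rh k = - al k by apply/eqP; rewrite -addr_eq0 addrC e0.
by rewrite polyCN rmorphN rmorph1; ring.
Qed.

Lemma rho_towerS k (X : curve K) (al rh : nat -> cR X) :
  (k < M)%N -> rho_tower k al rh ->
  exists (Y : curve K) (al' rh' : nat -> cR Y), rho_tower k.+1 al' rh'.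
Proof.
move=> ltkM T; have [wa wr] := rho_wt T (leqnn k).
have wf : wt X (2 * 1) (al k * rh k) by exact: cwt_mul wa wr.
pose Y := quad_step two_neq0 wf (rho_ns T).
pose qin : {rmorphism cR X -> cR Y} := curve_in wf (rho_ns T).
pose y : cR Y := curve_y wf (rho_ns T).
pose al' j := if (j <= k)%N then qin (al j) else qin (hlf X * (al k + rh k)).
pose rh' j := if (j <= k)%N then qin (rh j) else y.
have alS : al' k.+1 = qin (hlf X * (al k + rh k)) by rewrite /al' ltnn.
have rhS : rh' k.+1 = y by rewrite /rh' ltnn.
have alE j : (j <= k)%N -> al' j = qin (al j) by rewrite /al' => ->.
have rhE j : (j <= k)%N -> rh' j = qin (rh j) by rewrite /rh' => ->.
exists Y, al', rh'; split.
- by apply: (tower_ok_step pcharK) (rho_ok T).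
- by rewrite alE // (rho_al0 T) rmorph1.
- by rewrite rhE // (rho_rh0 T).
- move=> j; rewrite ltnS => lejk; rewrite (alE j) // (rhE j) //.
  move: lejk; rewrite leq_eqVlt => /predU1P [->|ltjk].
    by rewrite alS rmorphM rmorphD.
  by rewrite alE // (rho_al T) // rmorphM rmorphD.
- move=> j; rewrite ltnS => lejk; rewrite (alE j) // (rhE j) // -rmorphM.
  move: lejk; rewrite leq_eqVlt => /predU1P [->|ltjk]; first by rewrite rhS; exact: curve_y2.
  by rewrite rhE // -rmorphXn (rho_rh T).
- move=> j; rewrite leq_eqVlt => /predU1P [->|]; rewrite ?ltnS.
    rewrite alS rhS; split; last exact: curve_wt_y.
    by apply: curve_wt_in; apply: wtZ; apply: wtD.
  by move=> lejk; rewrite alE // rhE //; have [] := rho_wt T lejk; split; exact: curve_wt_in.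
- move=> z j /andP [j0]; rewrite leq_eqVlt => /predU1P [->|]; rewrite ?ltnS.
    by rewrite rhS; exact: curve_y_ev.
  by move=> lejk; rewrite rhE // curve_in_ev (rho_ev T) // j0.
- by rewrite alS rhS; apply: nonsquare_y; exact: rho_al_neq0 T.
- have -> : 1 + cS Y 'X = qin (1 + cS X 'X) by rewrite rmorphD rmorph1.
  by apply: nonsquare_in; [exact: rho_ns1 T | exact: rho_nsx T].
- have -> : 1 + cS Y 'X = qin (1 + cS X 'X) by rewrite rmorphD rmorph1.
  rewrite alS rhS mulrA -rmorphM; apply: nonsquare_y.
  apply: curve_mul_neq0; last exact: rho_al_neq0 T.
  exact: nonsquare_neq0 (rho_ns1 T).
Qed.

Lemma rho_tower_ex k : (k <= M)%N ->
  exists (X : curve K) (al rh : nat -> cR X), rho_tower k al rh.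
Proof.
elim: k => [|k IHk] lekM; first exact: rho_tower0.
by have [|X [al [rh T]]] := IHk _; [exact: ltnW | exact: rho_towerS T].
Qed.

(* [al], [rh] give the curves [y^2 = x (x + al_i^2) (x + B_i)], and [xx i] is
   the abscissa of a point of order [2^(i+1)] on the [i]-th one. *)
Definition Bq (R : pzRingType) (al rh : nat -> R) i := al i ^+ 2 - rh i ^+ 2.

(** [tor_y] says that the point of abscissa [x = xx j.+1] has a rational ordinate, denominators
    being cleared by [e]. Modulo squares, [x + al^2] is then the radicand [x (x + B)]; this is how
    the norm of the following radicand is seen not to be a square. *)
Record tor_tower k j (X : curve K) (al rh xx vv : nat -> cR X) : Prop := TorTower {
  tor_ok : tower_ok (k + j) X;
  tor_al0 : al 0%N = 1;
  tor_al : forall i, (i < k)%N -> al i.+1 = hlf X * (al i + rh i);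
  tor_rh : forall i, (i < k)%N -> rh i.+1 ^+ 2 = al i * rh i;
  tor_wt : forall i, (i <= k)%N -> wt X 1 (al i) /\ wt X 1 (rh i);
  tor_ev : forall z i, (0 < i <= k)%N -> cev z (rh i) != 0;
  tor_B : forall i, (i <= k)%N -> Bq al rh i <> 0;
  tor_x1 : xx 1%N = hlf X ^+ 2 * Bq al rh 0;
  tor_vv : forall i, (0 < i <= j)%N -> vv i ^+ 2 = xx i * (xx i + Bq al rh i);
  tor_xx : forall i, (0 < i <= j)%N ->
    xx i.+1 = hlf X * (hlf X * Bq al rh i + xx i + vv i);
  tor_evv : forall z i, (0 < i <= j)%N -> cev z (vv i) != 0;
  tor_wtx : wt X 2 (xx j.+1);
  tor_ns : nonsquare (xx j.+1 * (xx j.+1 + Bq al rh j.+1));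
  tor_y : exists e y, [/\ e <> 0, y <> 0 &
    e ^+ 2 * (xx j.+1 * (xx j.+1 + Bq al rh j.+1) * (xx j.+1 + al j.+1 ^+ 2)) = y ^+ 2]
}.

Lemma half_cancel (X : curve K) (a : cR X) : hlf X * a + hlf X * a = a.
Proof. by rewrite -[RHS]mul1r -(hlf2 X); ring. Qed.

Lemma tor_tower0 k : (1 <= k <= M)%N ->
  exists (X : curve K) (al rh xx vv : nat -> cR X), tor_tower k 0 al rh xx vv.
Proof.
case/andP=> k1 kM; have [X [al [rh T]]] := rho_tower_ex kM.
pose be := hlf X * (al 0%N - rh 0%N).
have eal1 : al 1%N = hlf X * (al 0%N + rh 0%N) by rewrite (rho_al T).
have BS i : (i < k)%N -> Bq al rh i.+1 = (hlf X * (al i - rh i)) ^+ 2.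
  move=> ltik; rewrite /Bq (rho_al T) // (rho_rh T) //.
  have h1 := half_cancel (1 : cR X); rewrite mulr1 in h1.
  have e : al i * rh i = (hlf X + hlf X) ^+ 2 * (al i * rh i) by rewrite h1 expr1n mul1r.
  by rewrite [in LHS]e; ring.
have eB0 : Bq al rh 0 = (1 + cS X 'X) * (1 - cS X 'X).
  by rewrite /Bq (rho_al0 T) (rho_rh0 T); ring.
have p0 : 1 + cS X 'X <> 0 := nonsquare_neq0 (rho_ns1 T).
have m0 : 1 - cS X 'X <> 0.
  move=> m0; have ex : cS X 'X = 1 by apply/eqP; rewrite eq_sym -subr_eq0 m0.
  have : (1 : cR X) = 0; last by move/eqP; rewrite oner_eq0.
  apply: (rho_ns1 T (c := 2) two_neq0 (a := 2)).
  by rewrite ex polyC_natr rmorph_nat; ring.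
have h0 : hlf X <> 0 by apply: cS_neq0; rewrite invr_eq0.
have Bn i : (i <= k)%N -> Bq al rh i <> 0.
  elim: i => [|i IHi] leik; first by rewrite eB0; exact: curve_mul_neq0.
  rewrite BS //; apply: curve_sq_neq0; apply: curve_mul_neq0 => // e0.
  apply: (IHi (ltnW leik)); rewrite /Bq subr_sqr e0 mul0r.
  by [].
have x1E : hlf X ^+ 2 * Bq al rh 0 = al 1%N * be.
  by rewrite eal1 /be /Bq; ring.
have be0 : be <> 0 by rewrite /be (rho_al0 T) (rho_rh0 T); exact: curve_mul_neq0.
have al10 : al 1%N <> 0.
  by rewrite eal1 (rho_al0 T) (rho_rh0 T); exact: curve_mul_neq0.
have albe : al 1%N + be = 1.
  by rewrite eal1 /be -mulrDr addrACA subrr addr0 mulrDr half_cancel (rho_al0 T).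
(* The first radicand of the second half is [1 + x], up to a constant and a square. *)
have fE : al 1%N * be * (al 1%N * be + be ^+ 2) =
    be ^+ 2 * (hlf X * (1 + cS X 'X)).
  rewrite -[1 + _](_ : al 0%N + rh 0%N = _); last by rewrite (rho_al0 T) (rho_rh0 T).
  by rewrite -eal1 -[RHS]mulr1 -albe; ring.
exists X, al, rh, (fun=> hlf X ^+ 2 * Bq al rh 0), (fun=> 0); split.
- by rewrite addn0; exact: rho_ok T.
- exact: rho_al0 T.
- exact: rho_al T.
- exact: rho_rh T.
- exact: rho_wt T.
- exact: rho_ev T.
- exact: Bn.
- by [].
- by case.
- by case.
- by move=> z [].
- have [wa wr] := rho_wt T (leq0n k); rewrite expr2 -mulrA; apply/wtZ/wtZ.
  by apply: wtB; [exact: (wtX 2 wa) | exact: (wtX 2 wr)].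
- rewrite x1E BS // -/be fE; apply: nonsquareM2 => //.
  move=> c c0 a b e; apply: (rho_ns1 T (c := c * 2^-1) _ (a := a)).
    by rewrite mulf_neq0 // invr_eq0.
  by rewrite e polyCM rmorphM; ring.
- exists 1, (be * al 1%N); split.
  + by apply/eqP; rewrite oner_eq0.
  + exact: curve_mul_neq0.
  rewrite x1E BS // -/be expr1n mul1r fE -[1 + _](_ : al 0%N + rh 0%N = _); last first.
    by rewrite (rho_al0 T) (rho_rh0 T).
  rewrite -eal1 -[RHS]mulr1 -albe; ring.
Qed.

Lemma tor_towerS k j (X : curve K) (al rh xx vv : nat -> cR X) :
  (k + j < M)%N -> (j.+2 <= k)%N -> tor_tower k j al rh xx vv ->
  exists (Y : curve K) (al' rh' xx' vv' : nat -> cR Y), tor_tower k j.+1 al' rh' xx' vv'.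
Proof.
move=> ltM lejk T.
set i := j.+1 in lejk; have ltik : (i < k)%N by [].
have [waS wrS] := tor_wt T ltik; have [wa wr] := tor_wt T (ltnW ltik).
pose x := xx i; pose B := Bq al rh i; pose f := x * (x + B); pose h := hlf X.
pose a := al i.+1; pose b := h * (al i - rh i).
have h2 : h * 2 = 1 by exact: hlf2.
have h1 : h + h = 1 by rewrite -h2; ring.
have aE : a = h * (al i + rh i) by rewrite /a (tor_al T).
have eab : a + b = al i by rewrite aE /b -mulrDr -[RHS]mul1r -h2; ring.
have BE : B = 4 * a * b.
  have -> : 4 * a * b = (h * 2) ^+ 2 * B by rewrite aE /b /B /Bq; ring.
  by rewrite h2 expr1n mul1r.
have hhB : h * (h * B) = a * b.
  rewrite BE; transitivity ((h * 2) ^+ 2 * (a * b)); first by ring.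
  by rewrite h2 expr1n mul1r.
have BSE : Bq al rh i.+1 = b ^+ 2.
  rewrite /Bq -/a (tor_rh T) // aE /b.
  have e : al i * rh i = (h * 2) ^+ 2 * (al i * rh i) by rewrite h2 expr1n mul1r.
  by rewrite [in LHS]e; ring.
have b0 : b <> 0 by move=> b0; apply: (tor_B T ltik); rewrite BSE b0 expr0n.
have a0 : a <> 0.
  by move=> a0; apply: (tor_B T (ltnW ltik)); rewrite -/B BE a0 mulr0 mul0r.
have wf : wt X (2 * 2) f.
  apply: (@cwt_mul _ X 2 2); first exact: tor_wtx T.
  apply: wtD; first exact: tor_wtx T.
  by apply: wtB; [exact: (wtX 2 wa) | exact: (wtX 2 wr)].
pose Y := quad_step two_neq0 wf (tor_ns T).
pose qin : {rmorphism cR X -> cR Y} := curve_in wf (tor_ns T).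
pose y : cR Y := curve_y wf (tor_ns T).
have y2 : y ^+ 2 = qin f by exact: curve_y2.
have qin0 c : qin c = 0 -> c = 0 by exact: curve_in_inj.
pose x' : cR Y := qin (a * b + h * x) + qin h * y.
pose vv' n := if (n <= j)%N then qin (vv n) else y.
pose xx' n := if (n <= i)%N then qin (xx n) else x'.
have vvE n : (n <= j)%N -> vv' n = qin (vv n) by rewrite /vv' => ->.
have xxE n : (n <= i)%N -> xx' n = qin (xx n) by rewrite /xx' => ->.
have vvS : vv' i = y by rewrite /vv' ltnn.
have xxS : xx' i.+1 = x' by rewrite /xx' ltnn.
have BqE n : Bq (qin \o al) (qin \o rh) n = qin (Bq al rh n).
  by rewrite /Bq rmorphB !rmorphXn.
have eY : (x' + qin a ^+ 2) * (x' + qin b ^+ 2) = x' * (qin x + qin (al i) ^+ 2).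
  have -> : x' = qin a * qin b + qin h * qin x + qin h * y.
    by rewrite /x' rmorphD !rmorphM.
  rewrite -eab rmorphD; apply: halving_eq.
    exact: (hlf2 Y).
  by rewrite y2 /f BE rmorphM rmorphD !rmorphM rmorph_nat.
have norm_lin c d : curve_norm (qin c + qin d * y) = c ^+ 2 - f * d ^+ 2.
  by rewrite /curve_norm /quad_norm /=; ring.
have nx' : curve_norm x' = (a * b) ^+ 2.
  by rewrite norm_lin /f BE; apply: halving_norm.
have nx'b : curve_norm (x' + qin (b ^+ 2)) = b ^+ 2 * (x + al i ^+ 2).
  have -> : x' + qin (b ^+ 2) = qin (a * b + h * x + b ^+ 2) + qin h * y.
    by rewrite /x' (rmorphD qin (a * b + h * x)) addrAC.
  by rewrite norm_lin /f BE -eab; apply: halving_normD.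
have x'0 : x' <> 0.
  move=> e; have := congr1 (@curve_norm _ _ _ wf (tor_ns T)) e; rewrite nx'.
  rewrite /curve_norm /quad_norm /= expr0n mulr0 subr0.
  by apply: curve_sq_neq0; exact: curve_mul_neq0.
have [e [z [e0 z0 ez]]] := tor_y T.
exists Y, (qin \o al), (qin \o rh), xx', vv'; split.
- by rewrite addnS; apply: (tower_ok_step pcharK) (tor_ok T).
- by rewrite /= (tor_al0 T) rmorph1.
- by move=> n ltnk; rewrite /= (tor_al T) // rmorphM rmorphD.
- by move=> n ltnk; rewrite /= -rmorphXn (tor_rh T) // rmorphM.
- by move=> n lenk; have [] := tor_wt T lenk; split; exact: curve_wt_in.
- by move=> u n lenk; rewrite curve_in_ev (tor_ev T).
- by move=> n lenk; rewrite BqE => /qin0; exact: tor_B T n lenk.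
- by rewrite xxE // BqE (tor_x1 T) rmorphM rmorphXn.
- move=> n /andP [n0]; rewrite leq_eqVlt => /predU1P [->|lenj]; rewrite BqE.
    by rewrite vvS xxE // y2 rmorphM rmorphD.
  rewrite vvE // xxE; last exact: leq_trans lenj (leqnSn _).
  by rewrite -rmorphXn (tor_vv T) ?n0 // rmorphM rmorphD.
- move=> n /andP [n0]; rewrite leq_eqVlt => /predU1P [->|lenj]; rewrite BqE.
    rewrite vvS xxS xxE // -[hlf Y]/(qin h) /x' -hhB -/B -/x.
    by rewrite rmorphD !rmorphM; ring.
  rewrite vvE // !xxE //; last exact: leq_trans lenj (leqnSn _).
  by rewrite (tor_xx T) ?n0 // !(rmorphM, rmorphD).
- move=> u n /andP [n0]; rewrite leq_eqVlt => /predU1P [->|lenj].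
    by rewrite vvS; exact: curve_y_ev.
  by rewrite vvE // curve_in_ev (tor_evv T) // n0.
- rewrite xxS; apply: wtD.
    apply: curve_wt_in; rewrite -hhB; apply: wtD; apply: wtZ; last exact: tor_wtx T.
    by apply/wtZ/wtB; [exact: (wtX 2 wa) | exact: (wtX 2 wr)].
  by apply: wtZ; exact: curve_wt_y.
(* The norm of the new radicand is [(a b)^2 b^2 (x + al_i^2)], which by [tor_y] is [f] modulo
   squares. A relation between squares above would thus make [f] a square below. *)
- rewrite xxS BqE BSE => c c0 U V eUV; apply: (@curve_norm_eq0 _ _ _ wf (tor_ns T)).
  have nrm := congr1 (@curve_norm _ _ _ wf (tor_ns T)) eUV.
  rewrite !expr2 !curve_normM curve_in_S curve_norm_in nx' nx'b in nrm.
  pose g := a * b * b; pose NV := curve_norm V.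
  have key : (e * f * curve_norm U) ^+ 2 =
      cS X 1%:P * f * (cS X c%:P * g * z * NV) ^+ 2.
    rewrite rmorph1 mul1r; transitivity ((e * f) ^+ 2 * (curve_norm U * curve_norm U)).
      by ring.
    rewrite nrm; transitivity (f * (cS X c%:P * g * NV) ^+ 2 * z ^+ 2); last by ring.
    by rewrite -ez -/x -/B -/NV /f /g; ring.
  have := tor_ns T (oner_neq0 K) key.
  case/curve_dom => // /curve_dom [] // /curve_dom [/(cS_neq0 c0) []|].
  have g0 : g <> 0 by apply: curve_mul_neq0 => //; exact: curve_mul_neq0.
  by move/g0.
(* By [halving_eq] the new cubic is [x'^2 (x + al_i^2)]; multiplied by [e^2 y^2 = e^2 f], it becomes
   [x'^2 z^2]. *)
exists (qin e * y), (x' * qin z); split.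
- apply: (@curve_mul_neq0 Y); first by move/qin0.
  move=> y0; have /eqP := congr1 (@curve_norm _ _ _ wf (tor_ns T)) y0.
  rewrite curve_norm_y /curve_norm /quad_norm /= expr0n mulr0 subr0 oppr_eq0 => /eqP.
  exact: nonsquare_neq0 (tor_ns T).
- by apply: (@curve_mul_neq0 Y) => // /qin0.
rewrite xxS BqE BSE -[(qin \o al) i.+1]/(qin a).
transitivity (qin e ^+ 2 * y ^+ 2 * x' * ((x' + qin a ^+ 2) * (x' + qin b ^+ 2))).
  by rewrite rmorphXn; ring.
rewrite eY y2 [in RHS]exprMn -(rmorphXn qin 2 z) -ez -/x -/B /f.
by rewrite !(rmorphM, rmorphD, rmorphXn); ring.
Qed.

Lemma tor_tower_ex k j : (1 <= k)%N -> (k + j <= M)%N -> (j < k)%N ->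
  exists (X : curve K) (al rh xx vv : nat -> cR X), tor_tower k j al rh xx vv.
Proof.
move=> k1; elim: j => [|j IHj] leM ltjk; first by apply: tor_tower0; lia.
have [||X [al [rh [xx [vv T]]]]] := IHj; [by lia | by lia |].
by apply: tor_towerS T; lia.
Qed.

End Tower.

(** The values of the tower at a rational point. That [rh] and [vv] do not vanish comes from the
    points with [y = 0] having been discarded. *)
Record iso_chain (K : fieldType) k (al rh xx vv : nat -> K) : Prop := IsoChain {
  chain_al0 : al 0%N = 1;
  chain_al : forall i, (i < k)%N -> al i.+1 = 2^-1 * (al i + rh i);
  chain_rh : forall i, (i < k)%N -> rh i.+1 ^+ 2 = al i * rh i;
  chain_rh0 : forall i, (0 < i <= k)%N -> rh i != 0;
  chain_x1 : xx 1%N = 2^-1 ^+ 2 * Bq al rh 0;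
  chain_vv : forall i, (0 < i < k)%N -> vv i ^+ 2 = xx i * (xx i + Bq al rh i);
  chain_xx : forall i, (0 < i < k)%N ->
    xx i.+1 = 2^-1 * (2^-1 * Bq al rh i + xx i + vv i);
  chain_vv0 : forall i, (0 < i < k)%N -> vv i != 0
}.

Lemma iso_chain_ex (K : finFieldType) (p q s k : nat) :
    p \in [pchar K] -> #|K| = q -> p.-nat q -> (2 : K) != 0 ->
    (10 <= s)%N -> (s ^ 2 <= q)%N -> (q <= s * (s + 2))%N -> (2 <= k)%N ->
    (4 ^ k * (2 * k) * (17 * (2 * k) * (s + 2)) < q)%N ->
  exists al rh xx vv : nat -> K, iso_chain k al rh xx vv.
Proof.
move=> pcharK cardK p_q two0 s10 s_le q_le k2 big.
(* The tower takes [k] steps for the means and [k - 1] for the halvings. *)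
pose M := (2 * k)%N; have e4 : (2 ^ M = 4 ^ k)%N by rewrite /M expnM.
have M_q : (4 * 2 ^ M * (2 * M) <= q)%N.
  rewrite e4; apply: leq_trans (ltnW big); rewrite -/M.
  have h1 : (0 < 4 ^ k * M)%N by rewrite muln_gt0 expn_gt0 /M; lia.
  have h2 : (8 <= 17 * M * (s + 2))%N by rewrite /M; nia.
  apply: leq_trans (leq_mul (leqnn (4 ^ k * M)) h2); lia.
have [|||X [al [rh [xx [vv T]]]]] :=
  tor_tower_ex pcharK cardK p_q two0 s10 s_le q_le M_q (k := k) (j := k.-1).
- by lia.
- by rewrite /M; lia.
- by lia.
have [_ _ cardX] := tor_ok T.
have : (0 < #|cpt X|)%N.
  rewrite lt0n; apply: contraTneq cardX => ->; rewrite add0n -ltnNge.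
  apply: leq_ltn_trans big; rewrite -/M -e4; apply: leq_mul => //.
  by apply: leq_mul; rewrite ?leq_exp2l //; rewrite /M; lia.
case/card_gt0P => z _; pose ev := cev z.
have evh : ev (cS X (2^-1)%:P) = 2^-1 by exact: cev_const.
have evB i : Bq (ev \o al) (ev \o rh) i = ev (Bq al rh i) by rewrite /Bq rmorphB !rmorphXn.
have bnd i : (0 < i < k)%N -> (0 < i <= k.-1)%N by lia.
exists (ev \o al), (ev \o rh), (ev \o xx), (ev \o vv); split.
- by rewrite /= (tor_al0 T) rmorph1.
- by move=> i ltik; rewrite /= (tor_al T) // rmorphM rmorphD evh.
- by move=> i ltik; rewrite /= -rmorphXn (tor_rh T) // rmorphM.
- by move=> i leik; exact: tor_ev T z i leik.
- by rewrite /= (tor_x1 T) rmorphM rmorphXn evh evB.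
- by move=> i /bnd b; rewrite /= -rmorphXn (tor_vv T) // rmorphM rmorphD evB.
- by move=> i /bnd b; rewrite evB /= (tor_xx T) // !(rmorphM, rmorphD) evh.
- by move=> i /bnd b; exact: tor_evv T z i b.
Qed.

(** * Chains of 2-isogenies *)

Section EllAlgebra.
Variable K : fieldType.
Hypothesis two0 : (2 : K) != 0.
Implicit Types (V W : K * K) (S P c : K).

Definition onE S P V := V.2 ^+ 2 = V.1 ^+ 3 + S * V.1 ^+ 2 + P * V.1.
Definition addE S V W : K * K :=
  let l := (V.2 - W.2) / (V.1 - W.1) in
  let x := l ^+ 2 - S - V.1 - W.1 in (x, - (V.2 + l * (x - V.1))).
Definition dblE S P V : K * K :=
  let l := (3 * V.1 ^+ 2 + 2 * S * V.1 + P) / (2 * V.2) in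
  let x := l ^+ 2 - S - 2 * V.1 in (x, - (V.2 + l * (x - V.1))).
Definition isoE P c V : K * K :=
  (V.1 + P / V.1 - 2 * c, V.2 * (V.1 ^+ 2 - P) / V.1 ^+ 2).

(** Solving for the coefficients of the curve turns the identities of the group law into identities
    between independent variables, which [field] decides. *)
Lemma two_pointsE S P x y x' y' : x != 0 -> x' != 0 -> x != x' ->
    onE S P (x, y) -> onE S P (x', y') ->
  S = (y ^+ 2 / x - y' ^+ 2 / x' - x ^+ 2 + x' ^+ 2) / (x - x') /\
  P = (x * (y' ^+ 2 / x' - x' ^+ 2) - x' * (y ^+ 2 / x - x ^+ 2)) / (x - x').
Proof.
rewrite /onE /= => x0 x'0; rewrite -subr_eq0 => d0 -> ->.
by split; field; rewrite ?x0 ?x'0 ?d0.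
Qed.

Lemma one_pointE S P x y : x != 0 -> onE S P (x, y) ->
  S = (y ^+ 2 - x ^+ 3 - P * x) / x ^+ 2.
Proof. by rewrite /onE /= => x0 ->; field. Qed.

(** The cubic minus the square of the chord has the abscissas of three collinear points as roots.
    [T] is left free: the abscissa of the sum proves that it lies on the curve, and [- a] gives the
    descent map. *)
Lemma addE_poly S P V W T : V.1 != 0 -> V.1 != W.1 -> onE S P V -> onE S P W ->
  let l := (V.2 - W.2) / (V.1 - W.1) in
  T ^+ 3 + S * T ^+ 2 + P * T - (l * (T - V.1) + V.2) ^+ 2 =
  (T - V.1) * (T - W.1) * (T - (addE S V W).1).
Proof.
case: V W => x y [x' y'] /= x0 ne oV oW.
have [x'0|x'0] := eqVneq x' 0.
  have y'0 : y' = 0 by apply/eqP; rewrite -sqrf_eq0 [y' ^+ 2]oW x'0 /= ?expr0n /= ?mulr0 !addr0.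
  by rewrite (one_pointE x0 oV) x'0 y'0 !subr0; field.
have [eS eP] := two_pointsE x0 x'0 ne oV oW.
have d0 : x - x' != 0 by rewrite subr_eq0.
by rewrite eS eP; field; rewrite x0 x'0 d0.
Qed.

Lemma onE_add S P V W : V.1 != 0 -> V.1 != W.1 -> onE S P V -> onE S P W ->
  onE S P (addE S V W).
Proof.
move=> x0 ne oV oW; have := addE_poly (addE S V W).1 x0 ne oV oW.
rewrite subrr mulr0 => /eqP; rewrite subr_eq0 => /eqP e.
by rewrite /onE e /addE /= sqrrN addrC.
Qed.

(** The descent map [x + a] modulo squares is a homomorphism: at the root [- a] of the cubic only
    the square of the chord remains. *)
Lemma kappa_add S P a b V W : S = a + b -> P = a * b ->
    V.1 != 0 -> V.1 != W.1 -> onE S P V -> onE S P W ->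
  exists r, (V.1 + a) * (W.1 + a) * ((addE S V W).1 + a) = r ^+ 2.
Proof.
move=> eS eP x0 ne oV oW; have := addE_poly (- a) x0 ne oV oW.
set l := _ / _ => /= e; exists (l * (- a - V.1) + V.2).
have -> : (l * (- a - V.1) + V.2) ^+ 2 = - ((- a) ^+ 3 + S * (- a) ^+ 2 + P * - a -
    (l * (- a - V.1) + V.2) ^+ 2) by rewrite eS eP; ring.
by rewrite e; ring.
Qed.

(** With the slope [u = y / x], a point satisfies [x + P / x = u^2 - S]. So [S] and [P] are rational
    functions of [x], [x'], [u], [u'], between which no relation is left. *)
Lemma isoE_add_slopes (x x' u u' : K)
    (S := u ^+ 2 - x + x' * (u' ^+ 2 - u ^+ 2 + x - x') / (x' - x))
    (P := x * x' * (u' ^+ 2 - u ^+ 2 + x - x') / (x - x'))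
    (l := (x * u - x' * u') / (x - x'))
    (l' := (u * (x - P / x) - u' * (x' - P / x')) / (u ^+ 2 - u' ^+ 2))
    (x3 := x * x' * (u - u') ^+ 2 / (x - x') ^+ 2)
    (u3 := (x - x') / (u - u') - l) :
  x != 0 -> x' != 0 -> x - x' != 0 -> u - u' != 0 -> u + u' != 0 ->
  [/\ l ^+ 2 - S - x - x' = x3, - (x * u + l * (x3 - x)) = x3 * u3, 
      u3 ^+ 2 = l' ^+ 2 + 2 * S - u ^+ 2 - u' ^+ 2
    & - (u * (x - P / x) + l' * (u3 ^+ 2 - u ^+ 2)) = u3 * (x3 - P / x3)].
Proof.
move=> x0 x'0 d0 n0 s0.
have d0' : x' - x != 0 by rewrite -opprB oppr_eq0.
have e0 : u ^+ 2 - u' ^+ 2 != 0 by rewrite subr_sqr mulf_neq0.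
rewrite /u3 /x3 /l' /l /S /P; split; field; rewrite ?x0 ?x'0 ?d0 ?d0' ?n0 ?e0 //.
Qed.

Lemma isoE_add S P c V W (V' := isoE P c V) (W' := isoE P c W) :
    V.1 != 0 -> W.1 != 0 -> V'.1 != W'.1 -> onE S P V -> onE S P W ->
  isoE P c (addE S V W) = addE (S + 6 * c) V' W' /\ (addE S V W).1 != 0.
Proof.
rewrite {}/V' {}/W'; case: V W => x y [x' y']; rewrite /= => x0 x'0 neX oV oW.
have [u yE] : exists u, y = x * u by exists (y / x); rewrite mulrCA mulfV ?mulr1.
have [u' y'E] : exists u', y' = x' * u' by exists (y' / x'); rewrite mulrCA mulfV ?mulr1.
move: oV oW neX; rewrite {}yE {}y'E => oV oW.
have uE : u ^+ 2 = x + S + P / x.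
  by apply: (mulIf (expf_neq0 2 x0)); move: oV; rewrite /onE /= exprMn mulrC => ->; field.
have u'E : u' ^+ 2 = x' + S + P / x'.
  by apply: (mulIf (expf_neq0 2 x'0)); move: oW; rewrite /onE /= exprMn mulrC => ->; field.
rewrite /isoE /= => neX.
have eX : x + P / x = u ^+ 2 - S by rewrite uE; ring.
have eX' : x' + P / x' = u' ^+ 2 - S by rewrite u'E; ring.
have neu : u ^+ 2 - u' ^+ 2 != 0.
  by apply: contra_neq neX => /subr0_eq; rewrite eX eX' => ->.
have d0 : x - x' != 0 by apply: contra_neq neu => /eqP; rewrite subr_eq0 uE u'E => /eqP ->; rewrite subrr.
have d0' : x' - x != 0 by rewrite -opprB oppr_eq0.
move: (neu); rewrite subr_sqr mulf_eq0 negb_or => /andP [n0 s0].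
have SE : u ^+ 2 - x + x' * (u' ^+ 2 - u ^+ 2 + x - x') / (x' - x) = S.
  by rewrite uE u'E; field; rewrite x0 x'0 d0'.
have PE : x * x' * (u' ^+ 2 - u ^+ 2 + x - x') / (x - x') = P.
  by rewrite uE u'E; field; rewrite x0 x'0 d0.
have := isoE_add_slopes x0 x'0 d0 n0 s0; rewrite SE PE.
set l := (x * u - x' * u') / (x - x'); set x3 := x * x' * _ / _.
set u3 := _ - l; set l' := _ / (u ^+ 2 - u' ^+ 2) => -[e1 e2 e3 e4].
have x30 : x3 != 0 by rewrite !mulf_neq0 ?invr_eq0 ?expf_neq0.
have XE z w : z != 0 -> z * w * (z ^+ 2 - P) / z ^+ 2 = w * (z - P / z).
  by move=> z0; field.
have onX3 : x3 + P / x3 = u3 ^+ 2 - S.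
  have [] : onE S P (addE S (x, x * u) (x', x' * u')) by apply: onE_add => //=; rewrite -subr_eq0.
  rewrite /onE /addE /= -/l e1 e2 exprMn => e; apply: (mulIf (expf_neq0 2 x30)).
  by rewrite mulrBl [u3 ^+ 2 * _]mulrC e; field.
rewrite /addE /= -/l e1 e2 x30; split => //.
rewrite !XE // eX eX' -/l' onX3.
have -> : u ^+ 2 - S - 2 * c - (u' ^+ 2 - S - 2 * c) = u ^+ 2 - u' ^+ 2 by ring.
rewrite -/l'; have e5 : l' ^+ 2 - (S + 6 * c) - (u ^+ 2 - S - 2 * c) - (u' ^+ 2 - S - 2 * c) = u3 ^+ 2 - S - 2 * c.
  by rewrite e3; ring.
rewrite e5 -e4; congr pair; congr (- (_ + _ * _)); ring.
Qed.

Lemma dblE_x S P V : V.2 != 0 -> onE S P V ->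
  (dblE S P V).1 = ((V.1 ^+ 2 - P) / (2 * V.2)) ^+ 2.
Proof.
case: V => x y /= y0 oV.
have x0 : x != 0.
  by apply: contraNneq y0 => x0; rewrite -sqrf_eq0 [y ^+ 2]oV x0 /= !expr0n /= !mulr0 !addr0.
by rewrite (one_pointE x0 oV); field; rewrite two0 x0 y0.
Qed.

Lemma onE_dbl S P V : V.2 != 0 -> onE S P V -> onE S P (dblE S P V).
Proof.
case: V => x y /= y0 oV.
have x0 : x != 0.
  by apply: contraNneq y0 => x0; rewrite -sqrf_eq0 [y ^+ 2]oV x0 /= !expr0n /= !mulr0 !addr0.
rewrite /onE /dblE /= (one_pointE x0 oV); field; rewrite two0 x0 y0 //.
Qed.

Lemma kappa_dbl S P a b V : S = a + b -> P = a * b -> V.2 != 0 -> onE S P V ->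
  exists r, (dblE S P V).1 + a = r ^+ 2.
Proof.
case: V => x y eS eP /= y0 oV; exists ((x ^+ 2 + 2 * a * x + P) / (2 * y)).
have := @dblE_x S P (x, y) y0 oV; rewrite /= => ->; have yE : y ^+ 2 = x * (x + a) * (x + b).
  by rewrite [y ^+ 2]oV /= eS eP; ring.
have : y ^+ 2 != 0 by rewrite expf_neq0.
rewrite !expr_div_n !exprMn yE eP !mulf_eq0 !negb_or => /andP [/andP [x0 xa0] xb0].
have four0 : (4 : K) != 0 by rewrite (_ : 4 = 2 * 2) ?mulf_neq0 // -natrM.
by field; rewrite four0 x0 xa0 xb0.
Qed.

Lemma isoE_dbl S c V (V' := isoE (c ^+ 2) c V) :
    V.2 != 0 -> V'.2 != 0 -> onE S (c ^+ 2) V ->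
  isoE (c ^+ 2) c (dblE S (c ^+ 2) V) = dblE (S + 6 * c) ((S + 2 * c) * (4 * c)) V' /\
  (dblE S (c ^+ 2) V).1 != 0.
Proof.
rewrite {}/V'; case: V => x y; rewrite /= => y0 ne oV.
have x0 : x != 0.
  by apply: contraNneq y0 => x0; rewrite -sqrf_eq0 [y ^+ 2]oV x0 /= !expr0n /= !mulr0 !addr0.
have n0 : x ^+ 2 - c ^+ 2 != 0.
  by apply: contraNneq ne => ->; rewrite mulr0 mul0r.
have xE := @dblE_x S (c ^+ 2) (x, y) y0 oV.
have x30 : (dblE S (c ^+ 2) (x, y)).1 != 0.
  by rewrite xE expf_neq0 // mulf_neq0 ?invr_eq0 ?mulf_neq0.
split=> //; move: xE x30.
rewrite /dblE /isoE /= => xE _; rewrite xE.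
have -> : S = (y ^+ 2 - x ^+ 3 - c ^+ 2 * x) / x ^+ 2 by apply: (@one_pointE _ (c ^+ 2)).
congr pair; field; rewrite ?two0 ?x0 ?y0 ?n0 //.
Qed.

Lemma onE_iso S c V : V.1 != 0 -> onE S (c ^+ 2) V ->
  onE (S + 6 * c) ((S + 2 * c) * (4 * c)) (isoE (c ^+ 2) c V).
Proof.
case: V => x y /= x0 oV; rewrite (one_pointE x0 oV) /onE /isoE /=.
by field.
Qed.

End EllAlgebra.

Fixpoint tree_node (K : fieldType) (c : nat -> K) (X0 : K) l X : Prop :=
  if l is l'.+1 then X != 0 /\ tree_node c X0 l' ((X - c l') ^+ 2 / X) else X = X0.

(** * Lifting points along the chain *)

Section IsoChain.
Variables (K : fieldType) (k : nat) (al rh xx vv : nat -> K).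
Hypothesis two0 : (2 : K) != 0.
Hypothesis ch : iso_chain k al rh xx vv.
Hypothesis k2 : (2 <= k)%N.
Implicit Types V W : K * K.

Let B := Bq al rh.
Definition chain_c i := B i / 4.
Local Notation c := chain_c.
(** The [i]-th curve is [y^2 = x (x + al_i^2) (x + B_i)]. *)
Definition chain_S i := al i ^+ 2 + B i.
Definition chain_P i := al i ^+ 2 * B i.
Definition on_chain i V := onE (chain_S i) (chain_P i) V.
Definition phi i V := isoE (c i ^+ 2) (c i) V.
Local Notation dbl i := (dblE (chain_S i) (chain_P i)).
Local Notation add i := (addE (chain_S i)).

Let four0 : (4 : K) != 0.
Proof. by rewrite (_ : 4 = 2 * 2) ?mulf_neq0 // -natrM. Qed.

Lemma chain_half i : (i < k)%N -> exists b, al i = al i.+1 + b /\ rh i = al i.+1 - b /\ B i.+1 = b ^+ 2.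
Proof.
move=> ik; exists (2^-1 * (al i - rh i)).
have e : B i.+1 = (2^-1 * (al i - rh i)) ^+ 2.
  by rewrite /B /Bq (chain_rh ch ik) (chain_al ch ik); field.
by rewrite (chain_al ch ik) e; split; [|split] => //; field.
Qed.

Lemma chain_al_neq0 i : (i < k)%N -> al i != 0.
Proof.
move=> ik; have : rh i.+1 ^+ 2 != 0 by rewrite expf_neq0 // (chain_rh0 ch).
by rewrite (chain_rh ch ik) mulf_eq0 negb_or => /andP [].
Qed.

(** [chain_P i.+1 = c i ^+ 2] makes [phi i] the isogeny with kernel generated by [(0, 0)] on the
    curve [i + 1]; the other relations place its image on the curve [i]. *)
Lemma chain_rels i : (i < k)%N ->
  [/\ chain_S i = chain_S i.+1 + 6 * c i, chain_P i.+1 = c i ^+ 2,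
      al i ^+ 2 = chain_S i.+1 + 2 * c i & B i = 4 * c i].
Proof.
move=> ik; have [b [ea [er eB]]] := chain_half ik.
rewrite /chain_S /chain_P /chain_c eB /B /Bq ea er; split; field; exact: four0.
Qed.

Lemma chain_B_neq0 i : (i <= k)%N -> B i != 0.
Proof.
elim: i => [_|i IH ik].
  have : vv 1%N ^+ 2 != 0 by rewrite expf_neq0 // (chain_vv0 ch).
  rewrite (chain_vv ch) // mulf_eq0 negb_or => /andP [+ _].
  by rewrite (chain_x1 ch) mulf_eq0 negb_or => /andP [].
have := IH (ltnW ik); have [b [ea [er ->]]] := chain_half ik.
rewrite /B /Bq ea er => h; apply: contraNneq h => /eqP; rewrite sqrf_eq0 => /eqP ->.
by rewrite addr0 subr0 subrr.
Qed.

Lemma chain_c_neq0 i : (i <= k)%N -> c i != 0.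
Proof. by move=> ik; rewrite mulf_neq0 ?invr_eq0 ?chain_B_neq0. Qed.

Lemma on_chainE i V : (i < k)%N ->
  on_chain i V <-> V.2 ^+ 2 = V.1 * (V.1 + al i ^+ 2) * (V.1 + 4 * c i).
Proof.
move=> ik; have [_ _ _ <-] := chain_rels ik.
rewrite /on_chain /onE /chain_S /chain_P.
have -> // : V.1 ^+ 3 + (al i ^+ 2 + B i) * V.1 ^+ 2 + al i ^+ 2 * B i * V.1 =
  V.1 * (V.1 + al i ^+ 2) * (V.1 + B i) by ring.
Qed.

Lemma on_chain_x0 i V : V.2 != 0 -> on_chain i V -> V.1 != 0.
Proof.
move=> y0 oV; apply: contraNneq y0 => x0.
by rewrite -sqrf_eq0 [_ ^+ 2]oV x0 !expr0n /= !mulr0 !addr0.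
Qed.

Lemma on_phi i V : (i < k)%N -> V.1 != 0 -> on_chain i.+1 V -> on_chain i (phi i V).
Proof.
move=> ik x0; have [eS eP ea eB] := chain_rels ik.
rewrite /on_chain eP => /(onE_iso x0); rewrite -eS -ea -eB.
by [].
Qed.

Lemma phi_y i V : (phi i V).2 != 0 -> V.1 != 0 /\ V.2 != 0.
Proof.
rewrite /phi /isoE /= !mulf_eq0 !negb_or => /andP [/andP [y0 _]].
by rewrite invr_eq0 sqrf_eq0.
Qed.

Lemma phi_dbl i V : (i < k)%N -> V.2 != 0 -> (phi i V).2 != 0 -> on_chain i.+1 V ->
  phi i (dbl i.+1 V) = dbl i (phi i V) /\ (dbl i.+1 V).1 != 0.
Proof.
move=> ik y0 py0; have [eS eP ea eB] := chain_rels ik.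
rewrite /on_chain eP => oV; have := isoE_dbl two0 y0 py0 oV.
by rewrite /chain_P -ea -eB -eS.
Qed.

Lemma phi_add i V W : (i < k)%N -> V.1 != 0 -> W.1 != 0 ->
    (phi i V).1 != (phi i W).1 -> on_chain i.+1 V -> on_chain i.+1 W ->
  phi i (add i.+1 V W) = add i (phi i V) (phi i W) /\ (add i.+1 V W).1 != 0.
Proof.
move=> ik x0 x0' ne; have [eS eP _ _] := chain_rels ik.
rewrite /on_chain eP => oV oW; have := isoE_add x0 x0' ne oV oW.
by rewrite -eS.
Qed.

Lemma phi_fib i V : V.1 != 0 -> (V.1 - c i) ^+ 2 = (phi i V).1 * V.1.
Proof. by move=> x0; rewrite /phi /isoE /=; field. Qed.

(** Such a point has abscissa [c i], and the abscissa of its double contains the factor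
    [V.1^2 - c_i^2]. *)
Lemma phi_ker i V : (i < k)%N -> on_chain i.+1 V -> V.1 != 0 -> phi i V = (0, 0) ->
  V.2 != 0 /\ dbl i.+1 V = (0, 0).
Proof.
move=> ik oV x0 e; have xc : V.1 = c i.
  by apply/eqP; rewrite -subr_eq0 -sqrf_eq0 phi_fib // e mul0r.
have [eS eP ea eB] := chain_rels ik.
have y0 : V.2 != 0.
  rewrite -sqrf_eq0 [_ ^+ 2]oV eP xc.
  have -> : c i ^+ 3 + chain_S i.+1 * c i ^+ 2 + c i ^+ 2 * c i = c i ^+ 2 * al i ^+ 2.
    by rewrite ea; ring.
  by rewrite mulf_neq0 ?expf_neq0 ?chain_al_neq0 // chain_c_neq0 // ltnW.
split=> //; have e1 : (dbl i.+1 V).1 = 0.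
  by rewrite (dblE_x two0 y0 oV) eP xc subrr mul0r expr0n.
have := onE_dbl two0 y0 oV; case: (dbl _ _) e1 => x y /= ->.
by rewrite /onE /= !expr0n /= !mulr0 !addr0 => /eqP; rewrite sqrf_eq0 => /eqP ->.
Qed.

(** The abscissa is a root of [x^2 - (2 c + W.1) x + c^2], of discriminant [W.1 (W.1 + 4 c)]. On the
    curve the product of this discriminant by [W.1 + al^2] is a square, so the obstruction to
    lifting can be read on [W.1 + al^2]. *)
Lemma chain_lift i W v (x := 2^-1 * (2 * c i + W.1 + v)) : (i < k)%N -> on_chain i W ->
    v != 0 -> v ^+ 2 = W.1 * (W.1 + 4 * c i) ->
  [/\ x != 0, on_chain i.+1 (x, W.2 / v * x), phi i (x, W.2 / v * x) = W,
      (x - c i) ^+ 2 = W.1 * x & x ^+ 2 != c i ^+ 2].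
Proof.
move=> ik oW v0 ev; have [eS eP ea eB] := chain_rels ik.
have c0 := chain_c_neq0 (ltnW ik).
have ex : (x - c i) ^+ 2 = W.1 * x.
  apply/eqP; rewrite -subr_eq0; apply/eqP.
  have -> : (x - c i) ^+ 2 - W.1 * x = 2^-1 ^+ 2 * (v ^+ 2 - W.1 * (W.1 + 4 * c i)).
    by rewrite /x; field.
  by rewrite ev subrr mulr0.
have x0 : x != 0.
  by apply: contraNneq c0 => x0; move/eqP: ex; rewrite x0 sub0r mulr0 sqrrN sqrf_eq0.
have xv : x ^+ 2 - c i ^+ 2 = x * v.
  have -> : x * v = x * (2 * x - 2 * c i - W.1) by congr (_ * _); rewrite /x; field.
  have -> : x * (2 * x - 2 * c i - W.1) = 2 * x ^+ 2 - 2 * c i * x - W.1 * x by ring.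
  by rewrite -ex; ring.
split=> //.
- rewrite /on_chain /onE eP /= exprMn expr_div_n.
  have -> : W.2 ^+ 2 / v ^+ 2 = W.1 + al i ^+ 2.
    by move/(on_chainE _ ik): oW => ->; rewrite [X in X / _]mulrAC -ev mulrAC mulfV ?expf_neq0 // mul1r.
  have -> : (W.1 + al i ^+ 2) * x ^+ 2 = x * (W.1 * x + al i ^+ 2 * x) by ring.
  by rewrite -ex ea; ring.
- clearbody x; rewrite /phi /isoE /= xv [RHS]surjective_pairing; congr pair.
    have -> : x + c i ^+ 2 / x - 2 * c i = (x - c i) ^+ 2 / x by field.
    by rewrite ex mulfK.
  by field; rewrite v0 x0.
by rewrite -subr_eq0 xv mulf_neq0.
Qed.

(** Each point lifts the previous one through [phi]. The first lift of [(0, 0)] is a case apart, for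
    there [vv] would vanish: its abscissa is [c_0], and its ordinate [c_0 al_0] equals [c_0]. *)
Fixpoint chain_pt i : K * K :=
  if i is i'.+1 then
    if i' is 0 then (xx 1, xx 1%N)
    else (xx i'.+1, (chain_pt i').2 / vv i' * xx i'.+1)
  else (0, 0).

Lemma chain_pt1 i : (chain_pt i.+1).1 = xx i.+1.
Proof. by case: i. Qed.

Lemma chain_ptP i : (i < k)%N ->
  on_chain i (chain_pt i) /\
  (forall i', i = i'.+1 -> (chain_pt i).1 != 0 /\ phi i' (chain_pt i) = chain_pt i').
Proof.
elim: i => [_|[|i] IH ik].
- by split=> //; rewrite /on_chain /onE /= !expr0n /= !mulr0 !addr0.
- have x1 : xx 1%N = c 0 by rewrite (chain_x1 ch) /chain_c /B; field; rewrite four0 two0.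
  have k0 : (0 < k)%N by exact: ltnW.
  have [eS eP ea _] := chain_rels k0; have c0 := chain_c_neq0 (ltnW k0).
  rewrite /= x1; split; last first.
    move=> _ [<-]; rewrite /= c0; split=> //; rewrite /phi /isoE /= subrr mulr0 mul0r.
    by congr pair; field.
  rewrite /on_chain /onE eP /=.
  have -> : c 0 ^+ 3 + chain_S 1 * c 0 ^+ 2 + c 0 ^+ 2 * c 0 = c 0 ^+ 2 * al 0 ^+ 2.
    by rewrite ea; ring.
  by rewrite (chain_al0 ch) expr1n mulr1.
have ik' := ltnW ik; have [oV _] := IH ik'.
have iik : (0 < i.+1 < k)%N by [].
have [_ _ _ eB] := chain_rels ik'.
have ev : vv i.+1 ^+ 2 = (chain_pt i.+1).1 * ((chain_pt i.+1).1 + 4 * c i.+1).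
  by rewrite chain_pt1 (chain_vv ch iik) -eB.
have := chain_lift ik' oV (chain_vv0 ch iik) ev.
have -> : 2^-1 * (2 * c i.+1 + (chain_pt i.+1).1 + vv i.+1) = xx i.+2.
  rewrite (chain_xx ch iik) chain_pt1 -[Bq _ _ _]/(B i.+1) eB; field; exact: two0.
by case=> x0 oV' pV' _ _; split=> // i' [<-].
Qed.

Local Notation D i j := (iter j (dbl i) (chain_pt i)).

(** The multiples [2^j] of a point of order [2^(i+1)], down to the point [(0, 0)] of order two. A
    multiple has a nonzero ordinate because its image does or, at the last step, because it lies
    above [(0, 0)]. *)
Lemma chain_ptD i : (i < k)%N ->
  [/\ D i i = (0, 0),
      forall j, (j <= i)%N -> on_chain i (D i j),
      forall j, (j < i)%N -> (D i j).2 != 0 &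
      forall i' j, i = i'.+1 -> (j <= i')%N -> phi i' (D i j) = D i' j].
Proof.
elim: i => [k0|i IH ik].
  split=> // j; rewrite leqn0 => /eqP -> /=; exact: (chain_ptP k0).1.
have ik' := ltnW ik; have [D0 Don Dy Dphi] := IH ik'.
have [oP /(_ _ erefl) [xP pP]] := chain_ptP ik.
have step j : (j <= i)%N -> [/\ (D i.+1 j).1 != 0, on_chain i.+1 (D i.+1 j),
    (D i.+1 j).2 != 0 & phi i (D i.+1 j) = D i j].
  elim: j => [_|j IHj ji].
    split=> //; case: (posnP i) => [i0|i0]; last first.
      by case: (@phi_y i (chain_pt i.+1)) => //; rewrite pP; exact: (Dy 0%N).
    by subst i; case: (phi_ker ik' oP xP).
  have [x0 oV y0 pV] := IHj (ltnW ji).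
  have py0 : (phi i (D i.+1 j)).2 != 0 by rewrite pV Dy.
  have [e x0'] := phi_dbl ik' y0 py0 oV.
  have oV' : on_chain i.+1 (D i.+1 j.+1) by rewrite iterS; apply: onE_dbl.
  have e' : phi i (D i.+1 j.+1) = D i j.+1 by rewrite iterS e pV -iterS.
  split=> //; move: ji; rewrite leq_eqVlt => /orP [/eqP ji|ji].
    by case: (phi_ker ik' oV' x0') => //; rewrite e' ji.
  by case: (@phi_y i (D i.+1 j.+1)) => //; rewrite e' Dy.
have [xi oi yi pi] := step i (leqnn i); rewrite D0 in pi.
have Dn : D i.+1 i.+1 = (0, 0) by rewrite iterS; case: (phi_ker ik' oi xi pi).
split=> //.
- move=> j; rewrite leq_eqVlt => /orP [/eqP ->|]; last by rewrite ltnS => /step [].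
  by rewrite Dn /on_chain /onE /= !expr0n /= !mulr0 !addr0.
- by move=> j /step [].
- by move=> _ j [<-] /step [].
Qed.

Fixpoint phin l i V := if i is i'.+1 then phi l (phin l.+1 i' V) else V.

Lemma phin_on l i V : (l + i <= k)%N -> on_chain (l + i) V -> (phin l i V).2 != 0 ->
  on_chain l (phin l i V).
Proof.
elim: i l => [l|i IH l]; rewrite ?addn0 //= -addSnnS => lk oV y0.
have [x0 y0'] := phi_y y0; apply: on_phi => //; first lia.
exact: IH.
Qed.

Lemma phin_pt l i j : (l + i < k)%N -> (j <= l)%N -> phin l i (D (l + i) j) = D l j.
Proof.
elim: i l => [l|i IH l]; rewrite ?addn0 //= -addSnnS => lk jl.
rewrite IH //; last by rewrite ltnW.
have /chain_ptD [_ _ _ /(_ l j erefl jl)] : (l.+1 < k)%N by lia.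
by [].
Qed.

Lemma phin_x l i V W : V.1 = W.1 -> (phin l i V).1 = (phin l i W).1.
Proof. by elim: i l => //= i IH l /(IH l.+1) e; rewrite /isoE e. Qed.

Lemma phin_y l i V : (phin l i V).2 != 0 -> V.2 != 0.
Proof. by elim: i l => //= i IH l /phi_y [_ /IH]. Qed.

Lemma phin_add l i V W : (l + i <= k)%N -> on_chain (l + i) V -> on_chain (l + i) W ->
    (phin l i V).1 != (phin l i W).1 -> (phin l i V).2 != 0 ->
    ((0 < i)%N -> (phin l.+1 i.-1 W).2 != 0) ->
  phin l i (add (l + i) V W) = add l (phin l i V) (phin l i W).
Proof.
elim: i l => [l|i IH l]; rewrite ?addn0 //= -addSnnS => lk oV oW ne y0 /(_ isT) w0.
have [x0' y0'] := phi_y y0.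
have oV' := phin_on lk oV y0'; have oW' := phin_on lk oW w0.
rewrite IH //; first 1 last.
- by apply: contra_neq ne => e; rewrite /phi /isoE /= e.
- by case: (i) w0 => // i' /= /phi_y [].
have lk' : (l < k)%N by lia.
by have [] := phi_add lk' x0' (on_chain_x0 w0 oW') ne oV' oW'.
Qed.

(** Two abscissas with the same image satisfy [(x - x') (x x' - c^2) = 0], and [c^2 / x] is the
    abscissa of [U + (0, 0)]. *)
Lemma phi_eq l U U' : (l < k)%N -> on_chain l.+1 U -> on_chain l.+1 U' ->
    (phi l U).2 != 0 -> phi l U = phi l U' ->
  U = U' \/ U' = add l.+1 U (0, 0).
Proof.
move=> lk oU oU' y0 e; have [x0 u0] := phi_y y0.
have [x0' u0'] : U'.1 != 0 /\ U'.2 != 0 by apply: (@phi_y l); rewrite -e.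
have [_ eP _ _] := chain_rels lk; have c0 := chain_c_neq0 (ltnW lk).
have f1 := phi_fib l x0; have f2 := phi_fib l x0'; rewrite -e in f2.
case: U U' oU oU' y0 e x0 u0 x0' u0' f1 f2 => x y [x' y'] /= oU oU'.
rewrite /phi /isoE /= => n0 [_ e2] x0 u0 x0' u0' f1 f2.
have cx : x ^+ 2 - c l ^+ 2 != 0 by apply: contraNneq n0 => ->; rewrite mulr0 mul0r.
have : (x - x') * (x * x' - c l ^+ 2) = 0.
  have -> : (x - x') * (x * x' - c l ^+ 2) = (x - c l) ^+ 2 * x' - (x' - c l) ^+ 2 * x by ring.
  by rewrite f1 f2; ring.
move/eqP; rewrite mulf_eq0 !subr_eq0 => /orP [/eqP xE|/eqP xE].
  left; congr pair => //; move: e2; rewrite -xE.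
  by move/mulIf => /(_ _) /mulIf; apply; rewrite ?invr_eq0 ?expf_neq0.
right; have x'E : x' = c l ^+ 2 / x by rewrite -xE mulrAC mulfV ?mul1r.
have y'E : y' = - (y * c l ^+ 2 / x ^+ 2).
  have e3 : y * (x ^+ 2 - c l ^+ 2) / x ^+ 2 = - (y' / c l ^+ 2) * (x ^+ 2 - c l ^+ 2).
    by rewrite e2 x'E; field; rewrite x0 c0.
  have : y / x ^+ 2 = - (y' / c l ^+ 2) by apply: (mulIf cx); rewrite -e3 mulrAC.
  by move=> e4; rewrite mulrAC e4 mulNr opprK mulfVK ?expf_neq0.
have yE : y ^+ 2 = x ^+ 3 + chain_S l.+1 * x ^+ 2 + c l ^+ 2 * x by rewrite -eP.
have eX : (y / x) ^+ 2 - chain_S l.+1 - x = c l ^+ 2 / x.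
  by rewrite expr_div_n yE; field.
rewrite /addE /= !subr0 eX y'E x'E.
by congr pair; field; rewrite x0.
Qed.

Definition chain_kappa i V := V.1 + al i ^+ 2.

Lemma chain_kappa_neq0 i V : (i < k)%N -> on_chain i V -> V.2 != 0 -> chain_kappa i V != 0.
Proof.
move=> ik /(on_chainE _ ik) e; rewrite -sqrf_eq0 e !mulf_eq0 !negb_or.
by case/andP=> /andP [].
Qed.

(** Induction on the depth. On the curve just above the bottom, the images of the two points are
    equal or differ by [(0, 0)]; in the second case the torsion point [W], which maps to [(0, 0)]
    there, is added to [V]. This does not change the class of [V], for that of [W] is trivial: [W]
    is a double or is [(0, 0)] itself, where [x + al^2] is [al^2]. *)
Lemma phin_kappa i l V V' : (l + i < k)%N ->
    on_chain (l + i) V -> on_chain (l + i) V' ->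
    (phin l i V).2 != 0 -> phin l i V = phin l i V' ->
  exists r, chain_kappa (l + i) V * chain_kappa (l + i) V' = r ^+ 2.
Proof.
elim: i l V V' => [l V V' _ _ _ _ /= <-|i IH l V V' lk]; first by eexists; rewrite -expr2.
rewrite -addSnnS in lk *; set n := (l.+1 + i)%N in lk * => oV oV' /= y0 e.
have lk1 : (l.+1 + i <= k)%N by exact: ltnW.
have [x0' y0'] := phi_y y0.
have y0'' : (phin l.+1 i V').2 != 0 by case: (@phi_y l (phin l.+1 i V')) => //; rewrite -e.
have oU := phin_on lk1 oV y0'; have oU' := phin_on lk1 oV' y0''.
have lk' : (l < k)%N by rewrite /n in lk; lia.
have [eU|eU] := phi_eq lk' oU oU' y0 e; first exact: IH.
have [D0 Don Dy Dphi] := chain_ptD lk.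
pose W := D n l.+1; have eW : phin l.+1 i W = (0, 0).
  by rewrite phin_pt //; case/chain_ptD: (leq_ltn_trans (leq_addr i l.+1) lk).
have oW : on_chain n W by apply: Don; rewrite leq_addr.
have ne : (phin l.+1 i V).1 != (phin l.+1 i W).1 by rewrite eW.
have ne1 : V.1 != W.1 by apply: contra_neq ne; exact: phin_x.
have V0 := phin_y y0'; have Vx0 := on_chain_x0 V0 oV.
have eVW : phin l.+1 i (add n V W) = phin l.+1 i V'.
  rewrite phin_add // ?eW -?eU // => i0.
  have e1 : n = (l.+2 + i.-1)%N by rewrite /n; clear -i0; lia.
  rewrite /W e1 phin_pt -?e1 //.
  have lk2 : (l.+2 < k)%N by move: lk; rewrite e1; apply: leq_ltn_trans; rewrite leq_addr.
  by have [_ _ h _] := chain_ptD lk2; apply: h.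
have oVW : on_chain n (add n V W) by exact: onE_add.
have [] := IH l.+1 (add n V W) V' lk oVW oV' _ eVW; first by rewrite eVW.
move=> r er.
have [r2 er2] := kappa_add (a := al n ^+ 2) (b := B n) erefl erefl Vx0 ne1 oV oW.
have [r3 [r30 er3]] : exists r3, r3 != 0 /\ chain_kappa n W = r3 ^+ 2.
  case: (posnP i) => [i0|i0].
    have en : n = l.+1 by rewrite /n i0 addn0.
    exists (al n); split; first exact: chain_al_neq0.
    by rewrite /W -en D0 /chain_kappa add0r.
  have Dl : (D n l).2 != 0 by apply: Dy; rewrite /n; clear -i0; lia.
  have Dl1 : (D n l.+1).2 != 0 by apply: Dy; rewrite /n; clear -i0; lia.
  have oDl : on_chain n (D n l) by apply: Don; rewrite /n; clear -i0; lia.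
  have [r3 e3] := kappa_dbl two0 (a := al n ^+ 2) (b := B n) erefl erefl Dl oDl.
  exists r3; split=> //; rewrite -sqrf_eq0 -e3; exact: (chain_kappa_neq0 lk oW Dl1).
have k0 : chain_kappa n (add n V W) != 0.
  by apply: chain_kappa_neq0 => //; apply: (@phin_y l.+1 i); rewrite eVW.
exists (r * r2 / (r3 * chain_kappa n (add n V W))).
rewrite expr_div_n !exprMn -er -er2 -er3 /chain_kappa.
move: er3 k0 r30; rewrite /chain_kappa => er3 k0 r30.
field; rewrite k0 er3 expf_neq0 //.
Qed.

Lemma chain_kappa_phi l V : (l < k)%N -> on_chain l.+1 V -> V.1 != 0 ->
  chain_kappa l (phi l V) = (V.2 / V.1) ^+ 2.
Proof.
move=> lk oV x0; have [_ eP ea _] := chain_rels lk.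
rewrite expr_div_n [V.2 ^+ 2]oV eP /chain_kappa ea /phi /isoE /=.
by field.
Qed.

Lemma phinD l i j V : phin l (i + j) V = phin l i (phin (l + i) j V).
Proof. by elim: i l => [|i IH] l /=; rewrite ?addn0 // IH addSnnS. Qed.

(** The image of [Q] on the curve [l] comes from the curve [l + 1], so its class is trivial, and the
    class is constant on the fibre. *)
Lemma chain_good_kappa Q l V : (l < k)%N -> on_chain k Q -> (phin 0 k Q).2 != 0 ->
    on_chain l V -> phin 0 l V = phin 0 k Q ->
  exists2 u, u != 0 & V.1 + al l ^+ 2 = u ^+ 2.
Proof.
move=> lk oQ Q0 oV eV.
have ek : k = (l.+1 + (k - l.+1))%N by rewrite subnKC.
set U := phin l.+1 (k - l.+1) Q.
have eU : phin 0 k Q = phin 0 l (phi l U).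
  have e : k = (l + (k - l.+1).+1)%N by rewrite -addSnnS.
  by rewrite {1}e phinD.
have pU0 : (phi l U).2 != 0 by apply: (@phin_y 0 l); rewrite -eU.
have [x0 y0] := phi_y pU0.
have oU : on_chain l.+1 U by apply: phin_on; rewrite -?ek.
have oP := on_phi lk x0 oU.
have [||r] := @phin_kappa l 0 V (phi l U) lk oV oP; rewrite ?eV // add0n.
rewrite (chain_kappa_phi lk oU x0) => er.
have uy0 : U.2 / U.1 != 0 by rewrite mulf_neq0 ?invr_eq0.
have e : V.1 + al l ^+ 2 = (r / (U.2 / U.1)) ^+ 2.
  by rewrite [in RHS]expr_div_n -er mulfK ?expf_neq0.
exists (r / (U.2 / U.1)) => //; rewrite -sqrf_eq0 -e.
by apply: (chain_kappa_neq0 lk oV); apply: (@phin_y 0 l); rewrite eV.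
Qed.

Lemma chain_good_point Q l X : (l <= k)%N -> on_chain k Q -> (phin 0 k Q).2 != 0 ->
    tree_node c (phin 0 k Q).1 l X ->
  exists Y, on_chain l (X, Y) /\ phin 0 l (X, Y) = phin 0 k Q.
Proof.
move=> lk oQ Q0; elim: l X lk => [X _ /= ->|l IH x lk /= [x0 /(IH _ (ltnW lk)) [Y [oX eX]]]].
  exists (phin 0 k Q).2; rewrite -surjective_pairing; split=> //.
  by apply: phin_on => //; rewrite add0n.
set X := (x - c l) ^+ 2 / x in oX eX.
have [u u0 /= eu] := chain_good_kappa lk oQ Q0 oX eX.
have Y0 : Y != 0 by apply: (@phin_y 0 l (X, Y)); rewrite eX.
have [_ eP ea _] := chain_rels lk.
have ux w : w ^+ 2 = u ^+ 2 -> on_chain l.+1 (x, w * x).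
  move=> ew; rewrite /on_chain /onE eP /= exprMn ew -eu ea /X.
  by field.
have pX w : phi l (x, w * x) = (X, w * (x - c l ^+ 2 / x)).
  by rewrite /phi /isoE /X /=; congr pair; field.
have phinS V : phin 0 l.+1 V = phin 0 l (phi l V) by rewrite -addn1 phinD add0n.
have : Y ^+ 2 = (u * (x - c l ^+ 2 / x)) ^+ 2.
  by have /= -> := (on_chainE (X, Y) lk).1 oX; rewrite exprMn -eu /X; field.
(* Both signs of [u] give a point of abscissa [x]; one of them maps to [(X, Y)] rather than to its
   opposite. *)
move/eqP; rewrite eqf_sqr => /orP [] /eqP eY.
  by exists (u * x); split; [exact: ux | apply: etrans (phinS _) _; rewrite pX -eY eX].
exists (- u * x); split; first by apply: ux; rewrite sqrrN.
by apply: etrans (phinS _) _; rewrite pX mulNr -eY eX.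
Qed.

Theorem chain_good_split Q l X : (l < k)%N -> on_chain k Q -> (phin 0 k Q).2 != 0 ->
    tree_node c (phin 0 k Q).1 l X ->
  exists x, [/\ x != 0, (x - c l) ^+ 2 = X * x & x ^+ 2 != c l ^+ 2].
Proof.
move=> lk oQ Q0 /(chain_good_point (ltnW lk) oQ Q0) [Y [oX eX]].
have [u u0 /= eu] := chain_good_kappa lk oQ Q0 oX eX.
have Y0 : Y != 0 by apply: (@phin_y 0 l (X, Y)); rewrite eX.
have v0 : Y / u != 0 by rewrite mulf_neq0 ?invr_eq0.
have [|x0 _ _ ex xc] := chain_lift lk oX v0.
  have /= eY := (on_chainE (X, Y) lk).1 oX.
  by rewrite expr_div_n eY eu /=; field.
by eexists; split; [exact: x0 | exact: ex | exact: xc].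
Qed.

End IsoChain.

(** * Counting the roots of rational trees *)

Section Trees.
Variables (K : finFieldType) (p q s k : nat) (al rh xx vv : nat -> K).
Hypotheses (pcharK : p \in [pchar K]) (cardK : #|K| = q) (p_q : p.-nat q).
Hypothesis two0 : (2 : K) != 0.
Hypotheses (s_ge10 : (10 <= s)%N) (s_le : (s ^ 2 <= q)%N) (q_le : (q <= s * (s + 2))%N).
Hypotheses (ch : iso_chain k.+1 al rh xx vv) (k1 : (1 < k)%N).

Local Notation c := (chain_c al rh).
Local Notation on_chain := (on_chain al rh).
Local Notation phin := (phin al rh).

Lemma iso_chain_le : iso_chain k al rh xx vv.
Proof.
case: ch => h1 h2 h3 h4 h5 h6 h7 h8; split=> // i ik.
- by apply: h2; exact: leqW.
- by apply: h3; exact: leqW.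
- by apply: h4; case/andP: ik => -> /=; exact: leqW.
- by apply: h6; case/andP: ik => -> /=; exact: leqW.
- by apply: h7; case/andP: ik => -> /=; exact: leqW.
- by apply: h8; case/andP: ik => -> /=; exact: leqW.
Qed.

(** The [k]-th curve as a double cover of the line. The chain has one more step than the trees,
    whence [al k != 0]. *)
Let fE : {poly K} := 'X * (('X + (al k ^+ 2)%:P) * ('X + (4 * c k)%:P)).

Lemma fE_wt : filt (@cenc K (base_curve K)) (2 * 2) fE.
Proof.
have X1 a : (size ('X + a%:P : {poly K})%R <= 2)%N.
  by rewrite -[a%:P]opprK -polyCN size_XsubC.
apply: (@cwt_poly K (base_curve K) 4 fE); rewrite /fE.
have h1 := size_polyMleq ('X + (al k ^+ 2)%:P) ('X + (4 * c k)%:P).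
have h2 := size_polyMleq 'X (('X + (al k ^+ 2)%:P) * ('X + (4 * c k)%:P)).
move: h1 h2 (X1 (al k ^+ 2)) (X1 (4 * c k)); rewrite size_polyX.
move: (size _) (size _) (size _) (size _) => m1 m2 m3 m4; lia.
Qed.

Lemma fE_nonsq (e : K) : e != 0 -> forall a b : {poly K},
  a ^+ 2 = e%:P * fE * b ^+ 2 -> b = 0.
Proof.
move=> e0 a b eab.
apply: (@nonsq_simple_root K (e%:P * fE)
  (e%:P * (('X + (al k ^+ 2)%:P) * ('X + (4 * c k)%:P))) a b 0) => //.
  by rewrite /fE subr0 mulrCA.
have four0 : (4 : K) != 0 by rewrite (_ : 4 = 2 * 2) ?mulf_neq0 // -natrM.
have c0 : c k != 0 by exact: (chain_c_neq0 two0 ch (leqW k1)).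
have a0 : al k != 0 by exact: (chain_al_neq0 ch (ltnSn k)).
have v0 : (e%:P * (('X + (al k ^+ 2)%:P) * ('X + (4 * c k)%:P))).[0] = e * (al k ^+ 2 * (4 * c k)).
  by rewrite !hornerE.
rewrite rootE v0; apply: mulf_neq0 => //; apply: mulf_neq0; first exact: expf_neq0.
exact: mulf_neq0.
Qed.

Let E := quad_step two0 fE_wt fE_nonsq.

Definition pt (z : cpt E) : K * K := ((val z).1, (val z).2).

Lemma pt_inj : injective pt.
Proof. by move=> z w e; apply: val_inj; move: e; rewrite /pt -!surjective_pairing. Qed.

Lemma ptP z : on_chain k (pt z) /\ (pt z).2 != 0.
Proof.
have /andP [/eqP e y0] := valP z; split=> //.
apply/(on_chainE two0 ch) => //; rewrite [LHS]e.
have hE x : fE.[x] = x * (x + al k ^+ 2) * (x + 4 * c k) by rewrite /fE !hornerE.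
exact: hE.
Qed.

Lemma pt_card : (q <= #|cpt E| + 8 + 32 * (s + 2))%N.
Proof.
have := @quad_step_card K p q s pcharK cardK p_q two0 s_ge10 s_le q_le
  (base_curve K) fE 2 fE_wt fE_nonsq isT isT.
have q8 : (8 <= q)%N by apply: leq_trans s_le; nia.
move=> /(_ q8); rewrite -/E; move: #|cpt E| => e.
have -> : #|cpt (base_curve K)| = q by rewrite -cardK.
rewrite /=; nia.
Qed.

Let hx i (x : K) := x + c i ^+ 2 / x - 2 * c i.

Lemma card_hx i (A : {set K}) : (#|[set x : K | (x != 0)%R && (hx i x \in A)]| <= 2 * #|A|)%N.
Proof.
rewrite -sum1_card (partition_big (hx i) (mem A)) /=; last by move=> x; rewrite inE => /andP [].
rewrite mulnC -sum_nat_const; apply: leq_sum => X _.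
rewrite sum1dep_card.
case: (pickP (fun x => (x != 0) && (hx i x == X))) => [x /andP [x0 /eqP eX]|no].
  apply: (@leq_trans #|[set x; c i ^+ 2 / x]|); last by rewrite cards2; case: (_ != _).
  apply: subset_leq_card; apply/subsetP => y; rewrite !inE -andbA => /and3P [y0 _ /eqP].
  rewrite -eX /hx => e; have : (y - x) * (y - c i ^+ 2 / x) = 0.
    have -> : (y - x) * (y - c i ^+ 2 / x) =
       y * ((y + c i ^+ 2 / y - 2 * c i) - (x + c i ^+ 2 / x - 2 * c i)).
      by field; rewrite y0 x0.
    by rewrite e subrr mulr0.
  by move/eqP; rewrite mulf_eq0 !subr_eq0.
apply: (@leq_trans 0) => //; rewrite leqn0 cards_eq0.
apply/eqP/setP => y; rewrite !inE; have := no y; case: (y != 0) => //=.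
by move=> ->; rewrite andbF.
Qed.

(** Abscissas from which the way down meets the abscissa [0] or a zero ordinate: when the ordinate
    of [V] is nonzero, that of [phi l V] vanishes only where [x^2 = c_l^2]. *)
Fixpoint bad l : {set K} :=
  if l is l'.+1 then [set 0; c l'; - c l'] :|: [set x | (x != 0) && (hx l' x \in bad l')]
  else set0.

Lemma card_bad l : (#|bad l| + 3 <= 3 * 2 ^ l)%N.
Proof.
elim: l => [|l IH] /=; first by rewrite cards0.
have [h1 _] := leq_card_setU [set 0; c l; - c l] [set x | (x != 0) && (hx l x \in bad l)].
have h2 := card_hx l (bad l).
have h3 : (#|[set 0%R; c l; - c l]| <= 3)%N.
  apply: leq_trans (leq_card_setU _ _) _; rewrite cards1 cards2 addn1 ltnS.
  by case: (_ != _).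
apply: leq_trans (leq_add h1 (leqnn 3)) _.
apply: leq_trans (leq_add (leq_add h3 h2) (leqnn 3)) _.
by rewrite expnS; move: #|bad l| IH => b; lia.
Qed.

Fixpoint fib X l : {set K} :=
  if l is l'.+1 then [set x | (x != 0) && (hx l' x \in fib X l')] else [set X].

Lemma card_fib X l : (#|fib X l| <= 2 ^ l)%N.
Proof.
elim: l => [|l IH] /=; first by rewrite cards1.
by apply: leq_trans (card_hx _ _) _; rewrite expnS leq_mul2l.
Qed.

Lemma phin_top l V : phin 0 l.+1 V = phin 0 l (phi al rh l V).
Proof. by rewrite -addn1 phinD add0n. Qed.

Lemma phin_bad l V : V.2 != 0 -> V.1 \notin bad l ->
  (phin 0 l V).2 != 0 /\ V.1 \in fib (phin 0 l V).1 l.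
Proof.
elim: l V => [|l IH] V; first by move=> y0 _; split; rewrite //= set11.
move=> y0; rewrite phin_top /= !inE !negb_or negb_and negbK -!andbA => /and4P [x0 xc xc' hV].
rewrite (negPf x0) /= in hV.
have [||h1 h2] := IH (phi al rh l V); last by rewrite x0.
  rewrite /phi /isoE /= !mulf_neq0 ?invr_eq0 ?expf_neq0 //.
  by rewrite subr_eq0 eqf_sqr negb_or xc xc'.
by [].
Qed.

(** A root is the image of at most [2^(k+1)] points of the [k]-th curve, [2^k] abscissas with two
    ordinates each, and at most [6 * 2^k] points are bad. *)
Theorem tree_roots : exists G : {set K},
  (forall X0, X0 \in G -> X0 != 0 /\ forall l X, (l < k)%N -> tree_node c X0 l X ->
     exists x, [/\ x != 0, (x - c l) ^+ 2 = X * x & x ^+ 2 != c l ^+ 2]) /\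
  (q <= #|G| * 2 ^ k.+1 + 6 * 2 ^ k + 8 + 32 * (s + 2))%N.
Proof.
pose U := [set z : cpt E | (pt z).1 \notin bad k].
pose G := [set (phin 0 k (pt z)).1 | z in U].
exists G; split.
  move=> _ /imsetP [z zU ->]; have [oz z0] := ptP z.
  rewrite inE in zU; have [f0 _] := phin_bad z0 zU.
  have oz0 : on_chain 0 (phin 0 k (pt z)).
    by apply: (phin_on two0 iso_chain_le); rewrite ?add0n.
  split; first exact: on_chain_x0 f0 oz0.
  by move=> l X lk; exact: (chain_good_split two0 iso_chain_le k1 lk oz f0).
have two_pts (A : {set K}) : (#|[set z : cpt E | (pt z).1 \in A]| <= 2 * #|A|)%N.
  rewrite -sum1_card (partition_big (fun z : cpt E => (pt z).1) (mem A)) /=; last by move=> x; rewrite inE.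
  rewrite mulnC -sum_nat_const; apply: leq_sum => X _; rewrite sum1dep_card.
  case: (pickP (fun z : cpt E => (pt z).1 == X)) => [z /eqP eX|no].
    rewrite -(card_imset _ pt_inj).
    apply: (@leq_trans #|[set (X, (pt z).2); (X, - (pt z).2)]|); last by rewrite cards2; case: (_ != _).
    apply: subset_leq_card; apply/subsetP => _ /imsetP [w + ->].
    rewrite !inE => /andP [_ /eqP e']; have eX' : (pt w).1 = X by exact: e'.
    have [/(on_chainE two0 ch _ (ltnSn k)) e1 _] := ptP z.
    have [/(on_chainE two0 ch _ (ltnSn k)) e2 _] := ptP w.
    have ew : pt w = (X, (pt w).2) by rewrite -eX' -surjective_pairing.
    have := e2; rewrite eX' -eX -e1 => /eqP; rewrite eqf_sqr ew -eX.
    by case/orP => /eqP /= ->; rewrite eqxx ?orbT.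
  apply: (@leq_trans 0) => //; rewrite leqn0 cards_eq0.
  by apply/eqP/setP => y; rewrite !inE no andbF.
have hU : (#|cpt E| <= #|U| + 2 * #|bad k|)%N.
  rewrite -(cardsC U) leq_add2l; apply: leq_trans (two_pts (bad k)).
  by apply: subset_leq_card; apply/subsetP => z; rewrite !inE negbK.
have hG : (#|U| <= #|G| * 2 ^ k.+1)%N.
  rewrite -sum1_card (partition_big (fun z : cpt E => (phin 0 k (pt z)).1) (mem G)) /=; last first.
    by move=> z zU; apply: imset_f.
  rewrite -sum_nat_const; apply: leq_sum => X _; rewrite sum1dep_card.
  rewrite expnS; apply: leq_trans (_ : 2 * #|fib X k| <= _)%N; last by rewrite leq_mul2l card_fib.
  apply: leq_trans (two_pts (fib X k)); apply: subset_leq_card; apply/subsetP => z.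
  rewrite !inE => /andP [zU /eqP <-]; have [_ z0] := ptP z.
  by have [] := phin_bad z0 zU.
move: pt_card (card_bad k) hU hG; move: #|bad k| #|U| #|cpt E| (#|G| * _)%N => b u e g; lia.
Qed.

End Trees.

(** * Straight-line complexity *)

Section StraightLine.
Variables (K : fieldType) (R : comNzRingType) (cst : {rmorphism K -> R}).
Implicit Types (F G H : R -> Prop) (x y z : R).

(* Sets of elements of [R] stand for sets of available values, constants being
   always available. [slc F c G] means that, from [F], at most [c] ring
   operations yield all elements of [G] simultaneously. The programs need no
   division. *)
Definition known F x := F x \/ exists c, x = cst c.
Definition setor F G : R -> Prop := fun x => F x \/ G x.

Inductive slc : (R -> Prop) -> nat -> (R -> Prop) -> Prop :=
| SlcDone F c G : (forall x, G x -> known F x) -> slc F c G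
| SlcOp F c G x y z : known F x -> known F y ->
    [\/ z = x + y, z = x - y | z = x * y] ->
    slc (setor F (eq z)) c G -> slc F c.+1 G.

Definition sub F G := forall x, F x -> known G x.

Lemma sub_refl F : sub F F. Proof. by left. Qed.
Lemma sub_l F G H : sub F G -> sub F (setor G H).
Proof. by move=> FG x /FG [Gx|cx]; [left; left | right]. Qed.
Lemma sub_r F G H : sub F H -> sub F (setor G H).
Proof. by move=> FH x /FH [Hx|cx]; [left; right | right]. Qed.
Lemma sub_or F G H : sub F H -> sub G H -> sub (setor F G) H.
Proof. by move=> FH GH x [/FH|/GH]. Qed.
Lemma known_sub F G x : sub F G -> known F x -> known G x.
Proof. by move=> FG [/FG|cx] //; right. Qed.
Lemma sub_trans F G H : sub F G -> sub G H -> sub F H.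
Proof. by move=> FG GH x /FG; apply: known_sub. Qed.
Lemma sub_or2 F F' G G' : sub F F' -> sub G G' -> sub (setor F G) (setor F' G').
Proof. by move=> h1 h2; apply: sub_or; [apply: sub_l | apply: sub_r]. Qed.

Lemma slc_weak F c G : slc F c G -> forall F' c' G',
  sub F F' -> sub G' G -> (c <= c')%N -> slc F' c' G'.
Proof.
elim=> {F c G} [F c G GF|F c G x y z Fx Fy xyz _ IH] F' c' G' FF' GG' lecc'.
  by apply: SlcDone; apply: sub_trans GG' (sub_trans GF FF').
case: c' lecc' => // c' lecc'; apply: SlcOp (known_sub FF' Fx) (known_sub FF' Fy) xyz _.
by apply: IH => //; apply: sub_or2 => //; apply: sub_refl.
Qed.

Lemma slc_le F c c' G : slc F c G -> (c <= c')%N -> slc F c' G.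
Proof. by move=> h le; apply: (slc_weak h (@sub_refl _) (@sub_refl _) le). Qed.

Lemma slc_sub F F' c G : slc F c G -> sub F F' -> slc F' c G.
Proof. by move=> h s; apply: (slc_weak h s (@sub_refl _) (leqnn c)). Qed.

Lemma slc_out F c G G' : slc F c G -> sub G' G -> slc F c G'.
Proof. by move=> h s; apply: (slc_weak h (@sub_refl _) s (leqnn c)). Qed.

Lemma slc_bind F c1 G c2 H : slc F c1 G -> slc (setor F G) c2 H ->
  slc F (c1 + c2) H.
Proof.
move=> h1; elim: h1 H c2 => {F c1 G} [F c G GF|F c G x y z Fx Fy xyz _ IH] H c2 h2.
  apply: (slc_weak h2 _ (@sub_refl H) (leq_addl c c2)).
  exact: sub_or (@sub_refl F) GF.
rewrite addSn; apply: SlcOp Fx Fy xyz _; apply: IH; apply: slc_sub h2 _.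
by apply: sub_or2 (@sub_refl G); apply: sub_l; apply: sub_refl.
Qed.

Lemma slc_done F G c : sub G F -> slc F c G.
Proof. exact: SlcDone. Qed.

Lemma slc_or F c1 c2 G H : slc F c1 G -> slc F c2 H -> slc F (c1 + c2) (setor G H).
Proof.
move=> h1 h2; apply: slc_bind h1 _; rewrite -[c2]addn0.
apply: slc_bind (slc_sub h2 (sub_l _ (@sub_refl F))) _; apply: slc_done.
by apply: sub_or; [apply: sub_l; apply: sub_r | apply: sub_r]; apply: sub_refl.
Qed.

Definition bigor n (G : nat -> R -> Prop) : R -> Prop :=
  fun x => exists2 i, (i < n)%N & G i x.

Lemma sub_bigor n (G : nat -> R -> Prop) F :
  (forall i, (i < n)%N -> sub (G i) F) -> sub (bigor n G) F.
Proof. by move=> h x [i /h]; apply. Qed.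

Lemma sub_bigor_in n (G : nat -> R -> Prop) i F : (i < n)%N -> sub F (G i) ->
  sub F (bigor n G).
Proof. by move=> ltin h x /h [Gx|cx]; [left; exists i | right]. Qed.

Lemma slc_big F n (c : nat -> nat) (G : nat -> R -> Prop) :
  (forall i, (i < n)%N -> slc F (c i) (G i)) -> slc F (\sum_(i < n) c i) (bigor n G).
Proof.
elim: n => [|n IH] h; first by rewrite big_ord0; apply: slc_done => x [].
rewrite big_ord_recr /=; have h1 := IH (fun i lt => h i (ltnW lt)).
apply: slc_out (slc_or h1 (h n (ltnSn n))) _.
apply: sub_bigor => i; rewrite ltnS leq_eqVlt => /orP [/eqP ->|lt].
  exact: sub_r (@sub_refl _).
by apply: sub_l; apply: sub_bigor_in lt (@sub_refl _).
Qed.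

Lemma slc_all F n c (G : nat -> R -> Prop) :
  (forall i, (i < n)%N -> slc F c (G i)) -> slc F (n * c) (bigor n G).
Proof.
move=> h; have := @slc_big F n (fun=> c) G h.
by rewrite sum_nat_const card_ord.
Qed.

Lemma slc_add F x y : known F x -> known F y -> slc F 1 (eq (x + y)).
Proof.
move=> Fx Fy; apply: SlcOp Fx Fy (Or31 _ _ erefl) _.
by apply: slc_done; apply: sub_r; apply: sub_refl.
Qed.

Lemma slc_opp F x y : known F x -> known F y -> slc F 1 (eq (x - y)).
Proof.
move=> Fx Fy; apply: SlcOp Fx Fy (Or32 _ _ erefl) _.
by apply: slc_done; apply: sub_r; apply: sub_refl.
Qed.

Lemma slc_mul F x y : known F x -> known F y -> slc F 1 (eq (x * y)).
Proof.
move=> Fx Fy; apply: SlcOp Fx Fy (Or33 _ _ erefl) _.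
by apply: slc_done; apply: sub_r; apply: sub_refl.
Qed.

Lemma known_cst F c : known F (cst c). Proof. by right; exists c. Qed.
Lemma known_eq F x : known F x -> sub (eq x) F.
Proof. by move=> h _ <-. Qed.

Lemma slc_dot F n (u v : nat -> R) : (forall i, (i < n)%N -> known F (u i)) ->
    (forall i, (i < n)%N -> known F (v i)) ->
  slc F (2 * n) (eq (\sum_(i < n) u i * v i)).
Proof.
elim: n => [|n IH] hu hv.
  rewrite big_ord0; apply: slc_done => _ <-; right; exists 0; exact/esym/rmorph0.
rewrite big_ord_recr mulnS addnC /=.
apply: slc_bind (IH (fun i lt => hu i (ltnW lt)) (fun i lt => hv i (ltnW lt))) _.
rewrite -[2%N]/(1 + 1)%N; apply: slc_bind.
  apply: slc_mul; first by apply: known_sub (hu n (ltnSn n)); apply: sub_l; apply: sub_refl.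
  by apply: known_sub (hv n (ltnSn n)); apply: sub_l; apply: sub_refl.
apply: slc_add; first by left; left; right.
by left; right.
Qed.

Definition cf n (P : {poly R}) : R -> Prop := fun x => exists2 i, (i < n)%N & x = P`_i.

Lemma known_cf F n P i : sub (cf n P) F -> (i < n)%N -> known F P`_i.
Proof. by move=> h lt; apply: h; exists i. Qed.

Lemma known_coef F n P i : sub (cf n P) F -> (size P <= n)%N -> known F P`_i.
Proof.
move=> h le; have [lt|ge] := ltnP i n; first exact: known_cf h lt.
by rewrite nth_default ?(leq_trans le) //; right; exists 0; rewrite rmorph0.
Qed.

Lemma sub_cf F n (P : {poly R}) : (forall i, (i < n)%N -> known F P`_i) -> sub (cf n P) F.
Proof. by move=> h _ [i lt ->]; apply: h. Qed.

Lemma cf_bigor n P : sub (cf n P) (bigor n (fun i => eq P`_i)).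
Proof. by move=> _ [i lt ->]; left; exists i. Qed.

Lemma slc_coefs F n c (P : {poly R}) : (forall i, (i < n)%N -> slc F c (eq P`_i)) ->
  slc F (n * c) (cf n P).
Proof. by move=> h; apply: slc_out (slc_all h) (@cf_bigor n P). Qed.

Lemma slc_polyD F n P Q : sub (cf n P) F -> sub (cf n Q) F -> slc F n (cf n (P + Q)).
Proof.
move=> hP hQ; rewrite -{1}[n]muln1; apply: slc_coefs => i lt; rewrite coefD.
by apply: slc_add; [apply: known_cf hP lt | apply: known_cf hQ lt].
Qed.

Lemma slc_polyB F n P Q : sub (cf n P) F -> sub (cf n Q) F -> slc F n (cf n (P - Q)).
Proof.
move=> hP hQ; rewrite -{1}[n]muln1; apply: slc_coefs => i lt; rewrite coefB.
by apply: slc_opp; [apply: known_cf hP lt | apply: known_cf hQ lt].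
Qed.

Lemma slc_polyZ F n x P : known F x -> sub (cf n P) F -> slc F n (cf n (x *: P)).
Proof.
move=> hx hP; rewrite -{1}[n]muln1; apply: slc_coefs => i lt; rewrite coefZ.
by apply: slc_mul => //; apply: known_cf hP lt.
Qed.

Lemma sub_cf_le F n m P : sub (cf n P) F -> (m <= n)%N -> sub (cf m P) F.
Proof. by move=> h le; apply: sub_cf => i lt; apply: known_cf h (leq_trans lt le). Qed.

Lemma sub_cf_size F n m P : sub (cf n P) F -> (size P <= n)%N -> sub (cf m P) F.
Proof. by move=> h le; apply: sub_cf => i lt; apply: known_coef h le. Qed.

Lemma sub_cf_cst F n (p : {poly K}) : sub (cf n (map_poly cst p)) F.
Proof. by apply: sub_cf => i lt; rewrite coef_map; right; exists p`_i. Qed.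

End StraightLine.

#[export] Hint Resolve sub_refl sub_l sub_r : core.

(** * Programs and computation trees *)

(* Straight-line programs are run in the ring of functions of the input. *)
Definition fenv (K : Type) n : Type := 'rV[K]_n -> K.

HB.instance Definition _ K n := gen_eqMixin (fenv K n).
HB.instance Definition _ K n := gen_choiceMixin (fenv K n).

Section FenvRing.
Variables (K : fieldType) (n : nat).
Implicit Types f g h : fenv K n.

Definition fenv_add f g : fenv K n := fun e => f e + g e.
Definition fenv_opp f : fenv K n := fun e => - f e.
Definition fenv_mul f g : fenv K n := fun e => f e * g e.
Definition fenv_cst (c : K) : fenv K n := fun=> c.

Lemma fenv_addA : associative fenv_add.
Proof. by move=> f g h; apply/funext => e; apply: addrA. Qed.
Lemma fenv_addC : commutative fenv_add.
Proof. by move=> f g; apply/funext => e; apply: addrC. Qed.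
Lemma fenv_add0 : left_id (fenv_cst 0) fenv_add.
Proof. by move=> f; apply/funext => e; apply: add0r. Qed.
Lemma fenv_addN : left_inverse (fenv_cst 0) fenv_opp fenv_add.
Proof. by move=> f; apply/funext => e; apply: addNr. Qed.
HB.instance Definition _ := GRing.isZmodule.Build (fenv K n)
  fenv_addA fenv_addC fenv_add0 fenv_addN.

Lemma fenv_mulA : associative fenv_mul.
Proof. by move=> f g h; apply/funext => e; apply: mulrA. Qed.
Lemma fenv_mulC : commutative fenv_mul.
Proof. by move=> f g; apply/funext => e; apply: mulrC. Qed.
Lemma fenv_mul1 : left_id (fenv_cst 1) fenv_mul.
Proof. by move=> f; apply/funext => e; apply: mul1r. Qed.
Lemma fenv_mulD : left_distributive fenv_mul fenv_add.
Proof. by move=> f g h; apply/funext => e; apply: mulrDl. Qed.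
Lemma fenv_one_neq0 : fenv_cst 1 != 0 :> fenv K n.
Proof. by apply/eqP => /(congr1 (@^~ 0)) /eqP; rewrite oner_eq0. Qed.
HB.instance Definition _ := GRing.Zmodule_isComNzRing.Build (fenv K n)
  fenv_mulA fenv_mulC fenv_mul1 fenv_mulD fenv_one_neq0.

Lemma fenv_cst_zmod : zmod_morphism fenv_cst. Proof. by []. Qed.
Lemma fenv_cst_monoid : monoid_morphism fenv_cst. Proof. by []. Qed.
HB.instance Definition _ := GRing.isZmodMorphism.Build K (fenv K n) fenv_cst fenv_cst_zmod.
HB.instance Definition _ := GRing.isMonoidMorphism.Build K (fenv K n) fenv_cst fenv_cst_monoid.

Definition fenv_ev (e : 'rV[K]_n) f : K := f e.
Lemma fenv_ev_zmod e : zmod_morphism (fenv_ev e). Proof. by []. Qed.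
Lemma fenv_ev_monoid e : monoid_morphism (fenv_ev e). Proof. by []. Qed.
HB.instance Definition _ e :=
  GRing.isZmodMorphism.Build (fenv K n) K (fenv_ev e) (fenv_ev_zmod e).
HB.instance Definition _ e :=
  GRing.isMonoidMorphism.Build (fenv K n) K (fenv_ev e) (fenv_ev_monoid e).

End FenvRing.

Section Trees.
Variables (K : fieldType) (n : nat).
Notation R := (fenv K n).
Notation cst := (@fenv_cst K n).
Notation known := (@known K R cst).
Notation slc := (@slc K R cst).
Notation sub := (@sub K R cst).
Implicit Types (D : 'rV[K]_n -> Prop) (F G : R -> Prop) (xs zs : seq R).

Definition mem_at xs (e : 'rV[K]_n) : seq K := [seq x e | x : R <- xs].

Definition avail D xs (f : R) :=
  exists o, forall e, D e -> operand_eval (mem_at xs e) o = Some (f e).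

Lemma avail_known D xs F f : (forall f, F f -> avail D xs f) -> known F f -> avail D xs f.
Proof. by move=> h [/h //|[c ->]]; exists (Const c). Qed.

Lemma avail_nth D xs i : (i < size xs)%N -> avail D xs (nth 0 xs i).
Proof.
move=> lt; exists (Reg K i) => e _ /=; rewrite /mem_at onth_map.
by elim: xs i lt => [|x s IH] [|i] //= /IH.
Qed.

Lemma avail_cat D xs zs f : avail D xs f -> avail D (xs ++ zs) f.
Proof.
case=> -[c|j] h; first by exists (Const c).
exists (Reg K j) => e De; have /= := h e De.
rewrite /mem_at map_cat; elim: (map _ xs) j {h} => [|x s IH] [|j] //=; exact: IH.
Qed.

Lemma slc_code D F c G : slc F c G -> forall xs, (forall f, F f -> avail D xs f) ->
  exists code zs, [/\ (size code <= c)%N,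
    forall e, D e -> code_eval (mem_at xs e) code = Some (mem_at (xs ++ zs) e)
    & forall f, G f -> avail D (xs ++ zs) f].
Proof.
elim=> {F c G} [F c G GF|F c G x y z Fx Fy xyz _ IH] xs Fxs.
  exists [::], [::]; split=> [//|e _|f /GF h]; rewrite cats0 //.
  exact: avail_known h.
have [a ea] := avail_known Fxs Fx; have [b eb] := avail_known Fxs Fy.
have [op eop] : exists op, forall e, arith_eval op (x e) (y e) = Some (z e).
  by case: xyz => ->; [exists Add | exists Defs.Sub | exists Mul].
have [|code [zs [sz ev av]]] := IH (rcons xs z).
  move=> f [/Fxs h|<-]; first by rewrite -cats1; apply: avail_cat.
  have := @avail_nth D (rcons xs z) (size xs); rewrite size_rcons nth_rcons ltnn eqxx.
  exact.
exists (Instr op a b :: code), (z :: zs); split=> //.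
- move=> e De; rewrite /= /instr_eval /= ea // eb // eop.
  have := ev e De; rewrite /mem_at map_rcons => ->.
  by rewrite -cat_rcons.
- by rewrite -cat_rcons.
Qed.

Lemma operands_ev D xs (fs : seq R) : (forall f, f \in fs -> avail D xs f) ->
  exists os, forall e, D e -> operands_eval (mem_at xs e) os = Some (mem_at fs e).
Proof.
elim: fs => [|f fs IH] h; first by exists [::].
have [os eos] : exists os, forall e, D e -> operands_eval (mem_at xs e) os = Some (mem_at fs e).
  by apply: IH => g gfs; apply: h; rewrite inE gfs orbT.
have [o eo] := h f (mem_head f fs).
by exists (o :: os) => e De; rewrite /= eo // eos.
Qed.

(* On the inputs in [D], a tree of cost at most [c] whose memory contains [F]
   computes an output related to the input by [g]. *)
Definition tcan D c F (g : 'rV[K]_n -> seq K -> Prop) := forall xs,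
  (forall f, F f -> avail D xs f) ->
  exists2 t : ctree K, (ctree_cost t <= c)%N &
    forall e, D e -> exists2 s, ctree_eval t (mem_at xs e) = Some s & g e s.

Lemma tcan_slc D c1 c2 F G g : slc F c1 G -> tcan D c2 (setor F G) g ->
  tcan D (c1 + c2) F g.
Proof.
move=> h1 h2 xs Fxs; have [code [zs [sz ev av]]] := slc_code h1 Fxs.
have [|t ct et] := h2 (xs ++ zs).
  by move=> f [/Fxs h|/av //]; apply: avail_cat.
exists (foldr (fun i t => Compute i t) t code).
  apply: leq_trans (leq_add sz ct).
  by elim: code {sz ev} => //= i s IH; rewrite addSn ltnS.
move=> e De; have ev0 := ev e De; have [s es gs] := et e De; exists s => //; move: ev0 es.
move: (mem_at xs e) (mem_at (xs ++ zs) e).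
elim: code {sz ev} => [|i c IH] m m' /=; first by move=> [->].
by case: (instr_eval m i) => // x /IH h /h.
Qed.

Lemma tcan_test D c F x g : known F x ->
    tcan (fun e => D e /\ x e = 0) c F g -> tcan (fun e => D e /\ x e <> 0) c F g ->
  tcan D c.+1 F g.
Proof.
move=> Fx h1 h2 xs Fxs; have [o eo] := avail_known Fxs Fx.
have [|t1 c1 e1] := h1 xs; first by move=> f /Fxs [o' h]; exists o' => e [/h].
have [|t2 c2 e2] := h2 xs; first by move=> f /Fxs [o' h]; exists o' => e [/h].
exists (TestEq o (Const 0) t1 t2); first by rewrite /= ltnS geq_max c1.
move=> e De; rewrite /= eo //; have [x0|x0] := eqVneq (x e) 0; first by apply: e1.
by apply: e2; split => //; apply/eqP.
Qed.

Lemma tcan_ret D c F (fs : seq R) g : (forall f, f \in fs -> known F f) ->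
  (forall e, D e -> g e (mem_at fs e)) -> tcan D c F g.
Proof.
move=> h eg xs Fxs; have [|os eos] := @operands_ev D xs fs.
  by move=> f /h; apply: avail_known.
by exists (Return os) => // e De; exists (mem_at fs e); [exact: eos | exact: eg].
Qed.

Lemma tcan_weak D c c' F F' g : tcan D c F g -> (c <= c')%N ->
    (forall f, F f -> exists2 f', known F' f' & forall e, D e -> f e = f' e) ->
  tcan D c' F' g.
Proof.
move=> h lec FF' xs Fxs; have [|t ct et] := h xs.
  move=> f /FF' [f' /(avail_known Fxs) [o eo] e]; exists o => v Dv.
  by rewrite eo // e.
by exists t => //; apply: leq_trans lec.
Qed.

Lemma tcan_void D F g : (forall e, ~ D e) -> tcan D 0 F g.
Proof. by move=> h xs _; exists (Return [::]) => // e /h. Qed.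

End Trees.

(** * Fast multiplication of polynomials *)

Section NegacyclicFFT.
Import Pdiv.CommonRing Pdiv.RingMonic.
Variables (K : fieldType) (R : comNzRingType) (cst : {rmorphism K -> R}).
Variables (S : comNzRingType) (sg : S -> R -> Prop) (n t M : nat) (w h2 : S).
Notation slc := (slc cst).
Notation sub := (sub cst).
Hypothesis slcD : forall F a b, sub (sg a) F -> sub (sg b) F -> slc F n (sg (a + b)).
Hypothesis slcB : forall F a b, sub (sg a) F -> sub (sg b) F -> slc F n (sg (a - b)).
Hypothesis slcW : forall F e a, sub (sg a) F -> slc F n (sg (w ^+ e * a)).
Hypothesis slcH : forall F a, sub (sg a) F -> slc F n (sg (h2 * a)).
Hypothesis slcM : forall F a b, sub (sg a) F -> sub (sg b) F -> slc F t (sg (a * b)).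
Hypotheses (M0 : (0 < M)%N) (h2K : h2 * 2 = 1) (wM : w ^+ (2 * M) = -1).

(** [sg a] is the set of coordinates over [R] of an element [a] of [S]. In [S] a product by a power
    of [w] is as cheap as a sum, and only the products of two variable elements cost [t]. *)
Definition sgp m (P : {poly S}) : R -> Prop := bigor m (fun i => sg P`_i).

Lemma sgp_in m P F i : sub (sgp m P) F -> (i < m)%N -> sub (sg P`_i) F.
Proof. by move=> h lt x sx; apply: h; exists i. Qed.

Lemma slc_sgp m c (P : {poly S}) F : (forall i, (i < m)%N -> slc F c (sg P`_i)) -> slc F (m * c) (sgp m P).
Proof. exact: slc_all. Qed.

Lemma slc_sgpD m P Q F : sub (sgp m P) F -> sub (sgp m Q) F -> slc F (m * n) (sgp m (P + Q)).
Proof.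
move=> hP hQ; apply: slc_sgp => i lt; rewrite coefD.
by apply: slcD; [apply: sgp_in hP lt | apply: sgp_in hQ lt].
Qed.

Lemma slc_sgpB m P Q F : sub (sgp m P) F -> sub (sgp m Q) F -> slc F (m * n) (sgp m (P - Q)).
Proof.
move=> hP hQ; apply: slc_sgp => i lt; rewrite coefB.
by apply: slcB; [apply: sgp_in hP lt | apply: sgp_in hQ lt].
Qed.

Lemma slc_sgpW m e P F : sub (sgp m P) F -> slc F (m * n) (sgp m (w ^+ e *: P)).
Proof.
move=> hP; apply: slc_sgp => i lt; rewrite coefZ.
by apply: slcW; apply: sgp_in hP lt.
Qed.

Lemma slc_sgpH m P F : sub (sgp m P) F -> slc F (m * n) (sgp m (h2 *: P)).
Proof.
move=> hP; apply: slc_sgp => i lt; rewrite coefZ.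
by apply: slcH; apply: sgp_in hP lt.
Qed.

Lemma twist_monic h (g : S) : (0 < h)%N -> ('X^h - g%:P : {poly S}) \is monic.
Proof. exact: monicXnsubC. Qed.

Lemma twist_half h (g : S) U : (0 < h)%N ->
  let T := rmodp U ('X^(2 * h) - (g ^+ 2)%:P) in
  rmodp U ('X^h - g%:P) = take_poly h T + g *: drop_poly h T.
Proof.
move=> h0 T; have h20 : (0 < 2 * h)%N by rewrite muln_gt0.
have m2 := twist_monic (g ^+ 2) h20; have m1 := twist_monic g h0.
have eU := rdivp_eq m2 U; rewrite -/T in eU; set q := rdivp _ _ in eU.
have sT : (size T <= 2 * h)%N.
  by rewrite -ltnS -(size_XnsubC (g ^+ 2) h20) ltn_rmodp monic_neq0.
have -> : U = (q * ('X^h + g%:P) + drop_poly h T) * ('X^h - g%:P) +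
    (take_poly h T + g *: drop_poly h T).
  rewrite {1}eU -{1}[T](poly_take_drop h) -mul_polyC mulnC exprM rmorphXn /=; ring.
rewrite rmodp_addl_mul_small // size_XnsubC // ltnS.
apply: leq_trans (size_polyD _ _) _; rewrite geq_max size_take_poly /=.
apply: leq_trans (size_scale_leq _ _) _; rewrite size_drop_poly leq_subLR addnn -mul2n.
exact: sT.
Qed.

Lemma twist_mul h (g : S) A B : (0 < h)%N ->
  let d := 'X^h - g%:P in rmodp (A * B) d = rmodp (rmodp A d * rmodp B d) d.
Proof.
move=> h0 d; have md := twist_monic g h0.
by rewrite [RHS]rmodp_mulmr // [rmodp A d * B]mulrC rmodp_mulmr // [B * A]mulrC.
Qed.

Lemma twist_small h (g : S) (A : {poly S}) : (0 < h)%N -> (size A <= 2 * h)%N ->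
  rmodp A ('X^h - g%:P) = take_poly h A + g *: drop_poly h A.
Proof.
move=> h0 sA; rewrite (twist_half g A h0); have h20 : (0 < 2 * h)%N by rewrite muln_gt0.
by rewrite rmodp_small // size_XnsubC.
Qed.

(** The modulus [X^(2h) - g^2] splits into [X^h - g] and [X^h + g], and [- g] is again a power of
    [w] as [w^(2M) = -1]; the divisibility of the exponents provides the square roots [g]. A level
    costs [3 h n] for each factor and [6 h n] for the recombination, whence the constant 6 for size
    [2 h]. *)
Lemma fft_mul j e (A B : {poly S}) F : (2 ^ j %| e)%N -> (2 ^ j %| 2 * M)%N ->
    (size A <= 2 ^ j)%N -> (size B <= 2 ^ j)%N ->
    sub (sgp (2 ^ j) A) F -> sub (sgp (2 ^ j) B) F ->
  slc F (2 ^ j * t + 6 * j * 2 ^ j * n)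
    (sgp (2 ^ j) (rmodp (A * B) ('X^(2 ^ j) - (w ^+ e)%:P))).
Proof.
elim: j e A B F => [|j IH] e A B F.
  rewrite expn0 => _ _ sA sB hA hB; rewrite muln0 !mul0n addn0.
  rewrite (size1_polyC sA) (size1_polyC sB) -polyCM rmodp_small; last first.
    by rewrite size_XnsubC // ltnS size_polyC_leq1.
  apply: slc_sgp => -[|//] _; rewrite coefC /=.
  by apply: slcM; [apply: sgp_in hA _ | apply: sgp_in hB _].
set h := (2 ^ j)%N; have h0 : (0 < h)%N by rewrite expn_gt0.
have -> : (2 ^ j.+1 = 2 * h)%N by rewrite expnS.
move=> /dvdnP [e2 ee] dM sA sB hA hB; pose e' := (e2 * h)%N.
have {ee} ee : e = (e' * 2)%N by rewrite ee /e'; lia.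
pose g := w ^+ e'; have eg : w ^+ e = g ^+ 2 by rewrite ee exprM.
have dM' : (h %| 2 * M)%N by apply: dvdn_trans dM; apply: dvdn_mull.
have Ng : - g = w ^+ (e' + 2 * M) by rewrite exprD wM mulrN1.
have [gV gK] : exists r, w ^+ r * g = 1.
  exists (e' * (4 * M).-1)%N; rewrite -exprD.
  have -> : (e' * (4 * M).-1 + e' = (2 * M) * (2 * e'))%N by nia.
  by rewrite exprM wM exprM sqrrN !expr1n.
pose Ap := rmodp A ('X^h - g%:P); pose Am := rmodp A ('X^h - (- g)%:P).
pose Bp := rmodp B ('X^h - g%:P); pose Bm := rmodp B ('X^h - (- g)%:P).
have pre (X : {poly S}) (G : R -> Prop) : (size X <= 2 * h)%N -> sub (sgp (2 * h) X) G ->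
    slc G (3 * (h * n)) (setor (sgp h (rmodp X ('X^h - g%:P))) (sgp h (rmodp X ('X^h - (- g)%:P)))).
  move=> sX hX; rewrite !twist_small //.
  have h1 : sub (sgp h (drop_poly h X)) G.
    apply: sub_bigor => i lt; rewrite coef_drop_poly.
    by apply: sgp_in hX _; lia.
  have h3 : sub (sgp h (take_poly h X)) G.
    apply: sub_bigor => i lt; rewrite coef_take_poly lt.
    by apply: sgp_in hX _; lia.
  have -> : (3 * (h * n) = h * n + (h * n + h * n))%N by lia.
  apply: slc_bind (slc_sgpW e' h1) _; rewrite scaleNr; apply: slc_or.
    by apply: slc_sgpD; auto.
  by apply: slc_sgpB; auto.
have sp g' X : (size (rmodp X ('X^h - g'%:P) : {poly S}) <= h)%N.
  by rewrite -ltnS -(size_XnsubC g' h0) ltn_rmodp monic_neq0 ?twist_monic.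
set c := (h * t + 6 * j * h * n)%N in IH.
have -> : (2 * h * t + 6 * j.+1 * (2 * h) * n = 3 * (h * n) + (3 * (h * n) + (c + (c +
   (h * n + (h * n + (h * n + (h * n + (h * n + h * n))))))))) %N by rewrite /c; lia.
apply: slc_bind (pre A F sA hA) _.
apply: slc_bind (pre B _ sB _) _; first by auto.
set F2 := setor (setor F _) _.
have hAp : sub (sgp h Ap) F2 by apply: sub_l; apply: sub_r; auto.
have hAm : sub (sgp h Am) F2 by apply: sub_l; apply: sub_r; auto.
have hBp : sub (sgp h Bp) F2 by apply: sub_r; auto.
have hBm : sub (sgp h Bm) F2 by apply: sub_r; auto.
pose Cp := rmodp (Ap * Bp) ('X^h - g%:P); pose Cm := rmodp (Am * Bm) ('X^h - (- g)%:P).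
apply: (slc_bind (IH e' Ap Bp F2 (dvdn_mull _ (dvdnn _)) dM' (sp _ _) (sp _ _) hAp hBp)).
have dN : (h %| e' + 2 * M)%N by rewrite dvdn_add // dvdn_mull.
apply: (slc_bind (IH (e' + 2 * M)%N Am Bm _ dN dM' (sp _ _) (sp _ _) _ _)); auto.
rewrite -Ng -/g -/Cp -/Cm; set F3 := setor (setor F2 _) _.
have hCp : sub (sgp h Cp) F3 by apply: sub_l; apply: sub_r; auto.
have hCm : sub (sgp h Cm) F3 by apply: sub_r; auto.
apply: (slc_bind (slc_sgpD hCp hCm)).
apply: (slc_bind (slc_sgpB (sub_l _ hCp) (sub_l _ hCm))).
set F5 := setor (setor F3 _) _.
have hE : sub (sgp h (Cp + Cm)) F5 by apply: sub_l; apply: sub_r; auto.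
have hD : sub (sgp h (Cp - Cm)) F5 by apply: sub_r; auto.
apply: (slc_bind (slc_sgpH hE)); apply: (slc_bind (slc_sgpH (sub_l _ hD))).
apply: (slc_bind (slc_sgpW gV (sub_r _ (@sub_refl _ _ _ _)))).
apply: slc_done; set T := rmodp _ _.
have eT : T = rmodp (A * B) ('X^(2 * h) - (g ^+ 2)%:P) by rewrite /T eg.
have e1 : Cp = take_poly h T + g *: drop_poly h T.
  by rewrite eT -twist_half // /Cp /Ap /Bp -twist_mul.
have e2' : Cm = take_poly h T - g *: drop_poly h T.
  by rewrite -scaleNr eT -(sqrrN g) -twist_half // /Cm /Am /Bm -twist_mul.
have e3 : take_poly h T = h2 *: (Cp + Cm).
  rewrite e1 e2' addrACA subrr addr0 -mulr2n -scaler_nat scalerA mulrC.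
  by rewrite (_ : 2 * h2 = 1) ?scale1r // mulrC.
have e4 : drop_poly h T = w ^+ gV *: (h2 *: (Cp - Cm)).
  rewrite e1 e2'.
  have -> : take_poly h T + g *: drop_poly h T - (take_poly h T - g *: drop_poly h T) =
    (g *: drop_poly h T) *+ 2 by ring.
  rewrite -scaler_nat !scalerA.
  have -> : w ^+ gV * h2 * 2%:R * g = (h2 * 2) * (w ^+ gV * g) by ring.
  by rewrite h2K gK mulr1 scale1r.
apply: sub_bigor => i lt; have [lti|lei] := ltnP i h.
  have -> : T`_i = (take_poly h T)`_i by rewrite coef_take_poly lti.
  rewrite e3; apply: sub_l; apply: sub_l; apply: sub_r.
  exact: sub_bigor_in lti (@sub_refl _ _ _ _).
have -> : T`_i = (drop_poly h T)`_(i - h) by rewrite coef_drop_poly subnK.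
by rewrite e4; apply: sub_r; apply: sub_bigor_in (@sub_refl _ _ _ _); lia.
Qed.

End NegacyclicFFT.

(** * The Schonhage-Strassen recursion *)

Section PolyMul.
Import Pdiv.CommonRing Pdiv.RingMonic.
Variables (K : fieldType) (R : comNzRingType) (cst : {rmorphism K -> R}).
Hypothesis two0 : (2 : K) != 0.
Notation slc := (slc cst).
Notation sub := (sub cst).
Implicit Types (P Q : {poly R}) (U V : {poly {poly R}}).

Lemma rmodp_XnD1 N P : (0 < N)%N -> (size P <= 2 * N)%N ->
  rmodp P ('X^N + 1) = take_poly N P - drop_poly N P.
Proof.
move=> N0 sP; have mX := monicXnaddC (1 : R) N0.
rewrite -{1}[P](poly_take_drop N).
have -> : take_poly N P + drop_poly N P * 'X^N =
   drop_poly N P * ('X^N + 1%:P) + (take_poly N P - drop_poly N P) by rewrite polyC1; ring.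
rewrite -polyC1 rmodp_addl_mul_small // size_XnaddC // ltnS.
apply: leq_trans (size_polyD _ _) _; rewrite geq_max size_take_poly size_polyN /=.
by rewrite size_drop_poly leq_subLR addnn -mul2n.
Qed.

Lemma coef_block M U i : (0 < M)%N -> (forall j, (size (U`_j)%R <= M)%N) ->
  (U.['X^M])`_i = U`_(i %/ M)`_(i %% M).
Proof.
move=> M0 sU; rewrite horner_coef coef_sum.
have E j : (U`_j * 'X^M ^+ j)`_i = if j == (i %/ M)%N then U`_j`_(i %% M) else 0.
  rewrite -exprM coefMXn; case: eqP => [->|/eqP ne].
    rewrite ltnNge mulnC leq_trunc_div /=; congr (_`__).
    by rewrite {1}(divn_eq i M) mulnC addKn.
  case: ltnP => // le; rewrite nth_default // (leq_trans (sU j)) //.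
  rewrite leq_subRL //; have : (j <= i %/ M)%N by rewrite leq_divRL // mulnC.
  rewrite leq_eqVlt (negPf ne) /= => lt.
  by rewrite addnC -mulnS mulnC -leq_divRL.
have [lt|ge] := ltnP (i %/ M) (size U).
  by rewrite (bigD1 (Ordinal lt)) //= E eqxx big1 ?addr0 // => j /negPf; rewrite E -val_eqE /= => ->.
rewrite big1 ?[U`_(_ %/ _)]nth_default ?coef0 // => j _; rewrite E.
by case: eqP => // e; have := ltn_ord j; rewrite e ltnNge ge.
Qed.

Definition blocks M L P : {poly {poly R}} := \poly_(j < L) take_poly M (drop_poly (M * j) P).

Lemma size_blocks M L P j : (size ((blocks M L P)`_j)%R <= M)%N.
Proof. by rewrite coef_poly; case: ifP; rewrite ?size_poly0 ?size_take_poly. Qed.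

Lemma coef_blocks M L P j i : (size P <= L * M)%N -> (i < M)%N ->
  (blocks M L P)`_j`_i = P`_(i + M * j).
Proof.
move=> sP lt; rewrite coef_poly; case: ltnP => [ltj|gej].
  by rewrite coef_take_poly lt coef_drop_poly.
rewrite coef0 nth_default //; apply: leq_trans sP _; rewrite mulnC.
by apply: leq_trans (leq_addl _ _); rewrite leq_mul2l gej orbT.
Qed.

Lemma horner_blocks M L P : (0 < M)%N -> (size P <= L * M)%N -> (blocks M L P).['X^M] = P.
Proof.
move=> M0 sP; apply/polyP => i; rewrite coef_block //; last exact: size_blocks.
by rewrite coef_blocks ?ltn_mod // addnC mulnC -divn_eq.
Qed.

Lemma slc_naive_mul n m P Q F : (size P <= n)%N -> (size Q <= n)%N ->
    sub (cf n P) F -> sub (cf n Q) F -> slc F (m * (2 * m)) (cf m (P * Q)).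
Proof.
move=> sP sQ hP hQ; apply: slc_coefs => i lt; rewrite coefM.
apply: (@slc_le _ _ _ _ (2 * i.+1)); last by rewrite leq_mul2l.
apply: (slc_dot (u := fun j => P`_j) (v := fun j => Q`_(i - j))) => j _.
  exact: known_coef hP sP.
exact: known_coef hQ sQ.
Qed.

Let h2 := cst 2^-1.
Let h2K : h2 * 2 = 1.
Proof. have -> : (2 : R) = cst 2 by rewrite rmorph_nat.
by rewrite /h2 -rmorphM mulVf // rmorph1. Qed.

Section Step.
Variables (M L : nat).
Hypotheses (M0 : (0 < M)%N) (L0 : (0 < L)%N).

Definition negX : {poly R} := 'X^(2 * M) + 1.

Let M20 : (0 < 2 * M)%N. Proof. by rewrite muln_gt0. Qed.
Lemma negX_monic : negX \is monic.
Proof. by rewrite /negX -polyC1 monicXnaddC. Qed.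
Lemma negX_size : size negX = (2 * M).+1.
Proof. by rewrite /negX -polyC1 size_XnaddC. Qed.

Lemma mk_negX : mk_monic negX = negX.
Proof. by rewrite /mk_monic negX_size negX_monic andbT ltnS M20. Qed.

Notation S := {poly %/ negX}.
Definition sgn (a : S) : R -> Prop := cf (2 * M) (val a).

Lemma in_negXE P : val (in_qpoly negX P) = rmodp P negX.
Proof. by rewrite /= mk_negX. Qed.

Lemma in_negX_small P : (size P <= 2 * M)%N -> val (in_qpoly negX P) = P.
Proof. by move=> sP; rewrite in_negXE rmodp_small // negX_size ltnS. Qed.

Lemma val_negXM (a b : S) : val (a * b) = rmodp (val a * val b) negX.
Proof. by rewrite -in_negXE. Qed.

Lemma size_negX (a : S) : (size (val a) <= 2 * M)%N.
Proof. by rewrite -ltnS; apply: leq_trans (size_mk_monic a) _; rewrite mk_negX negX_size. Qed.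

Lemma in_negX_zmod : zmod_morphism (in_qpoly negX).
Proof.
move=> P Q; apply: val_inj; rewrite raddfB /= mk_negX.
by [].
Qed.

Lemma in_negX_monoid : monoid_morphism (in_qpoly negX).
Proof.
split; first by rewrite in_qpoly1.
move=> P Q; apply: val_inj; rewrite val_negXM !in_negXE.
by rewrite [RHS]rmodp_mulmr ?negX_monic // [rmodp P _ * Q]mulrC rmodp_mulmr ?negX_monic // [Q * P]mulrC.
Qed.

HB.instance Definition _ := GRing.isZmodMorphism.Build {poly R} S (in_qpoly negX) in_negX_zmod.
HB.instance Definition _ := GRing.isMonoidMorphism.Build {poly R} S (in_qpoly negX) in_negX_monoid.

Notation w := (in_qpoly negX 'X : S).

Lemma wM : w ^+ (2 * M) = -1.
Proof.
rewrite -rmorphXn; apply/eqP; rewrite -addr_eq0 -(rmorph1 (in_qpoly negX)) -rmorphD.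
apply/eqP/val_inj; rewrite in_negXE /= -/negX rmodpp ?negX_monic //.
Qed.

(** Multiplication by [X] modulo [X^(2M) + 1] rotates the coefficients with a change of sign. The
    opposite is written as a difference because that is an operation of the model. *)
Lemma w_coef e (a : S) i : (i < 2 * M)%N -> exists2 j, (j < 2 * M)%N &
  (val (w ^+ e * a))`_i = (val a)`_j \/ (val (w ^+ e * a))`_i = 0 - (val a)`_j.
Proof.
elim: e i => [|e IH] i lt; first by exists i => //; rewrite expr0 mul1r; left.
set b := w ^+ e * a in IH.
have eb : val (w ^+ e.+1 * a) = 'X * val b - (val b)`_(2 * M).-1 *: negX.
  rewrite exprS -mulrA -/b.
  have -> : w * b = in_qpoly negX ('X * val b).
    rewrite rmorphM; congr (_ * _); apply: val_inj.
    exact/esym/in_negX_small/size_negX.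
  rewrite in_negXE; set c := _`_ _.
  rewrite [X in rmodp X _](_ : _ = c%:P * negX + ('X * val b - c *: negX)); last first.
    by rewrite -mul_polyC addrC subrK.
  rewrite rmodp_addl_mul_small ?negX_monic // negX_size ltnS.
  apply/leq_sizeP => j; rewrite leq_eqVlt => /orP [/eqP <-|ltj].
    rewrite coefB coefXM coefZ /negX coefD coefXn coef1 eqxx eqn0Ngt M20 /=.
    by rewrite addr0 mulr1 subrr.
  rewrite coefB coefXM coefZ /negX coefD coefXn coef1 (gtn_eqF ltj) (gtn_eqF (leq_trans M20 (ltnW ltj))).
  rewrite addr0 mulr0 subr0 nth_default // (leq_trans (size_negX b)) //.
  by rewrite -ltnS prednK ?(leq_trans _ ltj).
have ei : (val (w ^+ e.+1 * a))`_i = if i == 0 then 0 - (val b)`_(2 * M).-1 else (val b)`_i.-1.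
  rewrite eb coefB coefXM coefZ /negX coefD coefXn coef1 (ltn_eqF lt) add0r.
  by case: (i == 0)%N; rewrite ?mulr1 ?mulr0 ?subr0.
have [|j ltj ej] := IH (if i == 0 then (2 * M).-1 else i.-1)%N.
  by case: ifP => _; [rewrite prednK | apply: leq_ltn_trans (leq_pred i) lt].
exists j => //; rewrite ei; case: ifP ej => _ // [] ->; [by right | left].
by rewrite !sub0r opprK.
Qed.

Section MulStep.
Variables (t : nat).
Hypothesis slc_mulS : forall P Q F, (size P <= 2 * M)%N -> (size Q <= 2 * M)%N ->
  sub (cf (2 * M) P) F -> sub (cf (2 * M) Q) F -> slc F t (cf (2 * M) (rmodp (P * Q) negX)).

Lemma slc_S_add F (a b : S) : sub (sgn a) F -> sub (sgn b) F -> slc F (2 * M) (sgn (a + b)).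
Proof. exact: slc_polyD. Qed.

Lemma slc_S_opp F (a b : S) : sub (sgn a) F -> sub (sgn b) F -> slc F (2 * M) (sgn (a - b)).
Proof. exact: slc_polyB. Qed.

Lemma slc_S_shift F e (a : S) : sub (sgn a) F -> slc F (2 * M) (sgn (w ^+ e * a)).
Proof.
move=> ha; rewrite -[X in slc _ X _]muln1; apply: slc_coefs => i lt.
have [j ltj [->|->]] := w_coef e a lt; have hj := known_cf ha ltj.
  by apply: slc_done; apply: known_eq hj.
by apply: slc_opp => //; right; exists 0; rewrite rmorph0.
Qed.

Lemma slc_S_half F (a : S) : sub (sgn a) F -> slc F (2 * M) (sgn (in_qpoly negX h2%:P * a)).
Proof.
move=> ha; have -> : in_qpoly negX h2%:P * a = h2 *: a.
  apply: val_inj; rewrite val_negXM in_negX_small ?mul_polyC; last first.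
    by rewrite (leq_trans (size_polyC_leq1 _)).
  rewrite /= rmodp_small // negX_size ltnS.
  by apply: leq_trans (size_scale_leq _ _) (size_negX a).
by apply: slc_polyZ => //; apply: known_cst.
Qed.

Lemma slc_S_mul F (a b : S) : sub (sgn a) F -> sub (sgn b) F -> slc F t (sgn (a * b)).
Proof. by rewrite /sgn val_negXM => ha hb; apply: slc_mulS => //; apply: size_negX. Qed.

(** The factors are cut into [L] blocks of size [M] and seen as polynomials in [Y = X^M]. The
    coefficients of their product in [Y] have size at most [2 M], so they can be read modulo
    [X^(2M) + 1], where [X] is a root of unity of the order that the transform modulo [Y^L + 1]
    requires. *)
Lemma slc_mul_step j P Q F : L = (2 ^ j)%N -> (L %| 2 * M)%N ->
    (size P <= L * M)%N -> (size Q <= L * M)%N ->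
    sub (cf (L * M) P) F -> sub (cf (L * M) Q) F ->
  slc F (L * t + 6 * j * L * (2 * M) + 3 * (L * M)) (cf (L * M) (rmodp (P * Q) ('X^(L * M) + 1))).
Proof.
move=> eL dL sP sQ hP hQ; pose A := blocks M L P; pose B := blocks M L Q.
have hb (X : {poly R}) : (size X <= L * M)%N -> sub (cf (L * M) X) F -> sub (sgp sgn L (map_poly (in_qpoly negX) (blocks M L X))) F.
  move=> sX hX; apply: sub_bigor => i lt; rewrite coef_map /sgn in_negX_small; last first.
    by rewrite (leq_trans (size_blocks _ _ _ _)) // mul2n -addnn leq_addl.
  apply: sub_cf => i' _; have [lt'|ge] := ltnP i' M.
    by rewrite coef_blocks //; apply: known_coef hX sX.
  by rewrite nth_default ?(leq_trans (size_blocks _ _ _ _)) //; right; exists 0; rewrite rmorph0.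
have sA (X : {poly R}) : (size (map_poly (in_qpoly negX) (blocks M L X)) <= L)%N.
  by apply: leq_trans (size_poly _ _) (size_poly _ _).
have h2S : (in_qpoly negX h2%:P : S) * 2 = 1.
  have -> : (2 : S) = in_qpoly negX 2%:P by rewrite !rmorph_nat.
  by rewrite -rmorphM -polyCM h2K !rmorph1.
have := @fft_mul K R cst S sgn (2 * M) t M w (in_qpoly negX h2%:P) slc_S_add slc_S_opp
  slc_S_shift slc_S_half slc_S_mul M0 h2S wM j (2 * M) (map_poly (in_qpoly negX) A) (map_poly (in_qpoly negX) B) F.
rewrite -eL => /(_ dL dL (sA P) (sA Q) (hb P sP hP) (hb Q sQ hQ)).
set C := rmodp _ _ => sC.
pose C' := take_poly L (A * B) - drop_poly L (A * B).
have sAB : (size (A * B)%R <= 2 * L)%N.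
  apply: leq_trans (size_polyMleq _ _) _; apply: leq_trans (leq_pred _) _.
  by rewrite mul2n -addnn leq_add // size_poly.
have eAB : A * B = drop_poly L (A * B) * ('X^L + 1) + C'.
  by rewrite -{1}[A * B](poly_take_drop L) /C'; ring.
have sC' : (size C' <= L)%N.
  apply: leq_trans (size_polyD _ _) _; rewrite geq_max size_take_poly size_polyN /=.
  by rewrite size_drop_poly leq_subLR addnn -mul2n.
have eC : C = map_poly (in_qpoly negX) C'.
  rewrite /C -rmorphM eAB rmorphD rmorphM rmorphD /= map_polyXn rmorph1 wM polyCN opprK polyC1.
  rewrite -polyC1 rmodp_addl_mul_small ?monicXnaddC // size_XnaddC // ltnS.
  exact: leq_trans (size_poly _ _) sC'.
have sABi i : (size (((A * B)%R)`_i)%R <= 2 * M)%N.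
  rewrite coefM; apply: leq_trans (size_sum _ _ _) _; apply/bigmax_leqP => l _.
  apply: leq_trans (size_polyMleq _ _) _; apply: leq_trans (leq_pred _) _.
  by rewrite mul2n -addnn leq_add // size_blocks.
have sCi i : (size (C'`_i)%R <= 2 * M)%N.
  rewrite coefB coef_take_poly coef_drop_poly; apply: leq_trans (size_polyD _ _) _.
  by rewrite geq_max size_polyN sABi andbT; case: ifP => _; rewrite ?sABi ?size_poly0.
have eCi i : val (C`_i) = C'`_i by rewrite eC coef_map in_negX_small.
pose V := C'.['X^M].
have ePQ : rmodp (P * Q) ('X^(L * M) + 1) = rmodp V ('X^(L * M) + 1).
  rewrite -{1}(horner_blocks M0 sP) -{1}(horner_blocks M0 sQ) -hornerM eAB hornerD hornerM -/V.
  rewrite !hornerE -exprM [(M * L)%N]mulnC rmodpD -?polyC1 ?monicXnaddC ?muln_gt0 ?L0 //.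
  by rewrite rmodp_mull ?monicXnaddC ?muln_gt0 ?L0 // add0r.
pose T : {poly {poly R}} := map_poly (take_poly M) C'.
pose D : {poly {poly R}} := map_poly (drop_poly M) C'.
have cT i : T`_i = take_poly M C'`_i by rewrite coef_map_id0 ?take_poly0r.
have cD i : D`_i = drop_poly M C'`_i by rewrite coef_map_id0 ?drop_poly0r.
have eV : V = T.['X^M] + (D * 'X).['X^M].
  rewrite /V; have -> : C' = T + ('X^M)%:P * D.
    apply/polyP => i; rewrite coefD coefCM cT cD mulrC.
    exact/esym/poly_take_drop.
  by rewrite hornerD !hornerM hornerC hornerX mulrC.
have sT i : (size (T`_i)%R <= M)%N by rewrite cT size_take_poly.
have sD i : (size (D`_i)%R <= M)%N.
  by rewrite cD size_drop_poly leq_subLR addnn -mul2n.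
have sDX i : (size (((D * 'X)%R)`_i)%R <= M)%N by rewrite coefMX; case: ifP; rewrite ?size_poly0.
have cV i : V`_i = T`_(i %/ M)`_(i %% M) + (D * 'X)`_(i %/ M)`_(i %% M).
  by rewrite eV coefD !coef_block.
have sV : (size V <= 2 * (L * M))%N.
  apply/leq_sizeP => i le; rewrite cV.
  have le' : (2 * L <= i %/ M)%N by rewrite leq_divRL // -mulnA.
  have le2 : (L <= i %/ M)%N by apply: leq_trans le'; rewrite mul2n -addnn leq_addl.
  rewrite cT [C'`_(i %/ M)]nth_default ?(leq_trans sC') // take_poly0r coef0 add0r.
  rewrite coefMX; case: eqP => [_|]; rewrite ?coef0 // => ne; rewrite cD [C'`_(_).-1]nth_default ?drop_poly0r ?coef0 //.
  apply: leq_trans sC' _; rewrite -ltnS prednK; last by rewrite lt0n; apply/eqP.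
  by apply: leq_trans le'; rewrite mul2n -addnn -addn1 leq_add.
rewrite ePQ rmodp_XnD1 ?muln_gt0 ?L0 //.
have -> : (3 * (L * M) = 2 * (L * M) + L * M)%N by rewrite mulSn addnC.
apply: slc_bind sC _; set F1 := setor F _.
have hC i : sub (cf (2 * M) (C'`_i)%R) F1.
  have [lt|ge] := ltnP i L; last first.
    by rewrite nth_default ?(leq_trans sC') //; apply: sub_cf => l _; rewrite coef0; right; exists 0; rewrite rmorph0.
  by rewrite -eCi; apply: sub_r; apply: sub_bigor_in lt (@sub_refl _ _ _ _).
apply: (@slc_bind _ _ _ _ _ (cf (2 * (L * M)) V)).
  rewrite -[X in slc _ X _]muln1; apply: slc_coefs => i _; rewrite cV; apply: slc_add.
    rewrite cT coef_take_poly ltn_mod M0; exact: known_coef (hC _) (sCi _).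
  rewrite coefMX; case: eqP => _; first by rewrite coef0; right; exists 0; rewrite rmorph0.
  by rewrite cD coef_drop_poly; apply: known_coef (hC _) (sCi _).
have hV : sub (cf (2 * (L * M)) V) (setor F1 (cf (2 * (L * M)) V)) by auto.
rewrite -[X in slc _ X _]muln1; apply: slc_coefs => i lt; rewrite coefB.
apply: slc_opp; last by rewrite coef_drop_poly; apply: known_coef hV sV.
by rewrite coef_take_poly lt; apply: known_coef hV sV.
Qed.

End MulStep.
End Step.

(* [2 ^ k * ss_rate (k - 3)] bounds the number of operations of a product
   modulo [X^(2^k) + 1]; the offset 3 turns the recursive call from [k] to
   [uphalf k + 1] into the halving of [k - 3]. *)
Definition ss_rate j := (27 * j * (trunc_log 2 j).+1 + 130 * j + 65 * (j == 0))%N.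

Lemma ss_rate_half j : (0 < j)%N -> (2 * ss_rate j./2 + 27 * j <= ss_rate j)%N.
Proof.
rewrite /ss_rate; case: j => // -[|j] _; first by rewrite /= trunc_log1 trunc_log0.
set i := j.+2; rewrite (trunc_log2S (isT : 1 < j.+2)%N) -/i.
have -> : (i./2 == 0)%N = false by [].
have h : (2 * i./2 <= i)%N by rewrite mul2n -[X in (_ <= X)%N]odd_double_half leq_addl.
move: (trunc_log 2 i./2) => l; rewrite !muln0 !addn0.
have := leq_mul h (leqnn l.+1); have := leq_mul h (leqnn 1).
move: (i./2) h => i2 h; nia.
Qed.

Lemma slc_negacyclic k P Q F : (size P <= 2 ^ k)%N -> (size Q <= 2 ^ k)%N ->
    sub (cf (2 ^ k) P) F -> sub (cf (2 ^ k) Q) F ->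
  slc F (2 ^ k * ss_rate (k - 3)) (cf (2 ^ k) (rmodp (P * Q) ('X^(2 ^ k) + 1))).
Proof.
elim/ltn_ind: k P Q F => k IH P Q F sP sQ hP hQ.
have N0 : (0 < 2 ^ k)%N by rewrite expn_gt0.
have [k3|k3] := leqP k 3.
  have -> : (k - 3 = 0)%N by apply/eqP; rewrite subn_eq0.
  have sPQ : (size (P * Q)%R <= 2 * 2 ^ k)%N.
    by apply: leq_trans (size_polyMleq _ _) _; apply: leq_trans (leq_pred _) _; rewrite mul2n -addnn leq_add.
  rewrite rmodp_XnD1 //; set PQ := P * Q in sPQ *.
  apply: (@slc_le _ _ _ _ (2 * 2 ^ k * (2 * (2 * 2 ^ k)) + 2 ^ k)).
    apply: slc_bind (slc_naive_mul (2 * 2 ^ k) sP sQ hP hQ) _.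
    set F1 := setor F _; have h : sub (cf (2 * 2 ^ k) PQ) F1 by apply: sub_r.
    rewrite -[X in slc _ X _]muln1; apply: slc_coefs => i lt; rewrite coefB coef_take_poly lt coef_drop_poly.
    by apply: slc_opp; apply: known_coef h sPQ.
  have : (2 ^ k <= 2 ^ 3)%N by rewrite leq_exp2l.
  by rewrite /ss_rate /=; move: (2 ^ k)%N => N; nia.
(* About [sqrt N] blocks of size about [sqrt N]. The recursive products have exponent [hi + 1],
   which is smaller than [k] only when [k > 3]; hence the naive base case. *)
pose hi := uphalf k; pose lo := k./2.
have ek : (k = lo + hi)%N by rewrite /hi /lo uphalf_half addnCA addnn odd_double_half.
have hilo : (lo <= hi)%N by rewrite /hi uphalf_half leq_addl.
have hik : (hi.+1 < k)%N.
  by move: k3 ek hilo; clear; rewrite /hi uphalf_half -/lo; case: (odd k); lia.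
have M0 : (0 < 2 ^ hi)%N by rewrite expn_gt0.
have L0 : (0 < 2 ^ lo)%N by rewrite expn_gt0.
have eN : (2 ^ lo * 2 ^ hi = 2 ^ k)%N by rewrite -expnD -ek.
have e2M : (2 * 2 ^ hi = 2 ^ hi.+1)%N by rewrite expnS.
have mulS P' Q' F' : (size P' <= 2 * 2 ^ hi)%N -> (size Q' <= 2 * 2 ^ hi)%N ->
    sub (cf (2 * 2 ^ hi) P') F' -> sub (cf (2 * 2 ^ hi) Q') F' ->
  slc F' (2 ^ hi.+1 * ss_rate (hi.+1 - 3)) (cf (2 * 2 ^ hi) (rmodp (P' * Q') (negX (2 ^ hi)))).
  by rewrite /negX e2M; apply: IH.
have dL : (2 ^ lo %| 2 * 2 ^ hi)%N by rewrite e2M dvdn_exp2l // leqW.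
have := slc_mul_step M0 L0 mulS erefl dL (P := P) (Q := Q) (F := F).
rewrite eN => /(_ sP sQ hP hQ) h; apply: slc_le h _.
have half_sub3 k' : (3 < k')%N -> ((uphalf k').+1 - 3 = (k' - 3)./2)%N.
  by case: k' => [|[|[|[|k']]]] //= _; rewrite !subSS !subn0 uphalf_half.
rewrite [(hi.+1 - 3)%N](half_sub3 _ k3).
have := @ss_rate_half (k - 3); rewrite subn_gt0 => /(_ k3).
move: (ss_rate _) (ss_rate _) => r2 r1 hr.
have -> : (2 ^ lo * (2 ^ hi.+1 * r1) = 2 ^ k * (2 * r1))%N by rewrite -e2M -eN; ring.
have -> : (6 * lo * 2 ^ lo * (2 * 2 ^ hi) = 2 ^ k * (12 * lo))%N by rewrite -eN; ring.
rewrite [(3 * _)%N]mulnC -!mulnDr leq_mul2l; apply/orP; right.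
apply: leq_trans hr; rewrite -addnA leq_add2l.
by move: k3 ek hilo; clear; lia.
Qed.

Definition mul_cost k := (2 ^ k * ss_rate (k - 3))%N.

Lemma slc_poly_mul k P Q F : (size P <= 2 ^ k)%N -> (size Q <= 2 ^ k)%N ->
    (size (P * Q)%R <= 2 ^ k)%N ->
    sub (cf (2 ^ k) P) F -> sub (cf (2 ^ k) Q) F ->
  slc F (mul_cost k) (cf (2 ^ k) (P * Q)).
Proof.
move=> sP sQ sPQ hP hQ; have := slc_negacyclic sP sQ hP hQ.
by rewrite rmodp_small // -polyC1 size_XnaddC ?expn_gt0 // ltnS.
Qed.

End PolyMul.

(** * Multipoint evaluation and fast summation of fractions *)

Section ProductTrees.
Variables (K : fieldType) (R : comNzRingType) (cst : {rmorphism K -> R}).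
Hypothesis two0 : (2 : K) != 0.
Notation slc := (slc cst).
Notation sub := (sub cst).
Notation known := (known cst).
Notation up p := (map_poly cst p).

Section Evaluation.
Variable xi : nat -> K.

Definition node o n : {poly K} := \prod_(i < n) ('X - (xi (o + i))%:P).

Lemma node_monic o n : node o n \is monic.
Proof. exact: monic_prod_XsubC. Qed.

Lemma size_node o n : size (node o n) = n.+1.
Proof. by rewrite size_prod_XsubC /index_enum -enumT size_enum_ord. Qed.

Lemma root_node o n i : (i < n)%N -> (node o n).[xi (o + i)] = 0.
Proof.
move=> lt; rewrite horner_prod (bigD1 (Ordinal lt)) //= hornerXsubC subrr.
exact: mul0r.
Qed.

(* The quotient of [f] by a monic [m] of degree [h] is linear in [f], whence
   the exactness of its computation from the quotient of [X^(2h)] by [m]. *)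
Lemma size_barrett h (m : {poly K}) (f : {poly R}) : m \is monic -> size m = h.+1 ->
    (size f <= 2 * h)%N ->
  (size (f - drop_poly h (drop_poly h f * up ('X^(2 * h) %/ m)) * up m)%R <= h)%N.
Proof.
move=> mon_m sm sf; set f1 := drop_poly h f; set I := up (_ %/ _); set q := drop_poly h _.
have sf1 : (size f1 <= h)%N by rewrite size_drop_poly leq_subLR addnn -mul2n.
pose rho := up ('X^(2 * h) %% m).
have srho : (size rho <= h)%N.
  by apply: leq_trans (size_poly _ _) _; rewrite -ltnS -sm ltn_modp monic_neq0.
have eX : 'X^(2 * h) = I * up m + rho.
  by rewrite -rmorphM -rmorphD -divp_eq rmorphXn /= map_polyX.
have e : (f - q * up m) * 'X^h =
    f1 * rho + take_poly h f * 'X^h + take_poly h (f1 * I) * up m.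
  have -> : q * up m = up m * q by rewrite mulrC.
  have e1 : f1 * rho = f1 * 'X^(2 * h) - f1 * I * up m by rewrite eX; ring.
  have e2 : f1 * I = take_poly h (f1 * I) + q * 'X^h by rewrite poly_take_drop.
  have e3 : f = take_poly h f + f1 * 'X^h by rewrite poly_take_drop.
  rewrite e1 {1}e3 [in f1 * I * _]e2 mulnC exprM; ring.
have [->|nz] := eqVneq (f - q * up m) 0; first by rewrite size_poly0.
have : (size ((f - q * up m) * 'X^h)%R <= 2 * h)%N.
  rewrite e; apply: leq_trans (size_polyD _ _) _; rewrite geq_max; apply/andP; split.
    apply: leq_trans (size_polyD _ _) _; rewrite geq_max; apply/andP; split.
      apply: leq_trans (size_polyMleq _ _) _; apply: leq_trans (leq_pred _) _.
      by rewrite mul2n -addnn leq_add.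
    apply: leq_trans (size_polyMleq _ _) _; rewrite size_polyXn addnS /=.
    by rewrite mul2n -addnn leq_add // size_take_poly.
  apply: leq_trans (size_polyMleq _ _) _.
  have sum : (size (up m) <= h.+1)%N by rewrite -sm size_poly.
  apply: (@leq_trans (h + h.+1).-1); last by rewrite addnS mul2n -addnn.
  by rewrite -!subn1 leq_sub2r // leq_add // size_take_poly.
by rewrite size_mulXn // mul2n -addnn leq_add2l.
Qed.

Fixpoint eval_cost j :=
  if j is j'.+1 then (2 * (eval_cost j' + 2 * mul_cost j + 2 ^ j'))%N else 0%N.

(** The values on one half of the points are those of the remainder of [f] modulo their node
    polynomial. A remainder takes two products, since the node and the quotient that inverts it are
    constants. *)
Lemma slc_eval j o (f : {poly R}) F : (size f <= 2 ^ j)%N -> sub (cf (2 ^ j) f) F ->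
  slc F (eval_cost j) (bigor (2 ^ j) (fun i => eq f.[cst (xi (o + i))])).
Proof.
elim: j o f F => [|j IH] o f F sf hf.
  apply: slc_done => _ [i _ <-]; rewrite (size1_polyC sf) hornerC.
  exact: known_cf hf _.
set h := (2 ^ j)%N; have e2 : (2 ^ j.+1 = 2 * h)%N by rewrite expnS.
have half o' : slc F (eval_cost j + 2 * mul_cost j.+1 + h)
    (bigor h (fun i => eq f.[cst (xi (o' + i))])).
  pose m := node o' h; have sm : size m = h.+1 by rewrite size_node.
  pose f1 := drop_poly h f; pose I : {poly K} := 'X^(2 * h) %/ m.
  pose q := drop_poly h (f1 * up I); pose r := f - q * up m.
  have sr : (size r <= h)%N by apply: size_barrett; rewrite ?node_monic -?e2.
  have sf1 : (size f1 <= h)%N by rewrite size_drop_poly leq_subLR addnn -mul2n -e2.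
  have sI : (size I <= h.+1)%N.
    rewrite size_divp ?monic_neq0 ?node_monic // size_polyXn sm /=; lia.
  have h0 : (0 < h)%N by rewrite expn_gt0.
  have sM (a b : {poly R}) : (size a <= h)%N -> (size b <= h.+1)%N -> (size (a * b)%R <= 2 * h)%N.
    move=> sa sb; apply: leq_trans (size_polyMleq _ _) _.
    by apply: (@leq_trans (h + h.+1).-1); [rewrite -!subn1 leq_sub2r // leq_add | lia].
  have s1 : (size (f1 * up I)%R <= 2 * h)%N by apply: sM => //; apply: leq_trans (size_poly _ _) sI.
  have sq : (size q <= h)%N by rewrite size_drop_poly leq_subLR addnn -mul2n.
  have s2 : (size (q * up m)%R <= 2 * h)%N by apply: sM => //; rewrite -sm size_poly.
  have -> : (eval_cost j + 2 * mul_cost j.+1 + h = mul_cost j.+1 + (mul_cost j.+1 + (h + eval_cost j)))%N by lia.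
  have leh n : (n <= h.+1)%N -> (n <= 2 ^ j.+1)%N by rewrite e2; move: h0; clear; lia.
  have hf1 : sub (cf (2 ^ j.+1) f1) F.
    by apply: sub_cf => i _; rewrite coef_drop_poly; apply: known_coef hf sf.
  apply: (slc_bind (@slc_poly_mul _ _ cst two0 j.+1 f1 (up I) F _ _ _ hf1 (@sub_cf_cst _ _ _ _ _ _))).
  - by apply: leh; apply: leqW.
  - by apply: leh; apply: leq_trans (size_poly _ _) sI.
  - by rewrite e2.
  set F1 := setor F _.
  have hq : sub (cf (2 ^ j.+1) q) F1.
    apply: sub_cf => i _; rewrite coef_drop_poly.
    by apply: known_coef (sub_r _ (@sub_refl _ _ _ _)) _; rewrite e2.
  apply: (slc_bind (@slc_poly_mul _ _ cst two0 j.+1 q (up m) F1 _ _ _ hq (@sub_cf_cst _ _ _ _ _ _))).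
  - by apply: leh; apply: leqW.
  - by apply: leh; rewrite -sm size_poly.
  - by rewrite e2.
  set F2 := setor F1 _.
  apply: (@slc_bind _ _ _ _ _ (cf h r)).
    rewrite -[X in slc _ X _]muln1; apply: slc_coefs => i lt; rewrite coefB.
    apply: slc_opp; first by apply: (known_sub _ (known_coef i hf sf)); apply: sub_l; apply: sub_l; apply: sub_refl.
    by apply: (@known_coef _ _ _ _ (2 ^ j.+1)); [apply: sub_r; apply: sub_refl | rewrite e2].
  have e i : (i < h)%N -> f.[cst (xi (o' + i))] = r.[cst (xi (o' + i))].
    move=> lt; rewrite /r !hornerE [(up m).[_]]horner_map [m.[_]]root_node //.
    by rewrite rmorph0 mulr0 subr0.
  have := IH o' r (setor F2 (cf h r)) sr (sub_r _ (@sub_refl _ _ _ _)).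
  move/slc_out; apply; apply: sub_bigor => i lt.
  by rewrite e //; apply: sub_bigor_in lt (@sub_refl _ _ _ _).
have -> : eval_cost j.+1 = ((eval_cost j + 2 * mul_cost j.+1 + h) + (eval_cost j + 2 * mul_cost j.+1 + h))%N.
  by rewrite /= mul2n addnn.
apply: slc_out (slc_or (half o) (half (o + h)%N)) _.
apply: sub_bigor => i; rewrite e2 => lt; have [lti|lei] := ltnP i h.
  by apply: sub_l; apply: sub_bigor_in lti (@sub_refl _ _ _ _).
apply: sub_r; have -> : (o + i = o + h + (i - h))%N by rewrite -addnA subnKC.
by apply: sub_bigor_in (@sub_refl _ _ _ _); rewrite ltn_subLR // addnn -mul2n.
Qed.

End Evaluation.

(** * Sums of simple fractions *)

Section Fractions.
Variable x : nat -> K.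

Definition revnode o n : {poly K} := \prod_(i < n) (1 - x (o + i) *: 'X).

Lemma size_revnode o n : (size (revnode o n) <= n.+1)%N.
Proof.
elim: n => [|n IH]; first by rewrite /revnode big_ord0 size_polyC_leq1.
rewrite /revnode big_ord_recr /=; apply: leq_trans (size_polyMleq _ _) _.
have s2 : (size (1 - x (o + n) *: 'X : {poly K})%R <= 2)%N.
  apply: leq_trans (size_polyD _ _) _; rewrite geq_max size_polyN size_poly1 /=.
  by apply: leq_trans (size_scale_leq _ _) _; rewrite size_polyX.
by apply: (@leq_trans (n.+1 + 2).-1); [rewrite -!subn1 leq_sub2r // leq_add | rewrite addn2].
Qed.

(** Numerator of the sum of the [a_i / (1 - x_i X)] over the common denominator [revnode]. *)
Definition fracnum (A : comNzRingType) (g : {rmorphism K -> A}) (a : nat -> A) o n : {poly A} :=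
  \sum_(i < n) a (o + i)%N *: map_poly g (\prod_(l < n | l != i) (1 - x (o + l) *: 'X)).

Lemma fracnum_cat (A : comNzRingType) (g : {rmorphism K -> A}) (a : nat -> A) o n m :
  fracnum g a o (n + m) = fracnum g a o n * map_poly g (revnode (o + n) m) +
    fracnum g a (o + n) m * map_poly g (revnode o n).
Proof.
rewrite /fracnum big_split_ord /= !mulr_suml; congr (_ + _); apply: eq_bigr => i _.
  rewrite -scalerAl -rmorphM; congr (_ *: map_poly g _).
  rewrite (bigID (fun l : 'I_(n + m) => (l < n)%N)) /=; congr (_ * _).
    rewrite (big_mkcond (fun l : 'I_(n + m) => _)) big_split_ord /= [X in _ * X]big1 ?mulr1; last first.
      by move=> l _; rewrite ltnNge leq_addr andbF.
    rewrite -big_mkcond /=; apply: eq_bigl => l; rewrite ltn_ord andbT.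
    by rewrite (inj_eq (@lshift_inj n m)).
  rewrite (big_mkcond (fun l : 'I_(n + m) => _)) big_split_ord /= [X in X * _]big1 ?mul1r; last first.
    by move=> l _; rewrite ltn_ord andbF.
  by apply: eq_bigr => l _; rewrite eq_rlshift ltnNge leq_addr /= addnA.
rewrite -addnA -scalerAl -rmorphM; congr (_ *: map_poly g _).
rewrite (bigID (fun l : 'I_(n + m) => (l < n)%N)) /= mulrC; congr (_ * _).
  rewrite (big_mkcond (fun l : 'I_(n + m) => _)) big_split_ord /= [X in X * _]big1 ?mul1r; last first.
    by move=> l _; rewrite ltn_ord andbF.
  rewrite -big_mkcond /=; apply: eq_big => l; last by rewrite addnA.
  by rewrite (inj_eq (@rshift_inj n m)) ltnNge leq_addr andbT.
rewrite (big_mkcond (fun l : 'I_(n + m) => _)) big_split_ord /= [X in _ * X]big1 ?mulr1; last first.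
  by move=> l _; rewrite ltnNge leq_addr andbF.
by apply: eq_bigr => l _; rewrite eq_lrshift ltn_ord.
Qed.

Lemma size_fracnum (A : comNzRingType) (g : {rmorphism K -> A}) (a : nat -> A) o n :
  (size (fracnum g a o n) <= n)%N.
Proof.
apply: leq_trans (size_sum _ _ _) _; apply/bigmax_leqP => i _.
apply: leq_trans (size_scale_leq _ _) _; apply: leq_trans (size_poly _ _) _.
apply: leq_trans (size_poly_prod_leq _ _) _.
rewrite leq_subLR; have sz l : (size (1 - x l *: 'X : {poly K})%R <= 2)%N.
  apply: leq_trans (size_polyD _ _) _; rewrite geq_max size_polyN size_poly1 /=.
  by apply: leq_trans (size_scale_leq _ _) _; rewrite size_polyX.
have -> : #|[pred l : 'I_n | l != i]| = n.-1 by rewrite cardC1 card_ord.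
apply: (@leq_ltn_trans (\sum_(l < n | l != i) 2)); first by apply: leq_sum => l _.
by rewrite sum_nat_const cardC1 card_ord; have := ltn_ord i; lia.
Qed.

Fixpoint fracnum_cost j :=
  if j is j'.+1 then (2 * fracnum_cost j' + 2 * mul_cost j + 2 ^ j)%N else 0%N.

Lemma slc_fracnum j o (a : nat -> R) F :
    (forall i, (i < 2 ^ j)%N -> known F (a (o + i)%N)) ->
  slc F (fracnum_cost j) (cf (2 ^ j) (fracnum cst a o (2 ^ j))).
Proof.
elim: j o F => [|j IH] o F ha.
  apply: slc_done; apply: sub_cf => -[|//] _.
  rewrite /fracnum big_ord1 big1 ?rmorph1 => [|l]; last by rewrite ord1.
  by rewrite coefZ coef1 mulr1; apply: ha.
set h := (2 ^ j)%N; have e2 : (2 ^ j.+1 = h + h)%N by rewrite expnS mul2n -addnn.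
have -> : fracnum_cost j.+1 = (fracnum_cost j + (fracnum_cost j + (mul_cost j.+1 + (mul_cost j.+1 + 2 ^ j.+1))))%N.
  by rewrite /=; lia.
have ha1 i : (i < h)%N -> known F (a (o + i)%N) by move=> lt; apply: ha; rewrite e2 ltn_addr.
apply: slc_bind (IH o F ha1) _; set F1 := setor F _.
apply: slc_bind (IH (o + h)%N F1 _) _.
  move=> i lt; apply: known_sub (sub_l _ (@sub_refl _ _ _ _)) _.
  by rewrite -addnA; apply: ha; rewrite e2 ltn_add2l.
set F2 := setor F1 _; have -> : fracnum cst a o (2 ^ j.+1) = fracnum cst a o (h + h) by rewrite -e2.
rewrite fracnum_cat -/h.
set N1 := fracnum _ _ o h; set N2 := fracnum _ _ (o + h) h.
have sN1 : (size N1 <= h)%N by apply: size_fracnum.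
have sN2 : (size N2 <= h)%N by apply: size_fracnum.
have h1 : sub (cf (2 ^ j.+1) N1) F2.
  apply: (@sub_cf_size _ _ _ _ h) => //; apply: sub_l; apply: sub_r; exact: sub_refl.
have h2 : sub (cf (2 ^ j.+1) N2) F2.
  apply: (@sub_cf_size _ _ _ _ h) => //; apply: sub_r; exact: sub_refl.
have h0 : (0 < h)%N by rewrite expn_gt0.
have sD o' : (size (up (revnode o' h)) <= h.+1)%N.
  by apply: leq_trans (size_poly _ _) (size_revnode _ _).
have sM (b c : {poly R}) : (size b <= h)%N -> (size c <= h.+1)%N -> (size (b * c)%R <= 2 ^ j.+1)%N.
  move=> sa sb; apply: leq_trans (size_polyMleq _ _) _.
  by rewrite e2; apply: (@leq_trans (h + h.+1).-1); [rewrite -!subn1 leq_sub2r // leq_add | rewrite addnS].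
have leh : (h.+1 <= 2 ^ j.+1)%N by rewrite e2 -addn1 leq_add2l.
have leh' : (h <= 2 ^ j.+1)%N by apply: ltnW.
have [l1 l2] : (size N1 <= 2 ^ j.+1)%N /\ (size N2 <= 2 ^ j.+1)%N.
  by split; apply: leq_trans leh'.
have lD o' := leq_trans (sD o') leh.
apply: slc_bind (slc_poly_mul two0 l1 (lD (o + h)%N) (sM _ _ sN1 (sD _)) h1 (@sub_cf_cst _ _ _ _ _ _)) _.
apply: slc_bind (slc_poly_mul two0 l2 (lD o) (sM _ _ sN2 (sD _)) (sub_l _ h2) (@sub_cf_cst _ _ _ _ _ _)) _.
apply: slc_polyD; last exact: sub_r (@sub_refl _ _ _ _).
by apply: sub_l; apply: sub_r; apply: sub_refl.
Qed.

End Fractions.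
End ProductTrees.

(** * Approximant bases *)

Section ApproximantBasis.
Variables (K : fieldType) (n : nat).
Hypothesis two0 : (2 : K) != 0.
Notation R := (fenv K n).
Notation cst := (@fenv_cst K n).
Notation known := (known cst).
Notation slc := (slc cst).
Notation sub := (sub cst).
Implicit Types (D : 'rV[K]_n -> Prop) (F G : R -> Prop) (e : 'rV[K]_n).
Implicit Types (f : bool -> {poly R}) (P : bool -> bool -> {poly R}) (d : bool -> nat).

Definition ev e (p : {poly R}) : {poly K} := map_poly (fenv_ev e) p.

Definition appr P f i : {poly R} := P i false * f false + P i true * f true.
Definition det2 P := P false false * P true true - P false true * P true false.

(** [d] shifts the degrees of the columns and [d'] bounds the shifted degrees of the rows.
    Minimality is replaced by a bound on the sum of [d'], and the determinant ensures that no row is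
    zero. *)
Record approximant N f d P d' e : Prop := Approximant {
  appr_order : forall i m, (m < N)%N -> (ev e (appr P f i))`_m = 0;
  appr_deg : forall i j m, (ev e (P i j))`_m != 0 -> (m + d j <= d' i)%N;
  appr_det : ev e (det2 P) != 0
}.

Definition mxset N P : R -> Prop := fun x => exists i j, cf N (P i j) x.

Lemma mxset_sub N P F : (forall i j, sub (cf N (P i j)) F) -> sub (mxset N P) F.
Proof. by move=> h x [i [j /h]]. Qed.

Lemma sub_mxset N P F i j : sub (mxset N P) F -> sub (cf N (P i j)) F.
Proof. by move=> h x cx; apply: h; exists i, j. Qed.

Lemma slc_mxset N P F c : (forall i j, slc F c (cf N (P i j))) -> slc F (4 * c) (mxset N P).
Proof.
move=> h; have -> : (4 * c = (c + c) + (c + c))%N by lia.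
apply: slc_out (slc_or (slc_or (h false false) (h false true)) (slc_or (h true false) (h true true))) _.
by apply: mxset_sub => -[] [] x cx; left; [right; right | right; left | left; right | left; left].
Qed.

(** Row [b] is multiplied by [X], and the residue of the other row is eliminated by cross
    multiplication, which avoids a division. *)
Definition pivot (r : bool -> R) b : bool -> bool -> {poly R} := fun i j =>
  if i == b then (if j == b then 'X else 0) else if j == b then (- r (~~ b))%:P else (r b)%:P.

Lemma pivot_approximant f d b e (r := fun i => (f i)`_0) :
    r b e <> 0 -> (d b <= d (~~ b))%N \/ r (~~ b) e = 0 ->
  approximant 1 f d (pivot r b) (fun i => d i + (i == b))%N e.
Proof.
move=> rb0 hd; split.
- move=> i [|//] _; rewrite coef_map /appr /pivot; case: b rb0 {hd}; case: i => rb0 /=;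
    rewrite ?mul0r ?add0r ?addr0 coefE ?coefXM ?eqxx ?coefCM /=; try exact: (rmorph0 (fenv_ev e)).
    by rewrite (_ : _ + _ = 0) ?rmorph0 // /r; ring.
  by rewrite (_ : _ + _ = 0) ?rmorph0 // /r; ring.
- move=> i j m; rewrite coef_map /pivot.
  have [->|ne] := eqVneq i b; have [->|ne'] := eqVneq j b.
  + rewrite coefX; have [->|_] := eqVneq m 1%N; first by rewrite addn1 add1n.
    by move/eqP; case.
  + by rewrite coef0 => /eqP [].
  + have -> : i = ~~ b by case: (i) (b) ne => [] [].
    rewrite coefC; have [->|_] := eqVneq m 0%N; last by move/eqP; case.
    move=> nz; case: hd => [le|h]; last first.
      by case/eqP: nz; rewrite -[LHS]/(- (r (~~ b) e)) h oppr0.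
    by rewrite add0n; case: (b) le; rewrite /= addn0.
  + have -> : j = i by case: (i) (j) (b) ne ne' => [] [] [].
    by rewrite coefC; have [->|_] := eqVneq m 0%N; rewrite ?addn0 // => /eqP [].
- have -> : det2 (pivot r b) = 'X * (r b)%:P.
    by rewrite /det2 /pivot; case: b {rb0 hd}; rewrite /= ?mul0r ?mulr0 subr0 // mulrC.
  rewrite /ev rmorphM /= map_polyX map_polyC /= mulf_neq0 ?polyX_eq0 // polyC_eq0.
  exact/eqP.
Qed.

Definition idmx : bool -> bool -> {poly R} := fun i j => if i == j then 1 else 0.

Lemma id_approximant f d e : (forall i, (f i)`_0 e = 0) -> approximant 1 f d idmx d e.
Proof.
move=> f0; split.
- move=> i [|//] _; rewrite coef_map /appr /idmx.
  by case: i; rewrite /= mul0r mul1r ?add0r ?addr0 /fenv_ev f0.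
- move=> i j m; rewrite /ev coef_map /idmx; have [->|_] := eqVneq i j; last by rewrite coef0 => /eqP [].
  by rewrite coef1; have [->|_] := eqVneq m 0%N => // /eqP [].
- by rewrite /det2 /idmx /= mulr1 mulr0 subr0 /ev rmorph1 oner_neq0.
Qed.

Lemma appr_comp f f' N M d d1 d2 P1 P2 e :
    (forall i m, (m < M)%N -> (ev e (f' i))`_m = (ev e (appr P1 f i))`_(m + N)) ->
    approximant N f d P1 d1 e -> approximant M f' d1 P2 d2 e ->
  approximant (N + M) f d (fun i j => P2 i false * P1 false j + P2 i true * P1 true j) d2 e.
Proof.
move=> ef [o1 g1 n1] [o2 g2 n2]; split.
- move=> i m lt; set P := fun _ _ => _.
  have -> : appr P f i = appr P2 (appr P1 f) i by rewrite /appr /P; ring.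
  have eG l : ev e (appr P1 f l) = drop_poly N (ev e (appr P1 f l)) * 'X^N.
    rewrite -{1}[ev e (appr P1 f l)](poly_take_drop N); rewrite [take_poly _ _](_ : _ = 0) ?add0r //.
    by apply/polyP => t; rewrite coef_take_poly coef0; case: ifP => // /o1 ->.
  have -> : ev e (appr P2 (appr P1 f) i) = (ev e (P2 i false) * drop_poly N (ev e (appr P1 f false)) +
     ev e (P2 i true) * drop_poly N (ev e (appr P1 f true))) * 'X^N.
    by rewrite {1}/appr /ev rmorphD !rmorphM /= -!/(ev e _) {1}(eG false) {1}(eG true); ring.
  rewrite coefMXn; case: ltnP => // le.
  have lt' : (m - N < M)%N by rewrite ltn_subLR.
  have := o2 i (m - N)%N lt'; rewrite {1}/appr /ev rmorphD !rmorphM /= -!/(ev e _) !coefD.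
  have E l : (ev e (P2 i l) * drop_poly N (ev e (appr P1 f l)))`_(m - N) =
      (ev e (P2 i l) * ev e (f' l))`_(m - N).
    apply: (coefM_trunc lt') => // t ltt; rewrite coef_drop_poly ef //.
  by rewrite !E.
- move=> i j m; rewrite /ev rmorphD !rmorphM /= -!/(ev e _) coefD => nz.
  have [l nzl] : exists l, (ev e (P2 i l) * ev e (P1 l j))`_m != 0.
    case: (eqVneq (ev e (P2 i false) * ev e (P1 false j))`_m 0) nz => [->|ne _]; last by exists false.
    by rewrite add0r; exists true.
  have [t nzt] : exists t : 'I_m.+1, (ev e (P2 i l))`_t * (ev e (P1 l j))`_(m - t) != 0.
    apply/existsP; apply: contraNT nzl; rewrite negb_exists => /forallP h.
    by rewrite coefM big1 // => t _; apply/eqP; rewrite -[_ == _]negbK; apply: h.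
  move: nzt; rewrite mulf_eq0 negb_or => /andP [/g2 h1 /g1 h2].
  by have := ltn_ord t; lia.
set P := fun _ _ => _; have -> : det2 P = det2 P2 * det2 P1 by rewrite /det2 /P; ring.
by rewrite /ev rmorphM mulf_neq0.
Qed.

(** At a leaf, two tests and one negation. At a node, 4 products for the residual pair and 8 for the
    product of the two matrices, with 6 sums. *)
Fixpoint pm_cost k :=
  if k is k'.+1 then (2 * pm_cost k' + 12 * mul_cost k.+1 + 6 * 2 ^ k.+1)%N else 3%N.

Lemma size_pivot r b i j : (size (pivot r b i j) <= 2)%N.
Proof.
rewrite /pivot; case: ifP => _; case: ifP => _; rewrite ?size_polyX ?size_poly0 //;
  by apply: leq_trans (size_polyC_leq1 _) _.
Qed.

Lemma slc_pivot r b F : (forall i, known F (r i)) -> slc F 1 (mxset 2 (pivot r b)).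
Proof.
move=> hr; have k0 : known F 0 by right; exists 0; rewrite rmorph0.
have k1 : known F 1 by right; exists 1; rewrite rmorph1.
rewrite -[1%N]addn0; apply: slc_bind (slc_opp k0 (hr (~~ b))) _; rewrite sub0r.
apply: slc_done; apply: mxset_sub => i j; apply: sub_cf => l _.
have F' x : known F x -> known (setor F (eq (- r (~~ b)))) x.
  by apply: known_sub; apply: sub_l; apply: sub_refl.
rewrite /pivot; case: ifP => _; case: ifP => _; rewrite ?coefX ?coef0 ?coefC.
- by right; exists (l == 1%N)%:R; rewrite rmorph_nat.
- exact: F'.
- by case: ifP => _; [left; right | exact: F'].
- by case: ifP => _; exact: F'.
Qed.

(** In continuation form, because each branch of the tree has a matrix of its own and the sequel is
    built separately behind it. The bounds [d] are known along a branch, so comparing degrees costs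
    no test. *)
Lemma tcan_pm k D F f d c g : (forall i, sub (cf (2 ^ k) (f i)) F) ->
    (forall D' P d', (forall e, D' e -> D e) -> (forall i j, (size (P i j) <= (2 ^ k).+1)%N) ->
       (d' false + d' true <= d false + d true + 2 ^ k)%N ->
       (forall e, D' e -> approximant (2 ^ k) f d P d' e) ->
       tcan D' c (setor F (mxset (2 ^ k).+1 P)) g) ->
  tcan D (pm_cost k + c) F g.
Proof.
elim: k D F f d c => [|k IH] D F f d c hf h.
  pose r i := (f i)`_0; have hr i : known F (r i) by apply: known_cf (hf i) _.
  have piv D' b : (forall e, D' e -> D e) -> (forall e, D' e -> r b e <> 0) ->
      (d b <= d (~~ b))%N \/ (forall e, D' e -> r (~~ b) e = 0) ->
    tcan D' (1 + c) F g.
    move=> D'D rb0 hd; apply: tcan_slc (slc_pivot b hr) _.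
    apply: (h _ _ (fun i => d i + (i == b))%N) => // [i j||e De].
    - exact: size_pivot.
    - by rewrite expn0; case: (b); rewrite /=; lia.
    - by apply: pivot_approximant (rb0 e De) _; case: hd => hd; [left | right; apply: hd].
  rewrite -[(pm_cost 0 + c)%N]/((1 + c).+2).
  apply: (tcan_test (hr false)); apply: (tcan_test (hr true)).
  - apply: tcan_weak (h _ idmx d _ _ _ _) _ _ => //=.
    + by move=> e [[]].
    + by move=> i j; rewrite /idmx; case: ifP; rewrite ?size_poly1 ?size_poly0.
    + by rewrite addn1.
    + by move=> e [[De r0] r1]; apply: id_approximant => -[].
    + move=> x [Fx|[i [j [l _ ->]]]]; first by exists x => //; left.
      exists (idmx i j)`_l => //; rewrite /idmx; right; case: ifP => _.
        by rewrite coef1; exists (l == 0%N)%:R; rewrite rmorph_nat.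
      by rewrite coef0; exists 0; rewrite rmorph0.
  - by apply: (piv _ true) => [e [[]]|e []|] //; right => e [[]].
  - by apply: (piv _ false) => [e [[]]|e [[]]|] //; right => e [].
  have [le|gt] := leqP (d false) (d true).
    by apply: (piv _ false) => [e [[]]|e [[]]|] //; left.
  by apply: (piv _ true) => [e [[]]|e []|] //; left; apply: ltnW.
set N := (2 ^ k)%N; have N0 : (0 < N)%N by rewrite expn_gt0.
have e2 : (2 ^ k.+1 = N + N)%N by rewrite expnS mul2n -addnn.
have e4 : (2 ^ k.+2 = 4 * N)%N by rewrite !expnS mulnA.
set m := mul_cost k.+2.
have -> : (pm_cost k.+1 + c = pm_cost k + (4 * m + 2 * 2 ^ k.+2 + (pm_cost k + (8 * m + 4 * 2 ^ k.+2 + c))))%N.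
  by rewrite /= -/m; lia.
apply: (IH D F f d) => [i|D1 P1 d1 D1D sP1 hd1 a1].
  by apply: sub_cf_le (hf i) _; rewrite e2 leq_addl.
set F1 := setor F _.
pose fT i := take_poly (2 ^ k.+1) (f i).
have prodc (a b : {poly R}) F' : (size a <= N.+1)%N -> (size b <= 2 * N)%N ->
    sub (cf (2 ^ k.+2) a) F' -> sub (cf (2 ^ k.+2) b) F' -> slc F' m (cf (2 ^ k.+2) (a * b)).
  move=> sa sb ha hb; apply: slc_poly_mul => //.
  - by apply: leq_trans sa _; rewrite e4; lia.
  - by apply: leq_trans sb _; rewrite e4; lia.
  apply: leq_trans (size_polyMleq _ _) _; rewrite e4.
  by apply: (@leq_trans (N.+1 + 2 * N).-1); [rewrite -!subn1 leq_sub2r // leq_add | lia].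
have hP1 i j F' : sub F1 F' -> sub (cf (2 ^ k.+2) (P1 i j)) F'.
  move=> s; apply: sub_trans s; apply: sub_cf_size (sP1 i j); apply: sub_r.
  by apply: sub_mxset; apply: sub_refl.
have hfT i F' : sub F1 F' -> sub (cf (2 ^ k.+2) (fT i)) F'.
  move=> s; apply: sub_trans s; apply: sub_l; apply: sub_cf => t _.
  rewrite coef_take_poly; case: ifP => lt; first exact: known_cf (hf i) lt.
  by right; exists 0; rewrite rmorph0.
have sfT i : (size (fT i) <= 2 * N)%N by rewrite (leq_trans (size_take_poly _ _)) // e2 addnn -mul2n.
have slcg i : slc F1 (2 * m + 2 ^ k.+2) (cf (2 ^ k.+2) (appr P1 fT i)).
  rewrite mul2n -addnn -addnA.
  apply: slc_bind (prodc _ _ _ (sP1 i false) (sfT false) (hP1 _ _ _ (@sub_refl _ _ _ _)) (hfT _ _ (@sub_refl _ _ _ _))) _.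
  apply: slc_bind (prodc _ _ _ (sP1 i true) (sfT true) (hP1 _ _ _ _) (hfT _ _ _)) _; auto.
  by apply: slc_polyD; auto; apply: sub_l; apply: sub_r; apply: sub_refl.
have -> : (4 * m + 2 * 2 ^ k.+2 = (2 * m + 2 ^ k.+2) + (2 * m + 2 ^ k.+2))%N by lia.
apply: tcan_slc (slc_or (slcg false) (slcg true)) _; set F2 := setor F1 _.
pose f' i := drop_poly N (appr P1 fT i).
have hg i : sub (cf (2 ^ k.+2) (appr P1 fT i)) F2.
  by apply: sub_r; case: i; [apply: sub_r | apply: sub_l]; apply: sub_refl.
apply: (IH D1 F2 f' d1) => [i|D2 P2 d2 D2D1 sP2 hd2 a2].
  apply: sub_cf => t lt; rewrite coef_drop_poly; apply: known_cf (hg i) _.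
  by rewrite e4; move: lt; rewrite -/N; lia.
set F3 := setor F2 _.
have hP2 i j F' : sub F3 F' -> sub (cf (2 ^ k.+2) (P2 i j)) F'.
  move=> s; apply: sub_trans s; apply: sub_cf_size (sP2 i j); apply: sub_r.
  by apply: sub_mxset; apply: sub_refl.
have F13 : sub F1 F3 by apply: sub_l; apply: sub_l; apply: sub_refl.
pose P i j := P2 i false * P1 false j + P2 i true * P1 true j.
have leN i j : (size (P1 i j) <= 2 * N)%N by apply: leq_trans (sP1 i j) _; rewrite -/N; lia.
have sP i j : (size (P i j) <= (2 ^ k.+1).+1)%N.
  apply: leq_trans (size_polyD _ _) _; rewrite geq_max e2.
  by apply/andP; split; apply: leq_trans (size_polyMleq _ _) _;
    apply: (@leq_trans (N.+1 + N.+1).-1); rewrite ?addnS ?addSn // -!subn1 leq_sub2r // -addnS -addSn leq_add.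
have slcP i j : slc F3 (2 * m + 2 ^ k.+2) (cf (2 ^ k.+2) (P i j)).
  rewrite mul2n -addnn -addnA.
  apply: slc_bind (prodc _ _ _ (sP2 i false) (leN false j) (hP2 _ _ _ (@sub_refl _ _ _ _)) (hP1 _ _ _ F13)) _.
  apply: slc_bind (prodc _ _ _ (sP2 i true) (leN true j) (hP2 _ _ _ _) (hP1 _ _ _ _)) _; auto.
  by apply: slc_polyD; auto; apply: sub_l; apply: sub_r; apply: sub_refl.
have -> : (8 * m + 4 * 2 ^ k.+2 = 4 * (2 * m + 2 ^ k.+2))%N by lia.
apply: tcan_slc (slc_mxset slcP) _.
apply: tcan_weak (h D2 P d2 _ sP _ _) (leqnn c) _.
- by move=> e /D2D1 /D1D.
- by apply: leq_trans hd2 _; rewrite e2 addnA leq_add2r.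
- move=> e De; rewrite e2; apply: (appr_comp (f' := f')) (a1 e _) (a2 e De); last exact: D2D1.
  move=> i t lt; rewrite !coef_map coef_drop_poly; congr (fenv_ev e _).
  have lt2 : (t + N < 2 ^ k.+1)%N by rewrite e2 ltn_add2r.
  rewrite /appr !coefD; congr (_ + _); apply: (coefM_trunc lt2) => // s lts.
    by rewrite coef_take_poly lts.
  by rewrite coef_take_poly lts.
move=> x Fx; exists x => //; move: x Fx; apply: sub_or.
  by apply: sub_l; apply: sub_trans F13; apply: sub_l; apply: sub_refl.
apply: sub_r; apply: mxset_sub => i j; apply: sub_cf_le (sub_mxset (@sub_refl _ _ _ _)) _.
by rewrite e2 e4; lia.
Qed.

End ApproximantBasis.

(** * Decoding *)

Section ErrorLocator.
Variables (K : fieldType) (d : nat) (x : nat -> K).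
Hypothesis x_inj : forall i j, (i < d)%N -> (j < d)%N -> x i = x j -> i = j.
Hypothesis x_neq0 : forall i, (i < d)%N -> x i != 0.
Implicit Types (J : {pred 'I_d}) (a : 'I_d -> K) (A B : {poly K}).

Definition lin (i : 'I_d) : {poly K} := 1 - x i *: 'X.
Definition linprod J : {poly K} := \prod_(j | J j) lin j.
Definition fracsum J a : {poly K} := \sum_(i | J i) a i *: \prod_(j | J j && (j != i)) lin j.

Lemma lin_root i j : (lin j).[(x i)^-1] = 1 - x j / x i.
Proof. by rewrite /lin !hornerE. Qed.

Lemma size_lin i : (size (lin i) <= 2)%N.
Proof.
apply: leq_trans (size_polyD _ _) _; rewrite geq_max size_polyN size_poly1 /=.
by apply: leq_trans (size_scale_leq _ _) _; rewrite size_polyX.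
Qed.

Lemma size_linprod J : (size (linprod J) <= #|J|.+1)%N.
Proof.
apply: leq_trans (size_poly_prod_leq _ _) _; rewrite leq_subLR.
apply: (@leq_ltn_trans (\sum_(i | J i) 2)); first by apply: leq_sum => i _; apply: size_lin.
by rewrite (_ : \sum_(i | J i) 2 = \sum_(i in J) 2)%N // sum_nat_const muln2 -addnn addnS.
Qed.

Lemma linprod0 J : (linprod J)`_0 = 1.
Proof.
rewrite -horner_coef0 horner_prod big1 // => i _.
by rewrite /lin !(hornerE, mulr0, subr0).
Qed.

Lemma linprod_neq0 J : linprod J != 0.
Proof. by apply: contra_neq (@oner_neq0 K) => e; rewrite -(linprod0 J) e coef0. Qed.

Lemma size_fracsum J a : (size (fracsum J a) <= #|J|)%N.
Proof.
apply: leq_trans (size_sum _ _ _) _; apply/bigmax_leqP => i Ji.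
apply: leq_trans (size_scale_leq _ _) _.
apply: leq_trans (size_linprod [pred j | J j & j != i]) _.
rewrite (cardD1 i J) [i \in J]Ji add1n ltnS; apply: subset_leq_card.
by apply/subsetP => j; rewrite !inE andbC.
Qed.

Lemma fracsum_split J a : (forall i, ~~ J i -> a i = 0) ->
  fracsum predT a = fracsum J a * linprod [pred i | ~~ J i].
Proof.
move=> a0; rewrite /fracsum (bigID J) /= [X in _ + X]big1 ?addr0; last first.
  by move=> i /a0 ->; rewrite scale0r.
rewrite mulr_suml; apply: eq_bigr => i Ji; rewrite -scalerAl; congr (_ *: _).
rewrite (bigID J) /= /linprod; congr (_ * _); first by apply: eq_bigl => j; rewrite andbC.
by apply: eq_bigl => j /=; case: eqP => [->|] //=; rewrite Ji.
Qed.

Lemma linprod_split J : linprod predT = linprod J * linprod [pred i | ~~ J i].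
Proof. by rewrite /linprod (bigID J). Qed.

Lemma fracsum_root J a i : J i ->
  (fracsum J a).[(x i)^-1] = a i * \prod_(j | J j && (j != i)) (1 - x j / x i).
Proof.
move=> Ji; rewrite /fracsum horner_sum (bigD1 i) //= [X in _ + X]big1 ?addr0; last first.
  move=> l /andP [Jl li]; rewrite hornerZ horner_prod (bigD1 i) /= ?Ji 1?eq_sym //.
  by rewrite lin_root mulfV ?x_neq0 // subrr mul0r mulr0.
by rewrite hornerZ horner_prod; congr (_ * _); apply: eq_bigr => j _; rewrite lin_root.
Qed.

Lemma frac_neq0 J i : \prod_(j | J j && (j != i)) (1 - x j / x i) != 0.
Proof.
apply/prodf_neq0 => j /andP [_ ji]; rewrite subr_eq0 eq_sym.
apply: contra_neq ji => e; apply: val_inj; apply: x_inj (ltn_ord _) (ltn_ord _) _.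
by rewrite -[x i]mul1r -e mulfVK // x_neq0.
Qed.

Lemma unit_low s (G H : {poly K}) : H`_0 = 1 -> (forall i, (i < s)%N -> (G * H)`_i = 0) ->
  forall i, (i < s)%N -> G`_i = 0.
Proof.
move=> H0 GH; elim/ltn_ind => i IH lt; have := GH i lt.
rewrite coefM big_ord_recr /= subnn H0 mulr1 big1 ?add0r // => j _.
by rewrite IH ?mul0r // (ltn_trans _ lt).
Qed.

(** The factors outside [E] divide the relation and are invertible modulo [X^(2t)]. What remains has
    size at most [2 t], so it is zero exactly, and at the inverse of an error position only the term
    in [A] survives. *)
Lemma error_locator t (a : 'I_d -> K) (E : {pred 'I_d}) (N A B : {poly K}) :
    (forall i, (a i != 0) = E i) -> (#|E| <= t)%N ->
    (forall i, (i < 2 * t)%N -> N`_i = (fracsum predT a)`_i) ->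
    (forall i, (i < 2 * t)%N -> (A * N + B * linprod predT)`_i = 0) ->
    (size A <= t.+1)%N -> (size B <= t)%N -> (A != 0) || (B != 0) ->
  A != 0 /\ forall i, E i -> A.[(x i)^-1] = 0.
Proof.
move=> aE Et eN AB sA sB nz; pose G := A * fracsum E a + B * linprod E.
have aE0 i : ~~ E i -> a i = 0 by rewrite -aE negbK => /eqP.
have G0 : G = 0.
  have low i : (i < 2 * t)%N -> G`_i = 0.
    apply: (@unit_low _ _ (linprod [pred i | ~~ E i])); first exact: linprod0.
    move=> l lt; have -> : G * linprod [pred i | ~~ E i] = A * fracsum predT a + B * linprod predT.
      by rewrite (fracsum_split aE0) (linprod_split E) /G; ring.
    rewrite -[RHS](AB l lt) !coefD; congr (_ + _); apply: (coefM_trunc lt) => // j lj.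
    by rewrite eN.
  apply/polyP => i; rewrite coef0; have [/low //|ge] := ltnP i (2 * t).
  rewrite nth_default //; apply: leq_trans ge; apply: leq_trans (size_polyD _ _) _.
  rewrite geq_max; apply/andP; split; apply: leq_trans (size_polyMleq _ _) _.
    have sf := size_fracsum E a; apply: (@leq_trans (t.+1 + t).-1).
      by rewrite -!subn1 leq_sub2r // leq_add // (leq_trans sf).
    by rewrite addSn /= mul2n addnn.
  have sl := size_linprod E; apply: (@leq_trans (t + t.+1).-1).
    by rewrite -!subn1 leq_sub2r // leq_add // (leq_trans sl).
  by rewrite addnS /= mul2n addnn.
have A0 : A != 0.
  apply: contraTneq nz => A0; rewrite A0 eqxx /= negbK.
  have : B * linprod E = 0 by rewrite -[RHS]G0 /G A0 mul0r add0r.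
  by move/eqP; rewrite mulf_eq0 (negPf (linprod_neq0 E)) orbF.
split=> // i Ei; have := congr1 (fun p => p.[(x i)^-1]) G0.
rewrite /G hornerD !hornerM horner0 (fracsum_root _ Ei).
have -> : (linprod E).[(x i)^-1] = 0.
  by rewrite horner_prod (bigD1 i) //= lin_root mulfV ?x_neq0 // subrr mul0r.
rewrite mulr0 addr0 => /eqP; rewrite mulf_eq0 => /orP [/eqP //|].
by rewrite mulf_eq0 (negPf (frac_neq0 _ _)) orbF; move: (Ei); rewrite -aE => /negPf ->.
Qed.

Lemma rev_prod (T : Type) (s : seq T) (y : T -> K) m : (m <= size s)%N ->
  (\prod_(i <- s) (1 - y i *: 'X))`_m = (\prod_(i <- s) ('X - (y i)%:P))`_(size s - m).
Proof.
elim: s m => [|i s IH] m; first by rewrite leqn0 => /eqP ->; rewrite !big_nil.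
rewrite !big_cons /=; set P := \prod_(j <- s) (1 - _); set Q := \prod_(j <- s) ('X - _).
have sP : (size P <= (size s).+1)%N.
  rewrite /P; elim: (s) => [|j r IHr]; first by rewrite big_nil size_polyC_leq1.
  rewrite big_cons; apply: leq_trans (size_polyMleq _ _) _.
  have s2 : (size (1 - y j *: 'X : {poly K})%R <= 2)%N.
    apply: leq_trans (size_polyD _ _) _; rewrite geq_max size_polyN size_poly1 /=.
    by apply: leq_trans (size_scale_leq _ _) _; rewrite size_polyX.
  by apply: (@leq_trans (2 + (size r).+1).-1) => //; rewrite -!subn1 leq_sub2r // leq_add.
have sQ : (size Q = (size s).+1)%N by rewrite size_prod_XsubC.
move=> lem; rewrite !mulrBl mul1r !coefB -scalerAl coefZ coefXM coefXM coefCM.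
case: m lem => [_|m lem].
  by rewrite /= mulr0 subr0 subn0 /= IH // subn0 [Q`_(size s).+1]nth_default ?sQ // mulr0 subr0.
rewrite subSS /=; have lem' : (m <= size s)%N by [].
have [e|ne] := eqVneq m (size s).
  rewrite e subnn eqxx [P`_(size s).+1]nth_default // !sub0r.
  by rewrite -e IH // e subnn.
have lt : (m < size s)%N by rewrite ltn_neqAle ne.
rewrite subn_eq0 leqNgt lt /= IH // IH 1?ltnW //.
by congr (Q`__ - _); rewrite -subnS.
Qed.

(** The weights of Lagrange interpolation, which are also the multipliers of the dual code. *)
Definition dual_coef i := (\prod_(j < d | j != i :> nat) (x i - x j))^-1.

Lemma dual_coef_neq0 (i : 'I_d) : \prod_(j < d | j != i :> nat) (x i - x j) != 0.
Proof.
apply/prodf_neq0 => j ji; rewrite subr_eq0; apply: contra_neq ji => e.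
exact/esym/x_inj.
Qed.

Definition lagrange_num (i : 'I_d) : {poly K} := \prod_(j < d | j != i) ('X - (x j)%:P).

Lemma card_others (i : 'I_d) : size [seq j <- index_enum 'I_d | j != i] = d.-1.
Proof.
transitivity #|predC1 i|; last by rewrite cardC1 card_ord.
by rewrite -sum1_card -sum1_size big_filter.
Qed.

Lemma size_lagrange_num i : (size (lagrange_num i) <= d)%N.
Proof.
by rewrite /lagrange_num -big_filter size_prod_XsubC card_others; have := ltn_ord i; lia.
Qed.

Lemma lagrange_num_root (i j : 'I_d) : dual_coef i * (lagrange_num i).[x j] = (i == j)%:R.
Proof.
have [<-|ij] := eqVneq i j.
  rewrite horner_prod (eq_bigr (fun l : 'I_d => x i - x l)) => [|l _]; last by rewrite hornerXsubC.
  by rewrite mulVf ?dual_coef_neq0.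
by rewrite horner_prod (bigD1 j) 1?eq_sym //= hornerXsubC subrr mul0r mulr0.
Qed.

Lemma poly_eq_points (f g : {poly K}) : (size f <= d)%N -> (size g <= d)%N ->
  (forall i : 'I_d, f.[x i] = g.[x i]) -> f = g.
Proof.
move=> sf sg fg; apply/eqP; rewrite -subr_eq0; apply: contraT => gf0.
have : (d < size (f - g)%R)%N.
  rewrite -{1}(size_enum_ord d) -(size_map (fun i : 'I_d => x i)).
  apply: max_poly_roots => //; last first.
    rewrite map_inj_uniq ?enum_uniq // => i j e; apply: val_inj.
    exact: x_inj e.
  by apply/allP => _ /mapP [i _ ->]; rewrite rootE hornerD hornerN fg subrr.
rewrite ltnNge; apply: contraNT => _; apply: leq_trans (size_polyD _ _) _.
by rewrite geq_max sf size_polyN.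
Qed.

Lemma size_interp (y : 'I_d -> K) :
  (size (\sum_(i < d) (dual_coef i * y i) *: lagrange_num i)%R <= d)%N.
Proof.
apply: leq_trans (size_sum _ _ _) _; apply/bigmax_leqP => i _.
exact: leq_trans (size_scale_leq _ _) (size_lagrange_num i).
Qed.

Lemma interp_value (y : 'I_d -> K) (j : 'I_d) :
  (\sum_(i < d) (dual_coef i * y i) *: lagrange_num i).[x j] = y j.
Proof.
rewrite horner_sum (bigD1 j) //= [X in _ + X]big1 ?addr0 => [|i ij].
  by rewrite hornerZ mulrAC lagrange_num_root eqxx mul1r.
by rewrite hornerZ mulrAC lagrange_num_root (negPf ij) mul0r.
Qed.

Lemma lagrange_interp (f : {poly K}) : (size f <= d)%N ->
  \sum_(i < d) (dual_coef i * f.[x i]) *: lagrange_num i = f.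
Proof.
move=> sf; apply: poly_eq_points => // [|j]; first exact: size_interp.
exact: (interp_value (fun i : 'I_d => f.[x i])).
Qed.

(** The numerator attached to a codeword is Lagrange's formula for [f] with the coefficients
    reversed, so its low coefficients are the high ones of [f]. *)
Lemma codeword_frac (f : {poly K}) k m : (size f <= k)%N -> (m + k < d)%N ->
  (fracsum predT (fun i => dual_coef i * f.[x i]))`_m = 0.
Proof.
move=> sf mk; have -> : (fracsum predT (fun i => dual_coef i * f.[x i]))`_m = f`_(d.-1 - m).
  rewrite -[f in RHS]lagrange_interp; last by apply: leq_trans sf _; lia.
  rewrite !coef_sum; apply: eq_bigr => i _; rewrite !coefZ; congr (_ * _).
  pose s := [seq j <- index_enum 'I_d | j != i].
  have -> : \prod_(j | predT j && (j != i)) lin j = \prod_(j <- s) lin j by rewrite big_filter.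
  have -> : lagrange_num i = \prod_(j <- s) ('X - (x j)%:P) by rewrite /lagrange_num big_filter.
  by rewrite rev_prod card_others //; lia.
by rewrite nth_default // (leq_trans sf) //; lia.
Qed.

End ErrorLocator.

Definition inp (K : fieldType) n (i : nat) : fenv K n :=
  fun e => if insub i is Some i' then e 0 i' else 0.

Definition inputs (K : fieldType) n : fenv K n -> Prop := bigor n (fun i => eq (@inp K n i)).

Lemma inpE (K : fieldType) n (e : 'rV[K]_n) (i : 'I_n) : @inp K n i e = e 0 i.
Proof. by rewrite /inp valK. Qed.

(** * The decoding tree *)

Section Decoder.
Variables (K : fieldType) (m : nat) (x : nat -> K).
Hypothesis two0 : (2 : K) != 0.
Local Notation t := (2 ^ m)%N.
Local Notation d := (2 ^ m.+2)%N.
Hypothesis x_inj : forall i j, (i < d)%N -> (j < d)%N -> x i = x j -> i = j.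
Hypothesis x_neq0 : forall i, (i < d)%N -> x i != 0.

Notation R := (fenv K d).
Notation cst := (@fenv_cst K d).
Notation known := (known cst).
Notation slc := (slc cst).
Notation sub := (sub cst).
Notation inp := (@inp K d).
Implicit Types (D : 'rV[K]_d -> Prop) (F : R -> Prop) (e c : 'rV[K]_d).

(** After the tests the zero pattern [J] belongs to the branch, so the sequel may use any constant
    that depends on [J]. *)
Lemma tcan_tests n (v : nat -> R) D k F g : (forall i, (i < n)%N -> known F (v i)) ->
    (forall J : nat -> bool,
       tcan (fun e => D e /\ forall i, (i < n)%N -> (v i e == 0) = J i) k F g) ->
  tcan D (n + k) F g.
Proof.
elim: n D => [|n IH] D hv h.
  move=> xs Fxs; have [|T cT eT] := h xpred0 xs.
    by move=> f /Fxs [o eo]; exists o => e [/eo].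
  by exists T => // e De; apply: eT.
have hv' i : (i < n)%N -> known F (v i) by move=> lt; apply: hv; apply: ltnW.
rewrite addSn; apply: (tcan_test (hv n (ltnSn n))); apply: IH => // J.
  move=> xs Fxs; have [|T cT eT] := h (fun i => if i == n then true else J i) xs.
    move=> f /Fxs [o eo]; exists o => e [De hJ]; apply: eo; split; first split=> //.
      by apply/eqP; rewrite hJ // eqxx.
    by move=> i lt; rewrite hJ ?ltn_eqF // ltnW.
  exists T => // e [[De vn] hJ]; apply: eT; split=> // i.
  by rewrite ltnS leq_eqVlt; case: eqP => [-> _|_ /= lt]; [apply/eqP | apply: hJ].
move=> xs Fxs; have [|T cT eT] := h (fun i => if i == n then false else J i) xs.
  move=> f /Fxs [o eo]; exists o => e [De hJ]; apply: eo; split; first split=> //.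
    by apply/eqP; rewrite hJ // eqxx.
  by move=> i lt; rewrite hJ ?ltn_eqF // ltnW.
exists T => // e [[De vn] hJ]; apply: eT; split=> // i.
by rewrite ltnS leq_eqVlt; case: eqP => [-> _|_ /= lt]; [apply/eqP | apply: hJ].
Qed.

Definition near_codeword e c : Prop :=
  (exists2 f : {poly K}, (size f <= 2 ^ m.+1)%N & forall i, c 0 i = f.[x i]) /\
  (4 * hamming_dist e c <= d)%N.

Let u i := dual_coef d x i.
Let xi i := (x i)^-1.
Let N : {poly R} := fracnum x cst (fun i => cst (u i) * inp i) 0 d.
Let Df : {poly R} := map_poly cst (revnode x 0 d).
Let f0 (b : bool) := if b then Df else N.

Lemma ev_up e (p : {poly K}) : ev e (map_poly cst p) = p.
Proof. by apply/polyP => i; rewrite !coef_map. Qed.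

Lemma ev_N e : ev e N = fracsum x predT (fun i => u i * e 0 i).
Proof.
rewrite /ev /N /fracnum rmorph_sum /fracsum /=; apply: eq_bigr => i _.
by rewrite map_polyZ /= [map_poly _ (map_poly _ _)]ev_up /fenv_ev /= -inpE.
Qed.

Lemma fracsum_lin (a b : 'I_d -> K) :
  fracsum x predT (fun i => a i + b i) = fracsum x predT a + fracsum x predT b.
Proof. by rewrite -big_split; apply: eq_bigr => i _; rewrite scalerDl. Qed.

Section Correctness.
Variables (e c : 'rV[K]_d).
Hypothesis nc : near_codeword e c.
Let a (i : 'I_d) := u i * (e 0 i - c 0 i).
Let E : {pred 'I_d} := [pred i | e 0 i != c 0 i].

Lemma err_neq0 i : (a i != 0) = E i.
Proof.
by rewrite /a mulf_eq0 invr_eq0 (negPf (dual_coef_neq0 x_inj i)) subr_eq0.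
Qed.

Lemma card_err : (#|E| <= t)%N.
Proof.
have : (4 * hamming_dist e c <= 4 * t)%N by apply: leq_trans nc.2 _; rewrite !expnS mulnA.
rewrite leq_pmul2l // /hamming_dist; apply: leq_trans.
by apply: subset_leq_card; apply/subsetP => i; rewrite !inE.
Qed.

Lemma syndrome_err i : (i < 2 * t)%N -> (ev e N)`_i = (fracsum x predT a)`_i.
Proof.
move=> lt; have [f sf cf] := nc.1.
have -> : ev e N = fracsum x predT a + fracsum x predT (fun i : 'I_d => u i * f.[x i]).
  rewrite ev_N -fracsum_lin; apply: eq_bigr => j _.
  by rewrite /a -cf -mulrDr subrK.
rewrite coefD (codeword_frac x_inj sf) ?addr0 //.
by rewrite -expnS in lt; rewrite [X in (_ < X)%N]expnS mul2n -addnn ltn_add2r.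
Qed.

Lemma approximant_locates P d' i0 :
    approximant (2 ^ m.+1) f0 (fun b => nat_of_bool b) P d' e -> (d' i0 <= t)%N ->
  ev e (P i0 false) != 0 /\ forall i : 'I_d, E i -> (ev e (P i0 false)).[xi i] = 0.
Proof.
move=> [ord deg dt] le.
have sA : (size (ev e (P i0 false)) <= t.+1)%N.
  apply/leq_sizeP => j lj; apply/eqP; apply: contraT => /deg; rewrite addn0 => h.
  by have := leq_trans h le; rewrite leqNgt lj.
have sB : (size (ev e (P i0 true)) <= t)%N.
  apply/leq_sizeP => j lj; apply/eqP; apply: contraT => /deg; rewrite addn1 => h.
  by have := leq_trans h le; rewrite leqNgt ltnS lj.
have [||A0 h] := @error_locator _ _ _ x_inj x_neq0 t a E (ev e N) _ _ err_neq0 card_err syndrome_err _ sA sB.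
- move=> i; rewrite -expnS => lt; rewrite -[RHS](ord i0 i lt); congr _`_i.
  by rewrite /appr /f0 /ev rmorphD !rmorphM /= -!/(ev e _) ev_up.
- apply: contraT; rewrite negb_or !negbK => /andP [/eqP A0 /eqP B0]; case/negP: dt.
  have E2 i : (ev e (P i0 i)) = 0 by case: i.
  rewrite /det2 /ev rmorphB !rmorphM /= -!/(ev e _).
  by case: (i0) E2 => E2; rewrite !E2 ?(mul0r, mulr0) subrr.
by split.
Qed.

Variable J : {pred 'I_d}.
Hypotheses (EJ : forall i, E i -> J i) (Jt : (#|J| <= t)%N).

(** The factors at the positions outside [J] are cancelled by their inverse series [C], a constant
    once [J] is known. [J] may be larger than the set of errors: the extra positions receive error
    value zero. *)
Lemma err_poly (C : {poly K}) :
    (forall i, (i < t)%N -> (C * linprod x [pred i | ~~ J i])`_i = (i == 0%N)%:R) ->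
  take_poly t (take_poly t (ev e N) * C) = fracsum x J a.
Proof.
move=> hC; apply/polyP => i; rewrite coef_take_poly; case: ltnP => lt; last first.
  by rewrite nth_default // (leq_trans (size_fracsum _ _ _)) // (leq_trans Jt).
have lt2 : (i < 2 * t)%N by rewrite mul2n -addnn ltn_addr.
transitivity ((fracsum x predT a * C)`_i).
  apply: (coefM_trunc lt) => // j lj; rewrite coef_take_poly lj syndrome_err //.
  by rewrite mul2n -addnn ltn_addr.
have aJ j : ~~ J j -> a j = 0.
  by move=> nJ; apply/eqP; apply: contraNT nJ; rewrite err_neq0 => /EJ.
rewrite (fracsum_split x aJ) -mulrA [linprod _ _ * C]mulrC.
rewrite -[RHS](congr1 (fun p : {poly K} => p`_i) (mulr1 (fracsum x J a))).
by apply: (coefM_trunc lt) => // j lj; rewrite hC // coef1.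
Qed.

Lemma err_value (i : 'I_d) : J i ->
  e 0 i - (fracsum x J a).[xi i] / (u i * \prod_(j | J j && (j != i)) (1 - x j / x i)) = c 0 i.
Proof.
move=> Ji; rewrite (fracsum_root x_neq0 _ Ji).
set pr := \prod_(j | _) _; have p0 : pr != 0 by apply: frac_neq0.
have u0 : u i != 0 by rewrite invr_eq0 dual_coef_neq0.
have gen (U p y z : K) : U != 0 -> p != 0 -> y - U * (y - z) * p / (U * p) = z.
  by move=> U0 p0'; field; rewrite U0 p0'.
exact: gen.
Qed.

Lemma no_err (i : 'I_d) : ~~ J i -> e 0 i = c 0 i.
Proof. by move=> nJ; apply/eqP; apply: contraNT nJ => /EJ. Qed.

End Correctness.

Lemma card_zeros (A : {poly K}) (J : {pred 'I_d}) : A != 0 -> (size A <= t.+1)%N ->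
  (forall i, J i -> A.[xi i] = 0) -> (#|J| <= t)%N.
Proof.
move=> A0 sA hJ; rewrite -ltnS; apply: leq_trans sA.
rewrite cardE -(size_map (fun i : 'I_d => xi i)); apply: max_poly_roots => //.
  by apply/allP => _ /mapP [i + ->]; rewrite mem_enum => /hJ /eqP.
rewrite map_inj_uniq ?enum_uniq // => i j /invr_inj e; apply: val_inj.
exact: x_inj e.
Qed.

Lemma inverse_low (p : {poly K}) : p`_0 = 1 ->
  exists2 C : {poly K}, (size C <= t)%N & forall i, (i < t)%N -> (C * p)`_i = (i == 0%N)%:R.
Proof.
move=> p0; have : coprimep p 'X^t.
  by apply: coprimep_expr; rewrite coprimepX rootE horner_coef0 p0 oner_neq0.
case/Bezout_eq1_coprimepP => -[C V] /= CV; exists (take_poly t C); first exact: size_take_poly.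
move=> i lt; rewrite -coef1 -CV coefD [(V * _)`_i]coefMXn lt addr0.
by apply: (coefM_trunc lt) => // j lj; rewrite coef_take_poly lj.
Qed.

Definition dec_cost := (d + (fracnum_cost m.+2 + (pm_cost m.+1 + (eval_cost m.+2 +
  (d + (mul_cost m.+1 + (eval_cost m.+2 + d * 2)))))))%N.

Lemma tcan_decode : tcan (fun e => exists c, near_codeword e c) dec_cost (@inputs K d)
  (fun e s => forall c, near_codeword e c -> s = row_seq c).
Proof.
set D0 := fun e => _; set g := fun e s => _.
pose a i := cst (u i) * inp i.
have hin i : (i < d)%N -> known (@inputs K d) (inp i) by move=> lt; left; exists i.
apply: (tcan_slc (G := bigor d (fun i => eq (a i)))).
  rewrite -[X in slc _ X _]muln1; apply: slc_all => i lt.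
  by apply: slc_mul; [apply: known_cst | apply: hin].
set F1 := setor _ _.
have ha i : (i < d)%N -> known F1 (a (0 + i)%N) by move=> lt; left; right; exists i.
apply: tcan_slc (@slc_fracnum _ _ cst two0 x m.+2 0 a F1 ha) _; rewrite -/N; set F2 := setor F1 _.
apply: (@tcan_pm _ _ two0 m.+1 D0 F2 f0 (fun b => nat_of_bool b)) => [[]|D1 P d' D1D sP hd apx].
- exact: sub_cf_cst.
- by apply: sub_cf_le (sub_r _ (@sub_refl _ _ _ _)) _; rewrite leq_exp2l.
set F3 := setor F2 _.
(* The shifts [0] and [1] have sum 1, so the row degrees have sum at most [2 t + 1] and one of them
   is at most [t]. The shift also makes the second entry of that row of size at most [t]. *)
have [i0 hi0] : exists i0, (d' i0 <= t)%N.
  have [le|gt] := leqP (d' false) t; first by exists false.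
  exists true; move: hd gt; rewrite expnS /=; move: (d' true) (d' false) => y z; lia.
pose A := P i0 false; have t0 : (0 < t)%N by rewrite expn_gt0.
have e2 : (2 ^ m.+1 = 2 * t)%N by rewrite expnS.
have e4 : (d = 4 * t)%N by rewrite !expnS mulnA.
have sA : (size A <= d)%N by apply: leq_trans (sP i0 false) _; rewrite e2 e4; lia.
have hA : sub (cf d A) F3.
  by apply: sub_cf_size (sP i0 false); apply: sub_r; apply: sub_mxset; apply: sub_refl.
apply: tcan_slc (slc_eval two0 xi 0 sA hA) _; set F4 := setor F3 _.
apply: (@tcan_tests d (fun i => A.[cst (xi i)])) => [i lt|J]; first by left; right; exists i.
set D2 := fun e => _; pose Jp : {pred 'I_d} := fun i : 'I_d => J i.
have loc e c : D2 e -> near_codeword e c ->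
    [/\ forall i, e 0 i != c 0 i -> Jp i & (#|Jp| <= t)%N].
  move=> [D1e hJ] nc; have [A0 hE] := approximant_locates nc (apx e D1e) hi0.
  have hz (i : 'I_d) : (ev e A).[xi i] = A.[cst (xi i)] e.
    by rewrite -[RHS]/(fenv_ev e _) -horner_map.
  split=> [i /hE h|]; first by rewrite /Jp -hJ // -hz h eqxx.
  apply: (card_zeros A0) => [|i Ji]; last by apply/eqP; rewrite hz hJ.
  apply/leq_sizeP => j lj; apply/eqP; apply: contraT => /(appr_deg (apx e D1e)).
  by rewrite addn0 => h; have := leq_trans h hi0; rewrite leqNgt lj.
(* A nonzero [A] of degree at most [t] has at most [t] zeros, so no admissible input reaches the
   other branch. *)
have [Jt|Jt] := leqP #|Jp| t; last first.
  apply: (@tcan_weak _ _ _ 0%N _ F4) => [|//|f Ff]; last by exists f => //; left.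
  apply: tcan_void => e D2e; have [c nc] := D1D e D2e.1.
  by have [_] := loc e c D2e nc; rewrite leqNgt Jt.
have [C sC hC] := inverse_low (linprod0 x [pred i | ~~ Jp i]).
pose Nt := take_poly t N; pose S := take_poly t (Nt * map_poly cst C).
have sC' : (size (map_poly cst C) <= t)%N by apply: leq_trans (size_poly _ _) sC.
have sNt : (size Nt <= t)%N by apply: size_take_poly.
have sNC : (size (Nt * map_poly cst C)%R <= 2 * t)%N.
  apply: leq_trans (size_polyMleq _ _) _; apply: leq_trans (leq_pred _) _.
  by rewrite mul2n -addnn leq_add.
have le1 : (t <= 2 ^ m.+1)%N by rewrite e2 mul2n -addnn leq_addl.
have hN : sub (cf d N) F4 by apply: sub_l; apply: sub_l; apply: sub_r; apply: sub_refl.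
have hNt : sub (cf (2 ^ m.+1) Nt) F4.
  apply: (@sub_cf_size _ _ _ _ t) => //; apply: sub_cf => i lt; rewrite coef_take_poly lt.
  by apply: known_cf hN _; rewrite e4; lia.
apply: tcan_slc (@slc_poly_mul _ _ cst two0 m.+1 Nt (map_poly cst C) F4 _ _ _ hNt (@sub_cf_cst _ _ _ _ _ _)) _.
- exact: leq_trans le1.
- exact: leq_trans le1.
- by rewrite e2.
set F5 := setor F4 _.
have sS : (size S <= t)%N by apply: size_take_poly.
have hS : sub (cf d S) F5.
  apply: (@sub_cf_size _ _ _ _ t) => //; apply: sub_cf => i lt; rewrite coef_take_poly lt.
  by apply: (known_cf (n := (2 ^ m.+1)%N)); [apply: sub_r; apply: sub_refl | apply: leq_trans le1].
have sS' : (size S <= d)%N by apply: leq_trans sS _; rewrite e4; lia.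
apply: tcan_slc (slc_eval two0 xi 0 sS' hS) _; set F6 := setor F5 _.
(* The inverses of the denominators in Forney's formula, constants of the branch. *)
pose ka i : K := if insub i is Some i' then
  (u i * \prod_(j | Jp j && (j != i')) (1 - x j / x i))^-1 else 0.
pose y i : R := if J i then inp i - cst (ka i) * S.[cst (xi i)] else inp i.
have hin6 i : (i < d)%N -> known F6 (inp i).
  move=> lt; apply: (known_sub _ (hin i lt)); do 6 apply: sub_l; exact: sub_refl.
rewrite -[(d * 2)%N]addn0; apply: (tcan_slc (G := bigor d (fun i => eq (y i)))).
  apply: slc_all => i lt; rewrite /y; case: ifP => _; last by apply: slc_done; apply: known_eq (hin6 i lt).
  rewrite -[2%N]/(1 + 1)%N; apply: slc_bind.
    by apply: (slc_mul (known_cst _ _ (ka i))); left; right; exists i.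
  apply: slc_opp; last by left; right.
  by apply: (known_sub _ (hin6 i lt)); apply: sub_l; apply: sub_refl.
apply: (@tcan_ret _ _ _ _ _ [seq y i | i : 'I_d]).
  by move=> f /mapP [i _ ->]; left; right; exists i.
move=> e D2e c nc; rewrite /row_seq /mem_at -map_comp; apply: eq_map => i /=.
have [EJ _] := loc e c D2e nc.
rewrite /y; case: ifP => Ji; last by rewrite inpE; apply: (no_err EJ); rewrite /Jp Ji.
rewrite -[LHS]/(inp i e - ka i * S.[cst (xi i)] e) inpE /ka valK mulrC.
rewrite -[S.[_] e]/(fenv_ev e _) -horner_map /=.
have -> : map_poly (fenv_ev e) S = fracsum x Jp (fun i => u i * (e 0 i - c 0 i)).
  rewrite -(err_poly nc EJ Jt hC); apply/polyP => l.
  rewrite coef_map !coef_take_poly; case: ifP => lt; last exact: (rmorph0 (fenv_ev e)).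
  transitivity ((ev e (Nt * map_poly cst C))`_l); first by rewrite coef_map.
  rewrite /ev rmorphM /= [map_poly _ (map_poly _ _)]ev_up.
  apply: (coefM_trunc lt) => // j lj; rewrite coef_map !coef_take_poly lj.
  by rewrite coef_map.
by have := @err_value e c Jp i Ji; rewrite /xi; apply: etrans.
Qed.

End Decoder.

(** * The code *)

Section Levels.
Variables (K : fieldType) (c : nat -> K) (pts : nat -> nat -> K) (n0 k : nat).
Local Notation s := (2 * n0)%N.
Hypothesis n0_gt0 : (0 < n0)%N.
Hypothesis pts_neq0 : forall l i, (l <= k)%N -> (i < s * 2 ^ l)%N -> pts l i != 0.
Hypothesis pts_parent : forall l i, (l < k)%N -> (i < s * 2 ^ l.+1)%N ->
  (pts l.+1 i - c l) ^+ 2 = pts l i./2 * pts l.+1 i.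
Hypothesis pts_inj : forall l i j, (l <= k)%N -> (i < s * 2 ^ l)%N -> (j < s * 2 ^ l)%N ->
  pts l i = pts l j -> i = j.

(* Words of level [l] are indexed by the points of level [l]; the [b]-th word of
   level [l.+1] stands for [X^(n-1) (f0 (psi) + X f1 (psi))], where
   [psi = (X - c l)^2 / X], [n = n0 * 2^l], and where [f0], [f1] are the words of
   level [l] of indices [2 b] and [2 b + 1]. *)
Definition wt l i j : K := pts l.+1 i ^+ ((n0 * 2 ^ l).-1 + j).

Section Lev.
Variables (A : comNzRingType) (g : K -> A).
Implicit Type v : nat -> nat -> A.

Definition fwd l v b i : A :=
  g (wt l i 0) * v (2 * b)%N i./2 + g (wt l i 1) * v (2 * b).+1 i./2.

Fixpoint lev l v := if l is l'.+1 then fwd l' (lev l' v) else v.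

(** Inverse of the two by two system that [fwd] forms at the siblings [2 i] and [2 i + 1], whose
    determinant is a nonzero multiple of [x' - x]. *)
Definition bwt l i b i' : K :=
  let x := pts l.+1 (2 * i)%N in let x' := pts l.+1 (2 * i).+1 in
  if i' then (if b then 1 else - x) / (wt l (2 * i).+1 0 * (x' - x))
  else (if b then - 1 else x') / (wt l (2 * i) 0 * (x' - x)).

Definition bwd l v b i : A :=
  g (bwt l i (odd b) false) * v b./2 (2 * i)%N + g (bwt l i (odd b) true) * v b./2 (2 * i).+1.

Fixpoint blev l v := if l is l'.+1 then blev l' (bwd l' v) else v.

Definition eqd nb l v v' := forall b i, (b < nb)%N -> (i < s * 2 ^ l)%N -> v b i = v' b i.

End Lev.

Lemma half_lt i l : (i < s * 2 ^ l.+1)%N -> (i./2 < s * 2 ^ l)%N.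
Proof. by rewrite expnS mulnCA -[i in (i < _)%N]odd_double_half -mul2n; move: (s * _)%N => N; lia. Qed.

Lemma dbl_lt i l : (i < s * 2 ^ l)%N -> (2 * i < s * 2 ^ l.+1)%N /\ ((2 * i).+1 < s * 2 ^ l.+1)%N.
Proof. by rewrite expnS [(s * (2 * _))%N]mulnCA; move: (s * _)%N => N; lia. Qed.

Section Inverse.
Variables (A : comNzRingType) (g : {rmorphism K -> A}).
Implicit Type v : nat -> nat -> A.

Lemma fwd_ext nb l v v' : eqd (2 * nb) l v v' -> eqd nb l.+1 (fwd g l v) (fwd g l v').
Proof. by move=> e b i lb /half_lt li; rewrite /fwd !e //; lia. Qed.

Lemma bwd_ext nb l v v' : eqd nb l.+1 v v' -> eqd (2 * nb) l (bwd g l v) (bwd g l v').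
Proof.
move=> e b i lb /dbl_lt [l1 l2]; have lb2 : (b./2 < nb)%N.
  by move: lb; rewrite -[b in (b < _)%N]odd_double_half -mul2n; lia.
by rewrite /bwd !e.
Qed.

Lemma wt_neq0 l i : (l < k)%N -> (i < s * 2 ^ l.+1)%N -> wt l i 0 != 0.
Proof. by move=> lk li; rewrite expf_neq0 // pts_neq0. Qed.

Lemma wt_step l i : wt l i 1 = wt l i 0 * pts l.+1 i.
Proof. by rewrite /wt addn0 addn1 exprSr. Qed.

Lemma pts_sib l i : (l < k)%N -> (i < s * 2 ^ l)%N ->
  pts l.+1 (2 * i).+1 - pts l.+1 (2 * i)%N != 0.
Proof.
move=> lk /dbl_lt [l1 l2]; rewrite subr_eq0; apply/eqP => e.
by have := @pts_inj l.+1 _ _ lk l2 l1 e; lia.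
Qed.

Lemma bwd_fwd l v b i : (l < k)%N -> (i < s * 2 ^ l)%N -> bwd g l (fwd g l v) b i = v b i.
Proof.
move=> lk li; have [l1 l2] := dbl_lt li; have d0 := pts_sib lk li.
have w1 := wt_neq0 lk l1; have w2 := wt_neq0 lk l2.
have h1 : (2 * i)./2 = i by rewrite mul2n doubleK.
have h2 : (2 * i).+1./2 = i by rewrite mul2n /= uphalf_double.
rewrite /bwd /fwd h1 h2 !wt_step.
have eb : v b i = if odd b then v (2 * b./2).+1 i else v (2 * b./2)%N i.
  by rewrite -{1}[b]odd_double_half mul2n; case: (odd b).
rewrite eb /bwt; move: d0 w1 w2.
set x := pts l.+1 (2 * i)%N; set x' := pts l.+1 (2 * i).+1.
set p := wt l (2 * i) 0; set q := wt l (2 * i).+1 0 => d0 w1 w2.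
set y := v (2 * b./2)%N i; set z := v (2 * b./2).+1 i.
have lin (a a' u u' t t' : K) : g a * (g u * y + g t * z) + g a' * (g u' * y + g t' * z) =
    g (a * u + a' * u') * y + g (a * t + a' * t') * z.
  by rewrite !rmorphD !rmorphM; ring.
rewrite lin; case: (odd b).
  have -> : -1 / (p * (x' - x)) * p + 1 / (q * (x' - x)) * q = 0 by field; rewrite w1 w2 d0.
  have -> : -1 / (p * (x' - x)) * (p * x) + 1 / (q * (x' - x)) * (q * x') = 1 by field; rewrite w1 w2 d0.
  by rewrite rmorph0 rmorph1 mul0r mul1r add0r.
have -> : x' / (p * (x' - x)) * p + - x / (q * (x' - x)) * q = 1 by field; rewrite w1 w2 d0.
have -> : x' / (p * (x' - x)) * (p * x) + - x / (q * (x' - x)) * (q * x') = 0 by field; rewrite w1 w2 d0.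
by rewrite rmorph0 rmorph1 mul0r mul1r addr0.
Qed.

Lemma fwd_bwd l v b i : (l < k)%N -> (i < s * 2 ^ l.+1)%N -> fwd g l (bwd g l v) b i = v b i.
Proof.
move=> lk li; have lh := half_lt li; have [l1 l2] := dbl_lt lh; have d0 := pts_sib lk lh.
have w1 := wt_neq0 lk l1; have w2 := wt_neq0 lk l2.
have o1 : odd (2 * b) = false by rewrite mul2n odd_double.
have o2 : odd (2 * b).+1 by rewrite /= o1.
have h1 : (2 * b)./2 = b by rewrite mul2n doubleK.
have h2 : (2 * b).+1./2 = b by rewrite mul2n /= uphalf_double.
rewrite /fwd /bwd h1 h2 o1 o2 wt_step /bwt; move: d0 w1 w2; set j := i./2.
have ei : i = if odd i then (2 * j).+1 else (2 * j)%N.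
  by rewrite -{1}[i]odd_double_half mul2n; case: (odd i).
set x := pts l.+1 (2 * j)%N; set x' := pts l.+1 (2 * j).+1.
set p := wt l (2 * j) 0; set q := wt l (2 * j).+1 0 => d0 w1 w2.
set y := v b (2 * j)%N; set z := v b (2 * j).+1.
have lin (a a' u u' t t' : K) : g a * (g u * y + g t * z) + g a' * (g u' * y + g t' * z) =
    g (a * u + a' * u') * y + g (a * t + a' * t') * z.
  by rewrite !rmorphD !rmorphM; ring.
rewrite lin ei; case: (odd i); rewrite -/x -/x' -/p -/q.
  have -> : q * (x' / (p * (x' - x))) + q * x' * (- 1 / (p * (x' - x))) = 0 by field; rewrite w1 d0.
  have -> : q * (- x / (q * (x' - x))) + q * x' * (1 / (q * (x' - x))) = 1 by field; rewrite w2 d0.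
  by rewrite rmorph0 rmorph1 mul0r mul1r add0r.
have -> : p * (x' / (p * (x' - x))) + p * x * (- 1 / (p * (x' - x))) = 1 by field; rewrite w1 d0.
have -> : p * (- x / (q * (x' - x))) + p * x * (1 / (q * (x' - x))) = 0 by field; rewrite w2 d0.
by rewrite rmorph0 rmorph1 mul0r mul1r addr0.
Qed.

Lemma lev_ext nb l v v' : eqd (nb * 2 ^ l) 0 v v' -> eqd nb l (lev g l v) (lev g l v').
Proof.
elim: l nb => [|l IH] nb; first by rewrite muln1.
by rewrite expnS mulnA [(nb * 2)%N]mulnC => /IH; apply: fwd_ext.
Qed.

Lemma blev_ext nb l v v' : eqd nb l v v' -> eqd (nb * 2 ^ l) 0 (blev g l v) (blev g l v').
Proof.
elim: l nb v v' => [|l IH] nb v v'; first by rewrite muln1.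
by move=> /bwd_ext /IH; rewrite expnS mulnA [(nb * 2)%N]mulnC.
Qed.

Lemma blev_lev nb l v : (l <= k)%N -> eqd (nb * 2 ^ l) 0 (blev g l (lev g l v)) v.
Proof.
elim: l nb v => [|l IH] nb v lk //= b i lb li.
rewrite expnS mulnA [(nb * 2)%N]mulnC in lb.
rewrite -(IH (2 * nb)%N v (ltnW lk) b i lb li).
apply: (blev_ext (nb := (2 * nb)%N)) => // b' i' _ li'; exact: bwd_fwd.
Qed.

Lemma lev_blev nb l v : (l <= k)%N -> eqd nb l (lev g l (blev g l v)) v.
Proof.
elim: l nb v => [|l IH] nb v lk //= b i lb li.
rewrite -[RHS](fwd_bwd v b lk li).
by apply: fwd_ext lb li; apply: IH; apply: ltnW.
Qed.

End Inverse.

Section LevCost.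
Variables (R : comNzRingType) (cst : {rmorphism K -> R}).
Notation slc := (slc cst).
Notation sub := (sub cst).
Implicit Type v : nat -> nat -> R.

Definition lvset nb l v : R -> Prop :=
  bigor nb (fun b => bigor (s * 2 ^ l) (fun i => eq (v b i))).

Lemma known_lvset F nb l v b i : sub (lvset nb l v) F -> (b < nb)%N -> (i < s * 2 ^ l)%N ->
  known cst F (v b i).
Proof. by move=> h lb li; apply: h; exists b => //; exists i. Qed.

Lemma slc_comb F (a a' : K) (y z : R) : known cst F y -> known cst F z ->
  slc F 3 (eq (cst a * y + cst a' * z)).
Proof.
move=> ky kz; rewrite -[3%N]/(1 + (1 + 1))%N.
apply: slc_bind (slc_mul (known_cst _ _ a) ky) _.
apply: slc_bind (slc_mul (known_cst _ _ a') (known_sub (sub_l _ (@sub_refl _ _ _ _)) kz)) _.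
by apply: slc_add; left; [left; right | right].
Qed.

Lemma slc_lev F nb l v : sub (lvset (nb * 2 ^ l) 0 v) F ->
  slc F (l * (nb * (s * 2 ^ l) * 3)) (lvset nb l (lev cst l v)).
Proof.
elim: l nb => [|l IH] nb; first by rewrite muln1 => h; apply: slc_done.
rewrite expnS mulnA [(nb * 2)%N]mulnC => /IH h.
have -> : (l.+1 * (nb * (s * (2 * 2 ^ l)) * 3) = l * (2 * nb * (s * 2 ^ l) * 3) + nb * (s * 2 ^ l.+1 * 3))%N.
  by rewrite expnS; ring.
apply: slc_bind h _; apply: slc_all => b lb; apply: slc_all => i li.
have hh : sub (lvset (2 * nb) l (lev cst l v)) (setor F (lvset (2 * nb) l (lev cst l v))) by auto.
by apply: slc_comb; apply: (known_lvset hh); rewrite ?half_lt //; lia.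
Qed.

Lemma slc_blev F nb l v : sub (lvset nb l v) F ->
  slc F (l * (nb * (s * 2 ^ l) * 3)) (lvset (nb * 2 ^ l) 0 (blev cst l v)).
Proof.
elim: l nb v F => [|l IH] nb v F h.
  have -> : (nb * 2 ^ 0 = nb)%N by rewrite muln1.
  exact: slc_done.
have -> : (l.+1 * (nb * (s * 2 ^ l.+1) * 3) = 2 * nb * (s * 2 ^ l * 3) + l * (2 * nb * (s * 2 ^ l) * 3))%N.
  by rewrite expnS; ring.
apply: (@slc_bind _ _ _ _ _ (lvset (2 * nb) l (bwd cst l v))).
  apply: slc_all => b lb; apply: slc_all => i /dbl_lt [l1 l2].
  have lb2 : (b./2 < nb)%N by move: lb; rewrite -[b in (b < _)%N]odd_double_half -mul2n; lia.
  by apply: slc_comb; apply: (known_lvset h).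
have -> : (nb * 2 ^ l.+1 = 2 * nb * 2 ^ l)%N by rewrite expnS mulnCA mulnA.
by apply: IH; auto.
Qed.

End LevCost.

Lemma lev_poly l (v : nat -> nat -> K) : (l <= k)%N ->
    (forall b, exists2 f : {poly K}, (size f <= n0)%N & forall i, (i < s)%N -> v b i = f.[pts 0 i]) ->
  forall b, exists2 f : {poly K}, (size f <= n0 * 2 ^ l)%N &
    forall i, (i < s * 2 ^ l)%N -> lev id l v b i = f.[pts l i].
Proof.
move=> + hv; elim: l => [_|l IH lk] b; first by rewrite muln1; have := hv b; rewrite muln1.
set n := (n0 * 2 ^ l)%N; have n_gt0 : (0 < n)%N by rewrite muln_gt0 n0_gt0 expn_gt0.
have [f0 s0 e0] := IH (ltnW lk) (2 * b)%N; have [f1 s1 e1] := IH (ltnW lk) (2 * b).+1.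
(* This is [X^(n-1) f (psi)], a polynomial because [psi^j] has denominator [X^j] with [j < n]. *)
pose lift (f : {poly K}) : {poly K} := \sum_(j < n) f`_j *: (('X - (c l)%:P) ^+ (2 * j) * 'X^(n.-1 - j)).
have slift (f : {poly K}) : (size (lift f) <= (2 * n).-1)%N.
  apply: leq_trans (size_sum _ _ _) _; apply/bigmax_leqP => j _.
  apply: leq_trans (size_scale_leq _ _) _; rewrite size_mulXn ?expf_neq0 ?polyXsubC_eq0 //.
  by rewrite size_exp_XsubC; have := ltn_ord j; lia.
have elift (f : {poly K}) i : (i < s * 2 ^ l.+1)%N -> (size f <= n)%N ->
    (lift f).[pts l.+1 i] = pts l.+1 i ^+ n.-1 * f.[pts l i./2].
  move=> li sf; rewrite horner_sum (horner_coef_wide _ sf) mulr_sumr; apply: eq_bigr => j _.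
  rewrite hornerZ !hornerE exprM (pts_parent lk li) exprMn.
  have -> : pts l.+1 i ^+ n.-1 = pts l.+1 i ^+ (n.-1 - j) * pts l.+1 i ^+ j.
    by rewrite -exprD subnK // -ltnS prednK.
  rewrite /=; ring.
exists (lift f0 + lift f1 * 'X) => [|i li].
  have -> : (n0 * 2 ^ l.+1 = 2 * n)%N by rewrite expnS mulnCA.
  apply: leq_trans (size_polyD _ _) _; rewrite geq_max; apply/andP; split.
    by apply: leq_trans (slift f0) _; rewrite leq_pred.
  apply: leq_trans (size_polyMleq _ _) _; rewrite size_polyX addn2 /=.
  by apply: leq_ltn_trans (slift f1) _; rewrite ltn_predL muln_gt0.
rewrite /= /fwd e0 ?e1 ?half_lt // hornerD hornerM hornerX !elift // /wt addn0 addn1 -/n exprSr.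
by ring.
Qed.

End Levels.

Definition supp (K : fieldType) n (u : 'rV[K]_n) : {set 'I_n} := [set i | u 0 i != 0].

(** * Parameters of evaluation codes *)

Section EvaluationCode.
Variables (K : fieldType) (dim d : nat) (x : nat -> K).
Hypothesis x_inj : forall i j, (i < d)%N -> (j < d)%N -> x i = x j -> i = j.
Hypotheses (dim_gt0 : (0 < dim)%N) (dim_le : (dim <= d)%N).
Variable f : 'Hom('rV[K]_dim, 'rV[K]_d).
Hypothesis f_inj : injective f.
Hypothesis f_poly : forall m, exists2 p : {poly K}, (size p <= dim)%N & forall i, f m 0 i = p.[x i].

Lemma evaluation_weight m : m != 0 -> (d - dim + 1 <= #|supp (f m)|)%N.
Proof.
move=> m0; have [p sp ep] := f_poly m.
have p0 : p != 0.
  apply: contra_neq m0 => p0; apply: f_inj; rewrite linear0; apply/rowP => i.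
  by rewrite ep p0 horner0 mxE.
pose Z : {set 'I_d} := [set i | f m 0 i == 0].
have : (#|Z| < dim)%N.
  rewrite cardE -(size_map (fun i : 'I_d => x i)); apply: leq_trans sp; apply: max_poly_roots => //.
    by apply/allP => _ /mapP [i + ->]; rewrite mem_enum inE rootE ep.
  rewrite map_inj_uniq ?enum_uniq // => i j e; apply: val_inj; exact: x_inj e.
have := cardsC Z; rewrite card_ord.
have -> : ~: Z = supp (f m) by apply/setP => i; rewrite !inE.
by move: #|Z| #|supp _| => a b; lia.
Qed.

(** Vanishing at the first [dim - 1] positions imposes fewer conditions than the dimension. *)
Lemma low_weight : exists2 m, m != 0 & (#|supp (f m)| <= d - dim + 1)%N.
Proof.
have le : (dim.-1 <= d)%N by apply: leq_trans (leq_pred _) dim_le.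
pose M : 'M[K]_(dim, dim.-1) := \matrix_(i, j) f (delta_mx 0 i) 0 (widen_ord le j).
have : kermx M != 0.
  rewrite kermx_eq0 /row_free; apply/eqP => e.
  by have := rank_leq_col M; rewrite e -ltnS prednK // ltnn.
case/rowV0Pn => m /sub_kermxP mM m0; exists m => //.
have z (i : 'I_d) : (i < dim.-1)%N -> f m 0 i = 0.
  move=> lt; have := congr1 (fun A : 'rV_(dim.-1) => A 0 (Ordinal lt)) mM; rewrite !mxE => e.
  rewrite [m]row_sum_delta linear_sum /= summxE -[RHS]e; apply: eq_bigr => j _.
  by rewrite linearZ !mxE; congr (_ * f _ 0 _); apply: val_inj.
have sb : supp (f m) \subset ~: [set i : 'I_d | (i < dim.-1)%N].
  by apply/subsetP => i; rewrite !inE; apply: contraNN => /z ->.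
apply: leq_trans (subset_leq_card sb) _.
have := cardsC [set i : 'I_d | (i < dim.-1)%N]; rewrite card_ord.
have -> : #|[set i : 'I_d | (i < dim.-1)%N]| = dim.-1.
  have wi : injective (widen_ord le) by move=> i j /(congr1 val) /= e; apply: val_inj.
  rewrite -[RHS](card_ord dim.-1) -(card_imset predT wi).
  apply: eq_card => i; rewrite !inE; apply/idP/imsetP => [lt|[j _ ->]]; last by rewrite /= ltn_ord.
  by exists (Ordinal lt) => //; apply: val_inj.
by move: #|_| => a; lia.
Qed.

Lemma evaluation_code : linear_code dim (d - dim + 1) (limg f).
Proof.
split.
  have /eqP k0 : lker f == 0%VS by apply/lker0P.
  by rewrite limg_dim_eq ?k0 ?capv0 // dimvf; exact: mul1n.
have dist m1 m2 : hamming_dist (f m1) (f m2) = #|supp (f (m1 - m2))|.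
  by apply: eq_card => i; rewrite !inE linearB !mxE subr_eq0.
split.
  have [m m0 wm] := low_weight; exists (f m), (f 0); rewrite !memv_img ?memvf //; split=> //.
    by apply: contra_neq m0 => /f_inj.
  by rewrite dist subr0; apply/eqP; rewrite eqn_leq wm evaluation_weight.
move=> _ _ /memv_imgP [m1 _ ->] /memv_imgP [m2 _ ->] ne.
rewrite dist evaluation_weight // subr_eq0; by apply: contra_neq ne => ->.
Qed.

End EvaluationCode.

Lemma slc_slp (K : fieldType) n c G (fs : seq (fenv K n)) :
    slc (@fenv_cst K n) (@inputs K n) c G -> (forall h, h \in fs -> known (@fenv_cst K n) G h) ->
  exists2 P : slp K, (slp_cost P <= c)%N &
    forall e : 'rV[K]_n, slp_eval P (row_seq e) = Some [seq h e | h : fenv K n <- fs].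
Proof.
move=> hG hfs; pose xs := [seq @inp K n i | i : 'I_n].
have exs e : mem_at xs e = row_seq e.
  by rewrite /mem_at -map_comp; apply: eq_map => i /=; rewrite inpE.
have [_ [i lt <-]|code [zs [sz ev av]]] := slc_code (D := fun _ => True) hG (xs := xs).
  have := @avail_nth K n (fun _ => True) xs i; rewrite size_map -cardE card_ord.
  by rewrite (nth_map (Ordinal lt)) -?cardE ?card_ord // nth_enum_ord // => /(_ lt).
have [|os eos] := @operands_ev K n (fun _ => True) (xs ++ zs) fs.
  by move=> h /hfs; apply: avail_known.
exists (Slp code os) => // e; rewrite /slp_eval /= -exs ev //.
exact: eos.
Qed.

(** * Encoding and checking *)

Section TreeCode.
Variables (K : fieldType) (c : nat -> K) (pts : nat -> nat -> K) (n0 k : nat).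
Local Notation s := (2 * n0)%N.
Local Notation d := (s * 2 ^ k)%N.
Local Notation kk := (n0 * 2 ^ k)%N.
Hypothesis n0_gt0 : (0 < n0)%N.
Hypothesis pts_neq0 : forall l i, (l <= k)%N -> (i < s * 2 ^ l)%N -> pts l i != 0.
Hypothesis pts_parent : forall l i, (l < k)%N -> (i < s * 2 ^ l.+1)%N ->
  (pts l.+1 i - c l) ^+ 2 = pts l i./2 * pts l.+1 i.
Hypothesis pts_inj : forall l i j, (l <= k)%N -> (i < s * 2 ^ l)%N -> (j < s * 2 ^ l)%N ->
  pts l i = pts l j -> i = j.
Notation lev := (lev pts n0).
Notation blev := (blev pts n0).

Lemma blev_levK nb l (v : nat -> nat -> K) : (l <= k)%N ->
  eqd n0 (nb * 2 ^ l) 0 (blev id l (lev id l v)) v.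
Proof. exact: (@blev_lev K pts n0 k n0_gt0 pts_neq0 pts_inj K idfun). Qed.

Lemma lev_blevK nb l (v : nat -> nat -> K) : (l <= k)%N ->
  eqd n0 nb l (lev id l (blev id l v)) v.
Proof. exact: (@lev_blev K pts n0 k n0_gt0 pts_neq0 pts_inj K idfun). Qed.

Lemma blev_extK nb l (v v' : nat -> nat -> K) : eqd n0 nb l v v' ->
  eqd n0 (nb * 2 ^ l) 0 (blev id l v) (blev id l v').
Proof. exact: (@blev_ext K pts n0 n0_gt0 K idfun). Qed.

Lemma lev_extK nb l (v v' : nat -> nat -> K) : eqd n0 (nb * 2 ^ l) 0 v v' ->
  eqd n0 nb l (lev id l v) (lev id l v').
Proof. exact: (@lev_ext K pts n0 n0_gt0 K idfun). Qed.

Lemma lev_ev n l (v : nat -> nat -> fenv K n) (e : 'rV[K]_n) b i :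
  lev (@fenv_cst K n) l v b i e = lev id l (fun b i => v b i e) b i.
Proof.
elim: l b i => //= l IH b i; rewrite /fwd -!IH.
by [].
Qed.

Lemma blev_ev n l (v : nat -> nat -> fenv K n) (e : 'rV[K]_n) b i :
  blev (@fenv_cst K n) l v b i e = blev id l (fun b i => v b i e) b i.
Proof. by elim: l v b i => //= l IH v b i; rewrite IH. Qed.

Definition base_word (A : comNzRingType) (g : K -> A) (msg : nat -> A) b i : A :=
  \sum_(j < n0) g (pts 0 i ^+ j) * msg (b * n0 + j)%N.

Definition enc_coord i : fenv K kk :=
  lev (@fenv_cst K kk) k (base_word (@fenv_cst K kk) (@inp K kk)) 0 i.

Definition enc (m : 'rV[K]_kk) : 'rV[K]_d := \row_i enc_coord i m.

Lemma base_word_ev (m : 'rV[K]_kk) b i :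
  base_word (@fenv_cst K kk) (@inp K kk) b i m = base_word id (fun j => inp j m) b i.
Proof. by rewrite -[LHS]/(fenv_ev m _) rmorph_sum. Qed.

Lemma enc_coordE m i : enc_coord i m = lev id k (base_word id (fun j => inp j m)) 0 i.
Proof.
rewrite /enc_coord lev_ev.
by congr (lev _ _ _ _ _); apply/funext => b; apply/funext => j; rewrite base_word_ev.
Qed.

Lemma inp_linear n (a : K) (m m' : 'rV[K]_n) j : inp j (a *: m + m') = a * inp j m + inp j m'.
Proof. by rewrite /inp; case: insub => [i|]; rewrite ?mxE // mulr0 addr0. Qed.

Lemma lev_linear l (a : K) (u v w : nat -> nat -> K) :
    (forall b i, w b i = a * u b i + v b i) ->
  forall b i, lev id l w b i = a * lev id l u b i + lev id l v b i.
Proof. by move=> h; elim: l => //= l IH b i; rewrite /fwd !IH; ring. Qed.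

Lemma enc_linear : linear enc.
Proof.
move=> a m m'; apply/rowP => i; rewrite !mxE !enc_coordE; apply: lev_linear => b j.
rewrite /base_word mulr_sumr -big_split; apply: eq_bigr => t _ /=.
by rewrite inp_linear; ring.
Qed.

HB.instance Definition _ := GRing.isLinear.Build K 'rV[K]_kk 'rV[K]_d *:%R enc enc_linear.

Definition enc_hom : 'Hom('rV[K]_kk, 'rV[K]_d) := linfun enc.

Lemma enc_homE m i : enc_hom m 0 i = enc_coord i m.
Proof. by rewrite lfunE mxE. Qed.

Definition msg_poly (m : 'rV[K]_kk) b : {poly K} := \poly_(j < n0) inp (b * n0 + j) m.

Lemma base_word_poly m b i : base_word id (fun j => inp j m) b i = (msg_poly m b).[pts 0 i].
Proof.
rewrite horner_poly; apply: eq_bigr => j _; exact: mulrC.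
Qed.

Lemma enc_poly m : exists2 p : {poly K}, (size p <= kk)%N & forall i, enc_hom m 0 i = p.[pts k i].
Proof.
have hv b : exists2 f : {poly K}, (size f <= n0)%N &
    forall i, (i < s)%N -> base_word id (fun j => inp j m) b i = f.[pts 0 i].
  by exists (msg_poly m b) => [|i _]; [exact: size_poly | exact: base_word_poly].
have [p sp ep] := lev_poly n0_gt0 pts_parent (leqnn k) hv 0.
by exists p => // i; rewrite enc_homE enc_coordE ep.
Qed.

Lemma blev_enc m b i : (b < 2 ^ k)%N -> (i < s)%N ->
  blev id k (fun _ j => enc_coord j m) b i = (msg_poly m b).[pts 0 i].
Proof.
move=> lb li; rewrite -base_word_poly.
have lb' : (b < 1 * 2 ^ k)%N by rewrite mul1n.
have li' : (i < s * 2 ^ 0)%N by rewrite muln1.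
rewrite -(blev_levK (base_word id (fun j => inp j m)) (leqnn k) lb' li').
apply: (blev_extK _ lb' li') => -[|//] i' _ _.
by rewrite enc_coordE.
Qed.

Lemma pts0_inj i j : (i < s)%N -> (j < s)%N -> pts 0 i = pts 0 j -> i = j.
Proof. by move=> li lj; apply: pts_inj; rewrite ?muln1. Qed.

Lemma enc_inj : injective enc_hom.
Proof.
move=> m m' e; apply/rowP => i.
have ec j : (j < d)%N -> enc_coord j m = enc_coord j m'.
  by move=> lt; rewrite -(enc_homE m (Ordinal lt)) e enc_homE.
pose b := (i %/ n0)%N; have lb : (b < 2 ^ k)%N by rewrite ltn_divLR //; apply: leq_trans (ltn_ord i) _; rewrite mulnC.
have : msg_poly m b = msg_poly m' b.
  have le : (n0 <= s)%N by rewrite mul2n -addnn leq_addl.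
  apply: (@poly_eq_points K s (pts 0) pts0_inj) => [||j].
  - exact: leq_trans (size_poly _ _) le.
  - exact: leq_trans (size_poly _ _) le.
  rewrite -!blev_enc //.
  have lb' : (b < 1 * 2 ^ k)%N by rewrite mul1n.
  have li' : (j < s * 2 ^ 0)%N by rewrite muln1.
  by apply: (blev_extK _ lb' li') => b' i' _ lt; apply: ec.
move/(congr1 (fun p : {poly K} => p`_(i %% n0))); rewrite !coef_poly ltn_mod n0_gt0.
by rewrite -divn_eq !inpE.
Qed.

Definition enc_cost := (2 ^ k * (s * s) + k * (d * 3))%N.

Lemma slc_enc : slc (@fenv_cst K kk) (@inputs K kk) enc_cost (bigor d (fun i => eq (enc_coord i))).
Proof.
pose v := base_word (@fenv_cst K kk) (@inp K kk).
apply: (@slc_bind _ _ _ _ _ (lvset n0 (2 ^ k) 0 v)).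
  apply: slc_all => b lb; rewrite expn0 muln1; apply: slc_all => i li.
  rewrite /v /base_word; apply: (slc_dot (u := fun j => fenv_cst (pts 0 i ^+ j)) (v := fun j => inp (b * n0 + j))) => j lj.
    exact: known_cst.
  left; exists (b * n0 + j)%N => //.
  apply: (@leq_trans (b.+1 * n0)); first by rewrite mulSn addnC ltn_add2r.
  by rewrite mulnC leq_mul2l lb orbT.
have h := @slc_lev K pts n0 n0_gt0 _ (@fenv_cst K kk) (setor (@inputs K kk) (lvset n0 (2 ^ k) 0 v)) 1 k v.
rewrite !mul1n in h; apply: slc_out (h _) _; first exact: sub_r (@sub_refl _ _ _ _).
by apply: sub_bigor => i li _ <-; left; exists 0%N => //; exists i.
Qed.

Definition lag i j : K :=
  if insub j is Some l then @dual_coef K n0 (pts 0) (val l) * (@lagrange_num K n0 (pts 0) l).[pts 0 i] else 0.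

Lemma pts0_injl i j : (i < n0)%N -> (j < n0)%N -> pts 0 i = pts 0 j -> i = j.
Proof. by move=> li lj; apply: pts0_inj; lia. Qed.

Lemma lag_interp (y : nat -> K) i :
  (\sum_(j < n0) (@dual_coef K n0 (pts 0) (val j) * y j) *: (@lagrange_num K n0 (pts 0) j)).[pts 0 i] =
  \sum_(j < n0) lag i j * y j.
Proof.
rewrite horner_sum; apply: eq_bigr => j _.
by rewrite hornerZ mulrAC /lag valK.
Qed.

Definition unenc (A : comNzRingType) (g : K -> A) (w : nat -> A) b i : A := blev g k (fun _ j => w j) b i.

(** The word is taken back to the roots. A word of the lowest level has degree below [n0] when its
    last [n0] values are those interpolated from the first [n0]. *)
Definition check_coord b i : fenv K d :=
  unenc (@fenv_cst K d) (@inp K d) b (n0 + i)%N -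
  \sum_(j < n0) @fenv_cst K d (lag (n0 + i) j) * unenc (@fenv_cst K d) (@inp K d) b j.

Lemma check_coordE w b i : check_coord b i w =
  unenc id (fun j => inp j w) b (n0 + i)%N - \sum_(j < n0) lag (n0 + i) j * unenc id (fun j => inp j w) b j.
Proof.
rewrite -[LHS]/(fenv_ev w _) rmorphB rmorph_sum; congr (_ - _); first exact: blev_ev.
apply: eq_bigr => j _; rewrite rmorphM; congr (_ * _); exact: blev_ev.
Qed.

Lemma check_enc m b i : (b < 2 ^ k)%N -> (i < n0)%N -> check_coord b i (enc_hom m) = 0.
Proof.
move=> lb li; rewrite check_coordE.
have eu j : (j < s)%N -> unenc id (fun j => inp j (enc_hom m)) b j = (msg_poly m b).[pts 0 j].
  move=> lj; rewrite -blev_enc //.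
  have lb' : (b < 1 * 2 ^ k)%N by rewrite mul1n.
  have lj' : (j < s * 2 ^ 0)%N by rewrite muln1.
  apply: (blev_extK _ lb' lj') => b' i' _ lt.
  by rewrite -[i']/(val (Ordinal lt)) inpE enc_homE.
rewrite eu; last by lia.
rewrite (eq_bigr (fun j : 'I_n0 => lag (n0 + i) j * (msg_poly m b).[pts 0 j])) => [|j _]; last first.
  by rewrite eu //; have := ltn_ord j; lia.
rewrite -(lag_interp (fun j => (msg_poly m b).[pts 0 j])) lagrange_interp ?subrr //; first exact: pts0_injl.
exact: size_poly.
Qed.

Lemma check_mem w : (forall b i, (b < 2 ^ k)%N -> (i < n0)%N -> check_coord b i w = 0) ->
  w \in limg enc_hom.
Proof.
move=> h; pose y b := unenc id (fun j => inp j w) b.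
pose f b : {poly K} := \sum_(j < n0) (@dual_coef K n0 (pts 0) (val j) * y b j) *: (@lagrange_num K n0 (pts 0) j).
have fy b i : (b < 2 ^ k)%N -> (i < s)%N -> (f b).[pts 0 i] = y b i.
  move=> lb li; case: (ltnP i n0) => lin.
    exact: (@interp_value _ _ _ pts0_injl (fun j : 'I_n0 => y b j) (Ordinal lin)).
  have lt : (i - n0 < n0)%N by lia.
  by have /eqP := h _ _ lb lt; rewrite check_coordE subnKC // subr_eq0 => /eqP; rewrite lag_interp => <-.
pose m : 'rV[K]_kk := \row_t (f (t %/ n0)%N)`_(t %% n0).
have em b : (b < 2 ^ k)%N -> msg_poly m b = f b.
  move=> lb; apply/polyP => j; rewrite coef_poly; case: (ltnP j n0) => lj; last first.
    by rewrite nth_default // (leq_trans _ lj) //; apply: size_interp.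
  have lt : (b * n0 + j < kk)%N.
    apply: (@leq_trans (b.+1 * n0)); first by rewrite mulSn addnC ltn_add2r.
    by rewrite mulnC leq_mul2l lb orbT.
  rewrite -[(b * n0 + j)%N]/(val (Ordinal lt)) inpE mxE /=.
  by rewrite divnMDl // divn_small // addn0 modnMDl modn_small.
have -> : w = enc_hom m; last by rewrite memv_img // memvf.
apply/rowP => i; rewrite enc_homE enc_coordE -inpE.
have l0 : (0 < 1)%N by []. have li := ltn_ord i.
rewrite -(lev_blevK (fun _ j => inp j w) (leqnn k) l0 li).
apply: (lev_extK _ l0 li) => b j; rewrite mul1n muln1 => lb lj.
by rewrite base_word_poly em // fy.
Qed.

Definition check_cost := (k * (d * 3) + 2 ^ k * (n0 * (2 * n0 + 1)))%N.

Lemma slc_check : slc (@fenv_cst K d) (@inputs K d) check_cost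
  (bigor (2 ^ k) (fun b => bigor n0 (fun i => eq (check_coord b i)))).
Proof.
pose v b := unenc (@fenv_cst K d) (@inp K d) b.
apply: (@slc_bind _ _ _ _ _ (lvset n0 (2 ^ k) 0 v)).
  have h := @slc_blev K pts n0 n0_gt0 _ (@fenv_cst K d) (@inputs K d) 1 k (fun _ j => @inp K d j).
  rewrite !mul1n in h; apply: h; apply: sub_bigor => b _; apply: sub_bigor => i li.
  by move=> _ <-; left; exists i.
apply: slc_all => b lb; apply: slc_all => i li.
have kv j : (j < s)%N -> known (@fenv_cst K d) (setor (@inputs K d) (lvset n0 (2 ^ k) 0 v)) (v b j).
  by move=> lj; left; right; exists b => //; exists j; rewrite ?muln1.
apply: slc_bind (slc_dot (u := fun j => @fenv_cst K d (lag (n0 + i) j)) (v := fun j => v b j) _ _) _ => [j lj|j lj|].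
- exact: known_cst.
- by apply: kv; lia.
apply: slc_opp; first by apply: known_sub (sub_l _ (@sub_refl _ _ _ _)) (kv _ _); lia.
by left; right.
Qed.

Lemma tree_code_encodes : exists2 P : slp K, encodes kk P (limg enc_hom) & (slp_cost P <= enc_cost)%N.
Proof.
have [h|P cP eP] := slc_slp (fs := [seq enc_coord i | i : 'I_d]) slc_enc.
  by move=> /mapP [i _ ->]; left; exists i.
exists P => //; exists enc_hom; split=> // [|m]; first exact: enc_inj.
rewrite eP -map_comp; congr Some; apply: eq_map => i /=; by rewrite enc_homE.
Qed.

Lemma tree_code_checks : exists2 P : slp K, checks P (limg enc_hom) & (slp_cost P <= check_cost)%N.
Proof.
have [h|P cP eP] := slc_slp (fs := [seq check_coord b i | b <- iota 0 (2 ^ k), i <- iota 0 n0]) slc_check.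
  by move=> /allpairsP [[b i] /= [hb hi ->]]; left; exists b; [move: hb | exists i => //; move: hi]; rewrite mem_iota.
exists P => // w; eexists; first exact: eP.
apply/allP/idP => [h|/memv_imgP [m _ ->] _ /mapP [_ /allpairsP [[b i] /= [hb hi ->]] ->]].
  apply: check_mem => b i lb li; apply/eqP; apply: h; apply: (map_f (fun h : fenv K d => h w)).
  by apply/allpairsP; exists (b, i); rewrite !mem_iota.
by rewrite check_enc //; [move: hb | move: hi]; rewrite mem_iota.
Qed.

Lemma tree_code_linear : linear_code kk (kk + 1) (limg enc_hom).
Proof.
have := @evaluation_code K kk d (pts k) _ _ _ enc_hom enc_inj enc_poly.
have -> : (d - kk = kk)%N by rewrite -mulnA mul2n -addnn addKn.
apply=> [i j li lj||]; first exact: pts_inj.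
  by rewrite muln_gt0 n0_gt0 expn_gt0.
by rewrite -mulnA mul2n -addnn leq_addr.
Qed.

End TreeCode.

(** * Evaluation points *)

Section TreePoints.
Variables (K : finFieldType) (c : nat -> K) (G : {set K}) (k n : nat).
Hypothesis c_neq0 : forall l, (l < k)%N -> c l != 0.
Hypothesis G_neq0 : forall X0, X0 \in G -> X0 != 0.
Hypothesis G_split : forall X0 l X, X0 \in G -> (l < k)%N -> tree_node c X0 l X ->
  exists x, [/\ x != 0, (x - c l) ^+ 2 = X * x & x ^+ 2 != c l ^+ 2].
Hypothesis cardG : (n <= #|G|)%N.

Definition child l X : K :=
  odflt 0 [pick x | [&& x != 0, (x - c l) ^+ 2 == X * x & x ^+ 2 != c l ^+ 2]].

(** The nodes [2 i] and [2 i + 1] below a node are the roots [x] and [c^2 / x] of one quadratic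
    equation; they differ because [x^2 != c^2]. *)
Fixpoint tree_pts l i : K :=
  if l is l'.+1 then
    let x := child l' (tree_pts l' i./2) in if odd i then c l' ^+ 2 / x else x
  else nth 0 (enum G) i.

Lemma childP l X0 X : X0 \in G -> (l < k)%N -> tree_node c X0 l X ->
  let x := child l X in [/\ x != 0, (x - c l) ^+ 2 = X * x & x ^+ 2 != c l ^+ 2].
Proof.
move=> XG lk /(G_split XG lk) [x [x0 ex nx]]; rewrite /child; case: pickP => [y /and3P [y0 /eqP ey ny] //|/(_ x)].
by rewrite x0 ex eqxx nx.
Qed.

Lemma half_ltn l i : (i < n * 2 ^ l.+1)%N -> (i./2 < n * 2 ^ l)%N.
Proof. by rewrite ltn_half_double expnS mulnCA -mul2n. Qed.

Lemma tree_pts_node l i : (l <= k)%N -> (i < n * 2 ^ l)%N ->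
  exists2 X0, X0 \in G & tree_pts l i != 0 /\ tree_node c X0 l (tree_pts l i).
Proof.
elim: l i => [|l IH] i lk.
  rewrite muln1 => li; have gi : nth 0 (enum G) i \in G.
    by rewrite -mem_enum mem_nth // -cardE (leq_trans li).
  by exists (nth 0 (enum G) i) => //; split=> //; apply: G_neq0.
move=> /half_ltn li; have [X0 XG [nX tX]] := IH _ (ltnW lk) li; exists X0 => //=.
have [x0 ex _] := childP XG lk tX; set X := tree_pts l i./2 in nX tX x0 ex *.
set x := child l X in x0 ex *.
have c0 := c_neq0 lk.
have x'0 : c l ^+ 2 / x != 0 by rewrite mulf_neq0 ?invr_eq0 ?expf_neq0.
have e1 : (x - c l) ^+ 2 / x = X by rewrite ex mulfK.
have e2 : (c l ^+ 2 / x - c l) ^+ 2 / (c l ^+ 2 / x) = X.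
  by rewrite -e1; field; rewrite x0 c0.
by case: (odd i); rewrite ?e1 ?e2.
Qed.

Lemma tree_pts_neq0 l i : (l <= k)%N -> (i < n * 2 ^ l)%N -> tree_pts l i != 0.
Proof. by move=> lk li; have [? _ []] := tree_pts_node lk li. Qed.

Lemma tree_pts_parent l i : (l < k)%N -> (i < n * 2 ^ l.+1)%N ->
  (tree_pts l.+1 i - c l) ^+ 2 = tree_pts l i./2 * tree_pts l.+1 i.
Proof.
move=> lk /half_ltn li; have [X0 XG [nX tX]] := tree_pts_node (ltnW lk) li.
have [x0 ex _] := childP XG lk tX => /=; set x := child l _ in x0 ex *.
case: (odd i) => //; have -> : tree_pts l i./2 = (x - c l) ^+ 2 / x by rewrite ex mulfK.
by field.
Qed.

Lemma tree_pts_inj l i j : (l <= k)%N -> (i < n * 2 ^ l)%N -> (j < n * 2 ^ l)%N ->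
  tree_pts l i = tree_pts l j -> i = j.
Proof.
elim: l i j => [|l IH] i j lk.
  rewrite muln1 => li lj /eqP; rewrite nth_uniq ?enum_uniq -?cardE ?(leq_trans _ cardG) //.
  by move/eqP.
move=> li lj e; have hi := half_ltn li; have hj := half_ltn lj.
have eh : i./2 = j./2.
  apply: (IH _ _ (ltnW lk) hi hj); apply: (mulIf (tree_pts_neq0 lk li)).
  by rewrite -tree_pts_parent // e -tree_pts_parent.
have [X0 XG [nX tX]] := tree_pts_node (ltnW lk) hi.
have [x0 _ nx] := childP XG lk tX.
rewrite -[i]odd_double_half -[j]odd_double_half -eh; congr (nat_of_bool _ + _)%N.
move: e => /=; rewrite -eh; set x := child l _ in x0 nx *.
have nx' : c l ^+ 2 / x <> x by move=> e; case/eqP: nx; rewrite expr2 -[X in X * _]e mulfVK.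
by case: (odd i) (odd j) => [] [] // /esym.
Qed.

End TreePoints.

Lemma sqrt_floor q : exists s, (s ^ 2 <= q)%N /\ (q <= s * (s + 2))%N.
Proof.
elim: q => [|q [s [h1 h2]]]; first by exists 0%N.
case: (ltnP q (s * (s + 2))) => [lt|ge]; first by exists s; split; lia.
by exists s.+1; split; nia.
Qed.

Lemma two_neq0 (K : finFieldType) q : #|K| = q -> odd q -> prime_power q -> (2 : K) != 0.
Proof.
move=> cardK oddq [p [e [p_pr e0 eq]]].
have pcharK : p \in [pchar K] by apply: card_finPcharP p_pr; rewrite cardK eq.
apply/negP => /eqP z; have : 2%N \in [pchar K] by rewrite !inE /= z eqxx.
by rewrite (pcharf_eq pcharK) inE => /eqP p2; move: oddq; rewrite eq -p2 oddX; case: (e) e0.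
Qed.

(* [n0] is proportional to [M], so that naive interpolation at the [2 n0] roots
   costs [O(M)] operations per coordinate. *)
Lemma evaluation_points (K : finFieldType) q M : #|K| = q -> odd q -> prime_power q -> (0 < M)%N ->
    ((2 ^ M) ^ 4 %/ 4 <= q)%N -> ((2 * 2 ^ M + 1) ^ 2 + 1 <= q)%N ->
  exists n0 k, exists c : nat -> K, exists pts : nat -> nat -> K,
    [/\ (0 < n0)%N, (2 * n0 * 2 ^ k = 2 ^ M)%N & (2 * n0 + 3 * k <= 2048 * M)%N] /\
    [/\ forall l i, (l <= k)%N -> (i < 2 * n0 * 2 ^ l)%N -> pts l i != 0,
      forall l i, (l < k)%N -> (i < 2 * n0 * 2 ^ l.+1)%N ->
        (pts l.+1 i - c l) ^+ 2 = pts l i./2 * pts l.+1 i &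
      forall l i j, (l <= k)%N -> (i < 2 * n0 * 2 ^ l)%N -> (j < 2 * n0 * 2 ^ l)%N ->
        pts l i = pts l j -> i = j].
Proof.
move=> cardK oddq ppq M0 q4 q2; have [p [e [p_pr e0 eq]]] := ppq.
have pcharK : p \in [pchar K] by apply: card_finPcharP p_pr; rewrite cardK eq.
have p_q : p.-nat q by rewrite eq pnatX pnat_id.
have two0 := two_neq0 cardK oddq ppq.
(* There will be [2^a] roots. The factor 64 makes [64 * 2^k * (k + 1) <= d], the room that the point
   count of the tower needs. *)
pose a := up_log 2 (64 * M).
have a_ge : (64 * M <= 2 ^ a)%N by apply: up_logP.
have a1 : (0 < a)%N by case: (a) a_ge => [|//]; rewrite expn0; lia.
have a_lt : (2 ^ a < 128 * M)%N.
  have /andP [+ _] := @up_log_bounds 2 (64 * M) isT ltac:(lia).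
  by rewrite -[in (2 ^ a < _)%N](prednK a1) expnS -/a; move: (2 ^ a.-1)%N; clear; lia.
(* For small [d] there is no level: [d] is at most [2^11], the origin of the bound [2048 * M], and
   any [d] nonzero elements can serve as points. *)
have [aM|Ma] := leqP (a + 2) M; last first.
  have dM : (2 ^ M < 256 * M)%N by apply: leq_ltn_trans (_ : _ <= 2 ^ a.+1)%N _; [rewrite leq_exp2l; lia | rewrite expnS; lia].
  have M11 : (M <= 11)%N.
    rewrite leqNgt; apply/negP => M12; move: dM; rewrite ltnNge => /negP; apply.
    rewrite -(subnK M12) expnD; have := ltn_expl (M - 12) (isT : 1 < 2)%N; move: (2 ^ (M - 12))%N => N; lia.
  have d0 : (0 < 2 ^ M.-1)%N by rewrite expn_gt0.
  have dd : (2 * 2 ^ M.-1 = 2 ^ M)%N by rewrite -expnS prednK.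
  have cG : (2 * 2 ^ M.-1 <= #|[set~ (0%R : K)]|)%N.
    by rewrite cardsC1 cardK dd; move: q2; move: (2 ^ M)%N => D; lia.
  exists (2 ^ M.-1)%N, 0%N, (fun=> 0), (tree_pts (fun=> 0) [set~ 0]).
  have H : forall X0 : K, X0 \in [set~ 0] -> X0 != 0 by move=> X0; rewrite !inE.
  split; first split=> //; first by rewrite muln1.
    rewrite dd; have : (2 ^ M <= 2 ^ 11)%N by rewrite leq_exp2l.
    by move: (2 ^ M)%N => D; lia.
  split=> [l i lk|//|l i j lk].
    by apply: (@tree_pts_neq0 _ _ _ 0).
  exact: (@tree_pts_inj _ _ _ 0).
pose k := (M - a)%N; have eM : (M = a + k)%N by rewrite /k; lia.
have [s [s_le q_le]] := sqrt_floor q.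
have s_ge : (2 ^ (2 * M - 1) <= s)%N.
  have eq4 : ((2 ^ M) ^ 4 %/ 4 = (2 ^ (2 * M - 1)) ^ 2)%N.
    rewrite -!expnM; have -> : (M * 4 = (2 * M - 1) * 2 + 2)%N by lia.
    by rewrite expnD mulnK.
  rewrite eq4 in q4; rewrite leqNgt; apply/negP => lt.
  have : (s.+1 ^ 2 <= q)%N by apply: leq_trans q4; rewrite leq_exp2r.
  by move: q_le; clear; nia.
have M12 : (11 < M)%N.
  rewrite ltnNge; apply/negP => M11.
  have : (2 ^ (a + 2) <= 2 ^ M)%N by rewrite leq_exp2l.
  rewrite expnD => h; have {}h : (256 * M <= 2 ^ M)%N by move: h a_ge; move: (2 ^ a)%N (2 ^ M)%N => A D; lia.
  have /allP /(_ M) : all (fun j => (2 ^ j < 256 * j)%N) (iota 1 11) by [].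
  by rewrite mem_iota M0 ltnS M11 ltnNge h => /(_ isT).
have eD : (2 ^ (2 * M - 1) * 2 = (2 ^ a * 2 ^ k) ^ 2)%N.
  by rewrite -expnD -eM -expnM -expnSr; congr (2 ^ _)%N; lia.
have bigA : (2 ^ 4 <= 2 ^ M)%N by rewrite leq_exp2l // ltnW // (leq_trans _ M12).
have eDD : (2 ^ M = 2 ^ a * 2 ^ k)%N by rewrite -expnD -eM.
have D2 : ((2 ^ M) ^ 2 <= 2 * s)%N by rewrite eDD -eD mulnC leq_mul2l s_ge orbT.
have s_ge10 : (1000 <= s)%N by apply: (@leq_trans (2 ^ 10)) => //; apply: leq_trans s_ge; rewrite leq_exp2l //; lia.
have [|||al [rh [xx [vv ch]]]] := @iso_chain_ex K p q s k.+1 pcharK cardK p_q two0 _ s_le q_le.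
- by move: s_ge10; clear; lia.
- by rewrite /k; lia.
(* Squared, this gives [4096 N <= 2 s] for [N = (2^k (k + 1))^2], whereas the chain requires
   [272 N (s + 2) < q]. *)
- have h : (64 * (2 ^ k * k.+1) <= 2 ^ M)%N.
    rewrite eDD mulnCA [X in (_ <= X)%N]mulnC leq_mul2l; apply/orP; right.
    by apply: leq_trans a_ge; rewrite leq_mul2l /=; move: a1 eM; clear; lia.
  have -> : (4 ^ k.+1 = 4 * (2 ^ k) ^ 2)%N by rewrite expnS -expnM (mulnC k) expnM.
  have {}h : (4096 * (2 ^ k * k.+1) ^ 2 <= 2 * s)%N.
    by apply: leq_trans D2; rewrite -[4096%N]/(64 ^ 2)%N -expnMn leq_exp2r.
  have -> : (4 * (2 ^ k) ^ 2 * (2 * k.+1) * (17 * (2 * k.+1) * (s + 2)) = 272 * (2 ^ k * k.+1) ^ 2 * (s + 2))%N.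
    by clear; ring.
  move: h s_ge10 s_le; move: ((2 ^ k * k.+1) ^ 2)%N => N; clear => h s10 sq; apply: leq_trans sq.
  rewrite -[(s ^ 2)%N]/(s * s)%N.
  have : (4096 * N * (s + 2) <= 2 * s * (s + 2))%N by rewrite leq_mul2r h orbT.
  have s10' : (10 <= s)%N by apply: leq_trans s10.
  by have : (10 * s <= s * s)%N; [rewrite leq_mul2r s10' orbT | move: h s10'; clear; nia].
have k1 : (1 < k)%N by rewrite /k; lia.
have [|G [hG cG]] := tree_roots pcharK cardK p_q two0 _ s_le q_le ch k1.
  by move: s_ge10; clear; lia.
have ea : (2 * 2 ^ a.-1 = 2 ^ a)%N.
  by rewrite -expnS prednK.
have cardG : (2 * 2 ^ a.-1 <= #|G|)%N.
  rewrite ea leqNgt; apply/negP => lt.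
  have h1 : (2 * ((#|G| + 1) * 2 ^ k) <= 2 * 2 ^ M)%N by rewrite leq_mul2l /= eDD leq_mul2r addn1 lt orbT.
  have h2 : (2 ^ k <= 2 ^ M)%N by rewrite leq_exp2l // eM leq_addl.
  have h3 : (2 ^ M <= s)%N by move: D2 bigA; clear; move: (2 ^ M)%N => D; nia.
  have h4 : (100 <= s)%N by apply: leq_trans s_ge10.
  have h5 : (100 * s <= s ^ 2)%N by rewrite leq_mul2r h4 orbT.
  by move: cG s_le h1 h2 h3 h4 h5; rewrite expnS; move: (2 ^ k)%N (2 ^ M)%N (s ^ 2)%N #|G|; clear; lia.
have c0 l : (l < k)%N -> chain_c al rh l != 0.
  by move=> lk; apply: (chain_c_neq0 two0 ch); lia.
exists (2 ^ a.-1)%N, k, (chain_c al rh), (tree_pts (chain_c al rh) G).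
have h1 X0 : X0 \in G -> X0 != 0 by case/hG.
have h2 X0 l X : X0 \in G -> (l < k)%N -> tree_node (chain_c al rh) X0 l X ->
  exists x, [/\ x != 0, (x - chain_c al rh l) ^+ 2 = X * x & x ^+ 2 != chain_c al rh l ^+ 2].
  by case/hG => _; apply.
split; first split.
- by rewrite expn_gt0.
- by rewrite ea eDD.
- by rewrite ea; move: a_lt eM; move: (2 ^ a)%N; clear; lia.
by split=> [l i|l i|l i j]; [apply: (tree_pts_neq0 c0) | apply: (tree_pts_parent c0) | apply: (tree_pts_inj c0)].
Qed.

(** * Costs *)

(** [222 = 27 + 130 + 65], the coefficients of [ss_rate]. *)
Lemma ss_rate_le m i : (i <= m)%N -> (ss_rate i <= 222 * (m.+1 * (trunc_log 2 m.+1).+1))%N.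
Proof.
move=> le; rewrite /ss_rate.
have h : (trunc_log 2 i <= trunc_log 2 m.+1)%N by apply: leq_trunc_log; rewrite leqW.
have h1 : (i * (trunc_log 2 i).+1 <= m.+1 * (trunc_log 2 m.+1).+1)%N by rewrite leq_mul // leqW.
have h2 : (m.+1 <= m.+1 * (trunc_log 2 m.+1).+1)%N by rewrite leq_pmulr.
have h3 : (65 * (i == 0%N) <= 65 * m.+1)%N by case: eqP => _; clear; lia.
by move: h1 h2 h3; rewrite -mulnA; move: (i * _)%N (m.+1 * _)%N (65 * _)%N; clear -le; lia.
Qed.

Section CostBounds.
Variables (W n : nat).
Hypothesis mul_le : forall j, (j <= n)%N -> (mul_cost j <= 2 ^ j * W)%N.
Hypothesis W_gt0 : (0 < W)%N.

Lemma eval_cost_le j : (j <= n)%N -> (eval_cost j <= 5 * W * (j * 2 ^ j))%N.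
Proof.
elim: j => //= j IH lt; have := IH (ltnW lt); have := mul_le lt; rewrite expnS.
move: (mul_cost _) (eval_cost _) (2 ^ j)%N W_gt0 => x y z; clear; nia.
Qed.

Lemma fracnum_cost_le j : (j <= n)%N -> (fracnum_cost j <= 3 * W * (j * 2 ^ j))%N.
Proof.
elim: j => //= j IH lt; have := IH (ltnW lt); have := mul_le lt; rewrite expnS.
move: (mul_cost _) (fracnum_cost _) (2 ^ j)%N W_gt0 => x y z; clear; nia.
Qed.

Lemma pm_cost_le j : (j < n)%N -> (pm_cost j <= 36 * W * (j.+1 * 2 ^ j))%N.
Proof.
elim: j => [|j IH] lt /=; first by move: W_gt0; clear; lia.
have := IH (ltnW lt); have := mul_le lt; rewrite !expnS.
move: (mul_cost _) (pm_cost _) (2 ^ j)%N W_gt0 => x y z; clear; nia.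
Qed.

End CostBounds.

(** In units of [W (m + 2) 2^m], the sum of fractions takes 12, the approximant basis 72, and each
    of the two evaluations 20; the linear terms and the last product fit in what remains of
    [144 = 36 * 4]. *)
Lemma dec_cost_le m :
  (dec_cost m <= 36 * (222 * (m.+2 ^ 2 * (trunc_log 2 m.+2).+1 * 2 ^ m.+2)))%N.
Proof.
pose W := (222 * (m.+1 * (trunc_log 2 m.+1).+1))%N.
have hm j : (j <= m.+2)%N -> (mul_cost j <= 2 ^ j * W)%N.
  by move=> le; rewrite leq_mul2l ss_rate_le ?orbT //; lia.
have W0 : (0 < W)%N by rewrite !muln_gt0.
have W_le : (W * m.+2 <= 222 * (m.+2 ^ 2 * (trunc_log 2 m.+2).+1))%N.
  rewrite /W -mulnA leq_mul2l /= mulnAC -mulnn leq_mul //.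
    by rewrite leq_mul.
  by rewrite ltnS leq_trunc_log.
have h1 := fracnum_cost_le hm W0 (leqnn _).
have h2 := pm_cost_le hm W0 (ltnSn _).
have h3 := eval_cost_le hm W0 (leqnn _).
have h4 := hm _ (leqnSn _).
apply: (@leq_trans (36 * (W * m.+2) * 2 ^ m.+2)); last first.
  have := W_le; rewrite -(leq_pmul2r (expn_gt0 2 m.+2)).
  by move: (W * _)%N (_ * (trunc_log _ _).+1)%N (2 ^ _)%N; clear; nia.
clear W_le; clearbody W.
have h5 : (2 * 2 ^ m <= W * m.+2 * 2 ^ m)%N by rewrite leq_mul2r (leq_trans _ (leq_pmull m.+2 W0)) ?orbT.
have h6 : (2 * (2 ^ m * W) <= W * m.+2 * 2 ^ m)%N by rewrite mulnCA mulnC leq_mul2r mulnC leq_mul2l; rewrite ?orbT.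
move: h1 h2 h3 h4 h5 h6; rewrite /dec_cost !expnS.
move: (fracnum_cost _) (pm_cost _) (eval_cost _) (mul_cost _) (2 ^ m)%N => x y z t D; clear.
have -> : (3 * W * (m.+2 * (2 * (2 * D))) = 12 * (W * m.+2 * D))%N by ring.
have -> : (36 * W * (m.+2 * (2 * D)) = 72 * (W * m.+2 * D))%N by ring.
have -> : (5 * W * (m.+2 * (2 * (2 * D))) = 20 * (W * m.+2 * D))%N by ring.
have -> : (36 * (W * m.+2) * (2 * (2 * D)) = 144 * (W * m.+2 * D))%N by ring.
rewrite -mulnA; move: (D * W)%N (W * m.+2 * D)%N => A B; lia.
Qed.

Lemma decoder (K : fieldType) m d (x : nat -> K) : (2 : K) != 0 -> d = (2 ^ m.+1)%N ->
    (forall i j, (i < d)%N -> (j < d)%N -> x i = x j -> i = j) -> (forall i, (i < d)%N -> x i != 0) ->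
  exists2 T : ctree K, (ctree_cost T <= 36 * (222 * (m.+1 ^ 2 * (trunc_log 2 m.+1).+1 * 2 ^ m.+1)))%N &
    forall w c : 'rV[K]_d, (exists2 f : {poly K}, (size f <= 2 ^ m)%N & forall i, c 0 i = f.[x i]) ->
      (4 * hamming_dist w c <= d)%N -> ctree_eval T (row_seq w) = Some (row_seq c).
Proof.
move=> two0 ed x_inj x_neq0; pose xs := [seq @inp K d i | i : 'I_d].
have exs (e : 'rV[K]_d) : mem_at xs e = row_seq e.
  by rewrite /mem_at -map_comp; apply: eq_map => i /=; rewrite inpE.
have av (D : 'rV[K]_d -> Prop) h : inputs h -> avail D xs h.
  move=> [i lt <-]; have := @avail_nth K d D xs i; rewrite size_map -cardE card_ord.
  by rewrite (nth_map (Ordinal lt)) -?cardE ?card_ord // nth_enum_ord // => /(_ lt).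
(* For [d = 2] no error is allowed, and the tree returns its input. *)
case: m ed => [|m] ed.
  have [h hx|os eos] := @operands_ev K d (fun=> True) xs xs.
    by case/mapP: hx => i _ ->; apply: av; exists i.
  exists (Return os) => // w c _ hc; rewrite /= -exs eos // exs; congr (Some (row_seq _)).
  have /eqP : #|[set i : 'I_d | w 0 i != c 0 i]| = 0%N.
    by move: hc; rewrite /hamming_dist [X in (_ <= X)%N]ed; move: #|_|; clear; case=> //; lia.
  rewrite cards_eq0 => /eqP e0; apply/rowP => i; apply/eqP; apply: contraT => ne.
  by have : i \in [set i : 'I_d | w 0 i != c 0 i]; [rewrite inE | rewrite e0 inE].
subst d; have [T cT eT] := @tcan_decode K m x two0 x_inj x_neq0 xs (av _).
exists T; first exact: leq_trans cT (dec_cost_le m).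
move=> w c pc hc; have nc : near_codeword x w c by split.
have [s es hs] := eT w (ex_intro _ c nc).
by rewrite -exs es (hs c nc).
Qed.

Lemma ln2_ge (R : realType) : 2^-1 <= ln 2 :> R.
Proof.
have := @le_ln1Dx R (- 2^-1) ltac:(lra).
have -> : 1 + - 2^-1 = 2^-1 :> R by lra.
by rewrite lnV ?posrE //; lra.
Qed.

Lemma ln2X (R : realType) M : ln (2 ^ M)%N%:R = ln 2 *+ M :> R.
Proof. by rewrite natrX lnXn. Qed.

Lemma exponent_le (R : realType) M : M%:R <= 2 * ln (2 ^ M)%N%:R :> R.
Proof.
rewrite ln2X -[ln 2 *+ M]mulr_natl; have := ln2_ge R; have : 0 <= M%:R :> R by [].
nra.
Qed.

(** Let [mx] be the maximum and [t] the truncated logarithm. As [1/2 <= ln 2 <= 1], one has [t / 2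
    <= ln M <= ln (ln d) + ln 2 <= 2 mx]; hence [t <= 4 mx], and [t + 1 <= 5 mx]. *)
Lemma trunc_log_le (R : realType) M : (0 < M)%N ->
  (trunc_log 2 M).+1%:R <= 5 * Num.max 1 (ln (ln (2 ^ M)%N%:R)) :> R.
Proof.
move=> M0; set t := trunc_log 2 M; set mx := Num.max _ _.
have l2 := ln2_ge R; have l2' : 0 < ln 2 :> R by lra.
have m1 : 1 <= mx by rewrite le_max lexx.
have m2 : ln (ln (2 ^ M)%N%:R) <= mx by rewrite le_max lexx orbT.
have ht : ln (2 ^ t)%N%:R <= ln M%:R :> R.
  by rewrite ler_ln ?posrE ?ltr0n ?expn_gt0 // ler_nat trunc_logP.
have hm : ln M%:R - ln 2 <= ln (ln (2 ^ M)%N%:R) :> R.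
  rewrite ln2X -ln_div ?posrE ?ltr0n //; rewrite ler_ln ?posrE ?divr_gt0 ?ltr0n ?mulrn_wgt0 //.
  rewrite -[ln 2 *+ M]mulr_natl ler_pM2l ?ltr0n //; lra.
have l1 : ln 2 <= 1 :> R by have := @le_ln1Dx R 1 ltac:(lra); rewrite -[1 + 1]/2.
move: ht; rewrite ln2X -[ln 2 *+ t]mulr_natl -natr1 => ht.
have t0 : 0 <= t%:R :> R by [].
nra.
Qed.

Theorem theorem9 (R : realType) :
  exists2 Q : R, 0 < Q &
  forall (d q : nat),
    (2 <= d)%N -> (exists m : nat, d = (2 ^ m)%N) ->
    odd q -> prime_power q ->
    (maxn (d ^ 4 %/ 4) ((2 * d + 1) ^ 2 + 1) <= q)%N ->
  forall K : finFieldType, #|K| = q ->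
  exists C : {vspace 'rV[K]_d},
    [/\ linear_code (d %/ 2) (d %/ 2 + 1) C,
        exists2 P : slp K, encodes (d %/ 2) P C &
          (slp_cost P)%:R <= Q * d%:R * ln d%:R,
        exists2 P : slp K, checks P C &
          (slp_cost P)%:R <= Q * d%:R * ln d%:R
      & exists2 T : ctree K, corrects T C d 4 &
          (ctree_cost T)%:R
            <= Q * d%:R * ln d%:R ^+ 2 * Num.max 1 (ln (ln d%:R))].
Proof.
(* [36 * 222] comes from the decoder, and [20 = 2^2 * 5] from [M <= 2 ln d] and the bound on the
   iterated logarithm. This also exceeds the [2 * 2048] that encoding and checking require. *)
exists (36 * 222 * 20) => [|d q d2 [M eD] oddq ppq]; first by rewrite !mulr_gt0.
rewrite geq_max => /andP [q4 q2] K cardK.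
have M0 : (0 < M)%N by case: M eD => // eD; rewrite eD in d2.
have two0 := two_neq0 cardK oddq ppq.
rewrite eD in q4 q2.
have [n0 [k [c [pts [[n0_gt0 ed cost] [pts_neq0 pts_parent pts_inj]]]]]] := evaluation_points cardK oddq ppq M0 q4 q2.
have {}eD : d = (2 * n0 * 2 ^ k)%N by rewrite ed.
subst d.
have -> : (2 * n0 * 2 ^ k %/ 2 = n0 * 2 ^ k)%N by rewrite -mulnA mulKn.
have exp_le := exponent_le R M; have log_le := trunc_log_le R M0; rewrite -ed in exp_le log_le.
set L := ln _ in exp_le log_le *; set mx := Num.max 1 _ in log_le *.
have L0 : 0 <= L by have : 0 <= M%:R :> R := ler0n _ _; lra.
have D0 : 0 <= (2 * n0 * 2 ^ k)%:R :> R := ler0n _ _.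
have lin (x : nat) : (x <= 2 * n0 * 2 ^ k * (2 * n0 + 3 * k))%N -> x%:R <= 36 * 222 * 20 * (2 * n0 * 2 ^ k)%:R * L.
  move=> /leq_trans/(_ (leq_mul (leqnn _) cost)); rewrite -(ler_nat R) => /le_trans; apply.
  by rewrite natrM [(2048 * M)%:R]natrM; nra.
have half : (n0 * (2 * n0 + 1) <= 2 * n0 * (2 * n0))%N by move: n0_gt0; clear; nia.
exists (limg (enc_hom pts n0 k)); split.
- exact: tree_code_linear n0_gt0 pts_neq0 pts_parent pts_inj.
- have [P eP cP] := tree_code_encodes n0_gt0 pts_neq0 pts_inj.
  exists P => //; apply: lin; apply: leq_trans cP _.
  by rewrite /enc_cost; move: (2 ^ k)%N; clear; nia.
- have [P eP cP] := tree_code_checks n0_gt0 pts_neq0 pts_inj.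
  exists P => //; apply: lin; apply: leq_trans cP _.
  rewrite /check_cost; have := leq_mul (leqnn (2 ^ k)) half.
  by move: (n0 * (2 * n0 + 1))%N (2 ^ k)%N; clear; nia.
have em : (2 * n0 * 2 ^ k = 2 ^ M.-1.+1)%N by rewrite prednK.
have [i j|i|T cT eT] := decoder two0 em (x := pts k).
- exact: pts_inj.
- exact: pts_neq0.
exists T => [w _ /memv_imgP [m _ ->] hc|].
  apply: eT => //; have [f sf ef] := enc_poly n0_gt0 pts_parent m.
  exists f => //; suff -> : (2 ^ M.-1 = n0 * 2 ^ k)%N by [].
  by apply/eqP; rewrite -(eqn_pmul2l (isT : 0 < 2)%N) -expnS prednK // -ed mulnA.
move: cT; rewrite -em prednK // -(ler_nat R) => /le_trans; apply.
have h : M%:R ^+ 2 * (trunc_log 2 M).+1%:R <= (2 * L) ^+ 2 * (5 * mx).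
  by apply: ler_pM; rewrite ?exprn_ge0 // ler_pXn2r ?nnegrE ?mulr_ge0.
move: D0 (h) => /ler_wpM2l /[apply]; move: (2 * n0 * 2 ^ k)%N => D; rewrite !natrM [M%:R ^+ 2]expr2.
by move: (M%:R * M%:R * _) (D%:R) => x y; lra.
Qed.
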